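(* Let $\mathbf a\in L^\infty((0,T)\times\mathbb R^N;\mathbb R^N)$ be such that a transport flow exists (e.g. $\mathbf a$ satisfies the OSLC condition). For any $\pi^T\in L^\infty_{loc}(\mathbb R^N)$ there exists a unique reversible solution $\pi\in\mathcal R^T$ with $\pi(T,\cdot)=\pi^T$. It is given by $\pi(t,x)=\pi^T(X^T(t,x))\,J(X^T)(t,x)$ for any transport flow $X^T$ (this expression is independent of the choice of $X^T$).
   Context: OSLC: $\langle \mathbf a(t,y)-\mathbf a(t,x),y-x\rangle\le\alpha(t)|y-x|^2$ for a.e. $(t,x,y)$, some $\alpha\in L^1_+(0,T)$. $\mathcal W^T$ denotes the set of $\pi\in C([0,T],L^\infty_{loc}(\mathbb R^N)\text{ weak-*})$ which satisfy $\partial_t\pi+\operatorname{div}(\mathbf a\pi)=0$ in the sense of distributions on $(0,T)\times\mathbb R^N$. A transport flow is a map $X^T\in\mathrm{Lip}([0,T]\times\mathbb R^N;\mathbb R^N)$ (globally Lipschitz) such that $\partial_tX^T+\mathbf a\cdot\nabla X^T=0$ a.e. in $(0,T)\times\mathbb R^N$ (componentwise, $\nabla$ the spatial gradient), $X^T(T,x)=x$ for all $x$, and $J(X^T)=\det(\nabla X^T_1,\dots,\nabla X^T_N)\ge0$ a.e. A reversible solution is $\pi\in\mathcal W^T$ such that for some transport flow $X^T$, $\pi(t,x)=\pi(T,X^T(t,x))\,J(X^T)(t,x)$ for all $t\in[0,T]$ and a.e. $x$ (the right side is well defined in $L^\infty_{loc}$ since, at fixed $t$, $J(X^T)=0$ a.e.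 on $\{x: X^T(t,x)\in Z\}$ whenever $|Z|=0$); $\mathcal R^T$ denotes the set of reversible solutions. *)

(* Defs.v *)
From HB Require Import structures.
From mathcomp Require Import all_boot all_order all_algebra.
From mathcomp Require Import all_classical all_reals all_analysis.
Set Implicit Arguments. Unset Strict Implicit. Unset Printing Implicit Defensive.
Import Order.TTheory GRing.Theory Num.Theory.
Import numFieldNormedType.Exports.
Local Open Scope classical_set_scope.
Local Open Scope ring_scope.

Section defs.
Variables (R : realType) (N : nat).

(** Euclidean space R^N, as row vectors (topology/norm from matrix_normedtype;
    the norm is the max-norm, equivalent to the Euclidean one). *)
Definition E := 'rV[R]_N.

Definition ME := g_sigma_algebraType (@open E).

Definition evec (j : 'I_N) : E := delta_mx 0 j.

Definition box (a b : E) : set ME := [set x : E | forall i, a 0 i < x 0 i <= b 0 i].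

(** lam is the N-dimensional Lebesgue measure (on Borel sets): it is
    determined by its values on boxes. *)
Definition is_lebesgue (lam : {measure set ME -> \bar R}) :=
  forall a b : E, (forall i, a 0 i <= b 0 i) ->
    lam (box a b) = (\prod_(i < N) (b 0 i - a 0 i))%:E.

Variable lam : {measure set ME -> \bar R}.

Definition st_ae (P : R -> E -> Prop) :=
  negligible (product_measure1 (@lebesgue_measure R) lam)
    (~` [set p : (R * ME)%type | P p.1 p.2]).

Definition Lloc (f : E -> R) :=
  measurable_fun setT (f : ME -> R) /\
  forall r : R, exists M : R, {ae lam, forall x : ME, `|x : E| <= r -> `|f x| <= M}.

Variable T : R.

Definition Linfty_st (a : R -> E -> E) :=
  (forall i : 'I_N, measurable_fun (`]0, T[ `*` setT)
      (fun p : (R * ME)%type => a p.1 p.2 0 i)) /\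
  exists M : R, st_ae (fun t x => 0 < t < T -> `|a t x| <= M).

Definition jac (X : R -> E -> E) (t : R) (x : E) : R :=
  \det (\matrix_(i < N, j < N) derive (fun y : E => X t y 0 i) x (evec j)).

Definition transport_flow (a : R -> E -> E) (X : R -> E -> E) :=
  (exists L : R, forall t s (x y : E), 0 <= t <= T -> 0 <= s <= T ->
      `|X t x - X s y| <= L * (`|t - s| + `|x - y|)) /\
  st_ae (fun t x => 0 < t < T -> forall i : 'I_N,
      derivable (fun s : R => X s x 0 i) t 1 /\
      (forall j, derivable (fun y : E => X t y 0 i) x (evec j)) /\
      derive (fun s : R => X s x 0 i) t 1 +
        \sum_(j < N) a t x 0 j * derive (fun y : E => X t y 0 i) x (evec j) = 0) /\
  (forall x, X T x = x) /\
  st_ae (fun t x => 0 < t < T -> 0 <= jac X t x).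

Definition iter_der (f : (R * E)%type -> R) (vs : seq (R * E)%type) :=
  foldr (fun v g => fun p => derive g p v) f vs.

Definition smooth (f : (R * E)%type -> R) :=
  forall vs : seq (R * E)%type,
    (forall v p, derivable (iter_der f vs) p v) /\ continuous (iter_der f vs).

Definition test_fun (phi : (R * E)%type -> R) :=
  smooth phi /\
  exists delta r : R, 0 < delta /\
    forall t (x : E), (t <= delta \/ T - delta <= t \/ r < `|x|) -> phi (t, x) = 0.

(** L^1 functions with compact support on R^N (predual of L^oo_loc) *)
Definition L1c (phi : E -> R) :=
  measurable_fun setT (phi : ME -> R) /\
  lam.-integrable setT (fun x : ME => (phi x)%:E) /\
  exists r : R, forall x : E, r < `|x| -> phi x = 0.

(** W^T: pi in C([0,T], L^oo_loc weak-* ) solving d_t pi + div(a pi) = 0 in D' *)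
Definition weak_sol (a : R -> E -> E) (pi : R -> E -> R) :=
  (forall t, 0 <= t <= T -> Lloc (pi t)) /\
  (forall phi, L1c phi ->
     {within `[0, T], continuous (fun t => Rintegral lam setT (fun x : ME => pi t x * phi x))}) /\
  (forall phi, test_fun phi ->
     (\int[@lebesgue_measure R]_(t in `]0%R, T[)
        \int[lam]_(x in [set: ME])
          (pi t x * (derive phi (t, x : E) (1, 0) +
             \sum_(j < N) a t x 0 j * derive phi (t, x : E) (0, evec j)))%:E)%E = 0%E).

Definition reversible (a : R -> E -> E) (pi : R -> E -> R) :=
  weak_sol a pi /\
  exists X, transport_flow a X /\
    forall t, 0 <= t <= T -> {ae lam, forall x : ME, pi t x = pi T (X t x) * jac X t x}.

End defs.

(* Main.v *)
(** The Jacobian of a Lipschitz map with one compactly supported component has zero integral. We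
get this without mollification or Rademacher's theorem: a signed sum over monotone paths of products of finite
differences integrates to exactly zero by translation invariance, and in the limit it is the
determinant of the partial derivatives, which exist almost everywhere.

Apply it in space-time to (phi w, X_1, ..., X_N), where w is a Lipschitz solution of the transport
equation. Since each X_i solves it too, this determinant is w J(X) (d_t + a . grad) phi, so w J(X) is
a weak solution of the continuity equation. With phi depending on t only, the integral of
w(t) J(X)(t) does not depend on t.

- With w = psi(X) this gives that X(t, .) pushes J(X)(t) dx to Lebesgue measure.
- With w = (psi(X) (X_i - Y_i))^2, which vanishes at time T, it gives J(X) = 0 almost everywhere where
  two flows X and Y differ; where they coincide their gradients coincide almost everywhere. Hence
  p(X) J(X) = p(Y) J(Y), which is the independence and the uniqueness.
- Approximating pi^T in L^1 by such psi, the change of variables carries weak-* continuity and the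
  continuity equation over to pi^T(X) J(X), which is the existence. *)

Require Import Defs.
From HB Require Import structures.
From mathcomp Require Import all_boot all_order all_algebra all_fingroup.
From mathcomp Require Import all_classical all_reals all_analysis.
From mathcomp Require Import measurable_realfun.
From mathcomp Require Import ring lra zify.
Set Implicit Arguments. Unset Strict Implicit. Unset Printing Implicit Defensive.
Import Order.TTheory GRing.Theory Num.Theory.
Import numFieldNormedType.Exports.
Local Open Scope classical_set_scope.
Local Open Scope ring_scope.

(** * Discrete null Lagrangians *)

(** Two obstacles shape the proof. Lipschitz functions are handled through partial derivatives only,
    never through a differential. Derivatives are therefore replaced by upper limits of difference
    quotients ([pder], [tder]), which are bounded Borel functions everywhere, and the test functions
    composed with a flow are products of one-variable functions of its components, for which the
    product rule and a one-variable chain rule suffice. Secondly, the transport equation and the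
    sign of the Jacobian hold almost everywhere in space-time, whereas the conclusions concern every
    single time, and Jacobians have no pointwise regularity in time. The bridge is that integrals of
    a Jacobian against compactly supported Lipschitz weights are Lipschitz in time, again by
    integrating a determinant by parts; averages over short time windows then determine the value at
    each time. In the comparison of two flows the square makes the conserved integrand nonnegative,
    and the factor [psi(X)] supplies the compact support. Finally, a flow displaces points by a
    bounded amount, so a datum that is only locally bounded can be cut off to a ball before it is
    approximated. *)

Section alternating_paths.
Variables (R : realDomainType) (m : nat).
Implicit Types (s t : 'S_m.+1).

(** A permutation [s] is read as a monotone path on the cube, [s i] being the direction of its step
    number [i]. The vertex reached after [k] steps is [path_set s k]; [tail_set s k] is the vertex
    after [k] steps of the same path when its first step is left out. *)
Definition path_set s (k : nat) : {set 'I_m.+1} := s @: finset (fun i : 'I_m.+1 => (i < k)%N).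
Definition tail_set s (k : nat) : {set 'I_m.+1} :=
  s @: finset (fun i : 'I_m.+1 => (0 < i <= k)%N).

Lemma alternating_sum0 (t : 'S_m.+1) (F : 'S_m.+1 -> R) :
  odd_perm t -> (forall s, F (t * s)%g = F s) -> \sum_(s : 'S_m.+1) (-1) ^+ s * F s = 0.
Proof.
move=> todd Ft; set S := \sum_(s : 'S_m.+1) _.
have : S = - S.
  rewrite {1}/S (reindex_inj (mulgI t)) /= /S -sumrN; apply: eq_bigr => s _.
  by rewrite odd_permM todd Ft -mulNr addTb signrN.
by move/eqP; rewrite eq_sym eqNr => /eqP.
Qed.

Variable v : 'I_m -> {set 'I_m.+1} -> R.

(** There are [m.+1] edges for [m] functions, so edge [k] is jumped over: function [j] gets edge [j]
    before the jump and edge [j.+1] after it. *)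
Definition path_prod (k : nat) s :=
  \prod_(j < m) (if (j < k)%N then v j (path_set s j.+1) - v j (path_set s j)
                 else v j (path_set s j.+2) - v j (path_set s j.+1)).

(** Exchanging the steps [k] and [k.+1] changes the vertex between them and no other. *)
Lemma path_set_tperm (k : 'I_m) s (j : nat) : j != k.+1 ->
  path_set (tperm (widen_ord (leqnSn m) k) (lift ord0 k) * s)%g j = path_set s j.
Proof.
move=> jk; set t := tperm _ _.
suff E : t @: finset (fun i : 'I_m.+1 => (i < j)%N) = finset (fun i : 'I_m.+1 => (i < j)%N).
  rewrite /path_set -[in RHS]E -imset_comp; apply: eq_imset => i.
  by rewrite permM.
apply/setP => i; apply/imsetP/idP => [[l lj ->]|].
  move: lj; rewrite !inE /t => lj; case: tpermP => [lE|lE|//]; move: lj; rewrite lE /= /bump leq0n; lia.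
rewrite inE => ij; exists (t i); last by rewrite /t tpermK.
rewrite inE /t; case: tpermP => [iE|iE|//]; move: ij; rewrite iE /= /bump leq0n; lia.
Qed.

(* Moving the jump one step along the path only swaps two consecutive steps. *)
Lemma path_prod_step (k : 'I_m) :
  \sum_(s : 'S_m.+1) (-1) ^+ s * (path_prod k s + path_prod k.+1 s) = 0.
Proof.
apply: (@alternating_sum0 (tperm (widen_ord (leqnSn m) k) (lift ord0 k))).
  by rewrite odd_tperm; apply/eqP => /(congr1 val) /=; rewrite /bump leq0n; lia.
move=> s.
(* The two products differ only in factor [k], which uses edge [k.+1] in one and edge [k] in the
   other. Adding them telescopes over the vertex [k.+1], the only one that the transposition
   moves. *)
have E s' : path_prod k s' + path_prod k.+1 s' =
  (\prod_(j < m | j != k) (if (j < k)%N then v j (path_set s' j.+1) - v j (path_set s' j)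
                 else v j (path_set s' j.+2) - v j (path_set s' j.+1))) *
  (v k (path_set s' k.+2) - v k (path_set s' k)).
  rewrite /path_prod (bigD1 k) //= [X in _ + X](bigD1 k) //= ltnn ltnSn.
  rewrite [X in _ + _ * X](_ : _ = \prod_(j < m | j != k)
      (if (j < k)%N then v j (path_set s' j.+1) - v j (path_set s' j)
                 else v j (path_set s' j.+2) - v j (path_set s' j.+1))).
    by rewrite -mulrDl mulrC addrA subrK.
  apply: eq_bigr => j jk; rewrite ltnS leq_eqVlt.
  by have /negPf -> : (j : nat) != k by [].
rewrite !E; congr (_ * (_ - _)); last 2 first.
- by rewrite path_set_tperm // gtn_eqF.
- by rewrite path_set_tperm // ltn_eqF.
apply: eq_bigr => j jk; have {}jk : (j : nat) != k by [].
case: ifP => jlk.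
  by rewrite !path_set_tperm //; lia.
by rewrite !path_set_tperm //; lia.
Qed.

Lemma path_prod_last :
  \sum_(s : 'S_m.+1) (-1) ^+ s * path_prod 0 s = (-1) ^+ m * \sum_(s : 'S_m.+1) (-1) ^+ s * path_prod m s.
Proof.
have H k : (k <= m)%N ->
    \sum_(s : 'S_m.+1) (-1) ^+ s * path_prod 0 s = (-1) ^+ k * \sum_(s : 'S_m.+1) (-1) ^+ s * path_prod k s.
  elim: k => [|k IH] km; first by rewrite expr0 mul1r.
  rewrite IH ?(ltnW km)//.
  have := path_prod_step (Ordinal km) => /=.
  under eq_bigr do rewrite mulrDr.
  rewrite big_split /= => /eqP; rewrite addr_eq0 => /eqP ->.
  by rewrite exprS mulN1r mulrN mulNr.
exact: H.
Qed.

(** This is the discrete form of the divergence-free rows of the cofactor matrix: both sides omit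
    the first step, but on the right the rest of the path is translated by it. Moving the jump to
    the last edge costs a sign [(-1) ^+ m]; rotating the steps turns a path without its last edge
    into a tail and gives that sign back. *)
Lemma path_prod_cycle :
  \sum_(s : 'S_m.+1) (-1) ^+ s * \prod_(j < m) (v j (tail_set s j.+1) - v j (tail_set s j)) =
  \sum_(s : 'S_m.+1) (-1) ^+ s * path_prod 0 s.
Proof.
(* The cycle [c] sends the last index to [ord0] and every other index to its successor; its sign is
   [(-1) ^+ m]. *)
rewrite path_prod_last; pose c : 'S_m.+1 := lift_perm ord_max ord0 1%g.
rewrite [in RHS](reindex_inj (mulgI c)) /= mulr_sumr; apply: eq_bigr => s _.
rewrite odd_permM /c odd_lift_perm /= odd_perm1.
rewrite !addbF signr_addb signr_odd !mulrA -expr2 -exprM mulnC exprM sqrrN !expr1n mul1r.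
congr (_ * _); apply: eq_bigr => j _; rewrite ltn_ord.
have T (l : nat) : (l <= m)%N -> path_set (c * s)%g l = tail_set s l.
  move=> lm; apply/setP => i; apply/imsetP/imsetP => -[p]; rewrite inE => pl ->.
    have pm : (p < m)%N by exact: leq_trans lm.
    exists (c p); last by rewrite permM.
    have -> : p = lift ord_max (Ordinal pm).
      by apply: val_inj; rewrite /= /bump leqNgt pm add0n.
    by rewrite inE /c lift_perm_lift perm1 /= /bump leq0n add1n.
  case: p pl => p pm /= /andP [p0 pl].
  have pm' : (p.-1 < m)%N by lia.
  exists (lift ord_max (Ordinal pm')).
    by rewrite inE lift_max /=; lia.
  rewrite permM /c lift_perm_lift perm1; congr (s _); apply: val_inj => /=.
  by rewrite /bump leq0n; lia.
by rewrite !T // ltnW.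
Qed.

End alternating_paths.

(** * Bounded measurable functions and convergence in mean *)

Section bounded_measurable.
Context d (T : measurableType d) (R : realType).
Implicit Types (f g : T -> R).

(** The bound holds at every point, not almost everywhere, so that the class is stable under
    composition with any measurable map, without a condition on null sets. *)
Definition bmeas f := measurable_fun setT f /\ exists B : R, forall x, `|f x| <= B.

Lemma bmeas_cst (c : R) : bmeas (fun=> c).
Proof. by split; [exact: measurable_cst|exists `|c|]. Qed.

Lemma bmeasD f g : bmeas f -> bmeas g -> bmeas (fun x => f x + g x).
Proof.
move=> [mf [A fA]] [mg [B gB]]; split; first exact: measurable_funD.
by exists (A + B) => x; rewrite (le_trans (ler_normD _ _))// lerD.
Qed.

Lemma bmeasM f g : bmeas f -> bmeas g -> bmeas (fun x => f x * g x).
Proof.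
move=> [mf [A fA]] [mg [B gB]]; split; first exact: measurable_funM.
by exists (A * B) => x; rewrite normrM ler_pM.
Qed.

Lemma bmeasN f : bmeas f -> bmeas (fun x => - f x).
Proof.
move=> [mf [A fA]]; split; first exact: measurableT_comp.
by exists A => x; rewrite normrN.
Qed.

Lemma bmeasB f g : bmeas f -> bmeas g -> bmeas (fun x => f x - g x).
Proof. by move=> bf bg; apply: bmeasD => //; exact: bmeasN. Qed.

Lemma bmeas_norm f : bmeas f -> bmeas (fun x => `|f x|).
Proof.
move=> [mf [A fA]]; split; first exact: measurableT_comp.
by exists A => x; rewrite normr_id.
Qed.

Lemma bmeas_sum I (r : seq I) (P : pred I) (F : I -> T -> R) :
  (forall i, P i -> bmeas (F i)) -> bmeas (fun x => \sum_(i <- r | P i) F i x).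
Proof.
move=> bF; elim: r => [|i r IH].
  by under eq_fun do rewrite big_nil; exact: bmeas_cst.
under eq_fun do rewrite big_cons.
by have [Pi|_//] := boolP (P i); apply: bmeasD => //; exact: bF.
Qed.

Lemma bmeas_prod I (r : seq I) (P : pred I) (F : I -> T -> R) :
  (forall i, P i -> bmeas (F i)) -> bmeas (fun x => \prod_(i <- r | P i) F i x).
Proof.
move=> bF; elim: r => [|i r IH].
  by under eq_fun do rewrite big_nil; exact: bmeas_cst.
under eq_fun do rewrite big_cons.
by have [Pi|_//] := boolP (P i); apply: bmeasM => //; exact: bF.
Qed.

Lemma bmeas_indic (A : set T) : measurable A -> bmeas (\1_A : T -> R).
Proof.
move=> mA; split; first exact: measurable_indic.
by exists 1 => x; rewrite indicE; case: (_ \in _); rewrite ?normr1 ?normr0.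
Qed.

Variable mu : {measure set T -> \bar R}.

Lemma bmeas_integrable (K : set T) f :
  measurable K -> (mu K < +oo)%E -> bmeas f -> mu.-integrable K (EFin \o f).
Proof.
move=> mK K1 [mf [B fB]]; apply: measurable_bounded_integrable => //.
  exact: measurable_funTS.
by exists B; split; rewrite ?num_real// => x Bx y _ /=; rewrite (le_trans (fB y))// ltW.
Qed.

Lemma bmeas_integrableT (K : set T) f : measurable K -> (mu K < +oo)%E ->
  bmeas f -> (forall x, ~ K x -> f x = 0) -> mu.-integrable setT (EFin \o f).
Proof.
move=> mK K1 bf f0; have := bmeas_integrable mK K1 bf.
rewrite integrable_mkcond//; congr (integrable _ _ _).
apply/funext => x; rewrite /patch /=; case: ifPn => //.
by rewrite notin_setE => /f0 ->.
Qed.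

Lemma Rintegral_setT_supp (K : set T) f :
  (forall x, ~ K x -> f x = 0) -> \int[mu]_(x in K) f x = \int[mu]_x f x.
Proof.
move=> f0; rewrite Rintegral_mkcond; apply: eq_Rintegral => x _.
by rewrite /patch; case: ifPn => //; rewrite notin_setE => /f0 ->.
Qed.

Lemma Rintegral_sum (I : Type) (r : seq I) (K : set T) (F : I -> T -> R) :
  measurable K -> (mu K < +oo)%E -> (forall i, bmeas (F i)) ->
  \int[mu]_(x in K) (\sum_(i <- r) F i x) = \sum_(i <- r) \int[mu]_(x in K) F i x.
Proof.
move=> mK Kfin bF; elim: r => [|i r IH].
  rewrite big_nil; under eq_Rintegral do rewrite big_nil.
  by rewrite Rintegral_cst// mul0r.
rewrite big_cons; under eq_Rintegral do rewrite big_cons.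
rewrite RintegralD// ?IH//; apply: bmeas_integrable => //.
by apply: bmeas_sum => *; exact: bF.
Qed.

Lemma Rintegral_norm_le (K : set T) f B : measurable K -> (mu K < +oo)%E -> bmeas f ->
  (forall x, K x -> `|f x| <= B) -> \int[mu]_(x in K) `|f x| <= B * fine (mu K).
Proof.
move=> mK Kfin bf fB; rewrite -Rintegral_cst//.
apply: le_Rintegral => //; apply: bmeas_integrable => //.
  exact: bmeas_norm.
exact: bmeas_cst.
Qed.

Lemma bmeas_dominated (K : set T) (f : nat -> T -> R) (F : T -> R) B :
  measurable K -> (mu K < +oo)%E ->
  (forall k, measurable_fun setT (f k)) -> measurable_fun setT F ->
  (forall k x, `|f k x| <= B) ->
  {ae mu, forall x, K x -> f ^~ x @ \oo --> F x} ->
  (fun k => \int[mu]_(x in K) `|f k x - F x|) @ \oo --> 0.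
Proof.
move=> mK Kfin mf mF fB fF.
have [] := @dominated_convergence _ _ _ mu K mK (fun k => EFin \o f k) (EFin \o F) (cst B%:E).
- by move=> k; apply/measurable_EFinP; exact: measurable_funTS.
- by apply/measurable_EFinP; exact: measurable_funTS.
- apply: filterS fF => x /[apply] h.
  by apply: cvg_EFin => //; near=> k.
- exact: (@bmeas_integrable K (cst B)) (bmeas_cst B).
- by apply: aeW => x k _ /=; rewrite lee_fin.
move=> _ + _ => /fine_cvgP[_]; apply: cvg_trans.
by apply: near_eq_cvg; near=> k.
Unshelve. all: by end_near. Qed.

End bounded_measurable.

Lemma bmeas_comp d d' (T : measurableType d) (T' : measurableType d') (R : realType)
  (phi : T -> T') (f : T' -> R) :
  measurable_fun setT phi -> bmeas f -> bmeas (fun x => f (phi x)).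
Proof.
move=> mphi [mf [B fB]]; split; first exact: measurableT_comp.
by exists B.
Qed.

Section measure_preserving.
Local Open Scope ereal_scope.
Context d (T : measurableType d) (R : realType) (mu : {measure set T -> \bar R}).
Variable phi : T -> T.
Hypothesis mphi : measurable_fun setT phi.
Hypothesis phiE : forall A, measurable A -> mu (phi @^-1` A) = mu A.

Lemma ge0_integral_mpres (f : T -> \bar R) : measurable_fun setT f ->
  (forall x, 0 <= f x) -> \int[mu]_x f (phi x) = \int[mu]_x f x.
Proof.
move=> mf f0; transitivity (\int[pushforward mu phi]_x f x).
  by rewrite ge0_integral_pushforward// preimage_setT.
apply: eq_measure_integral => /= A mA _; exact: phiE.
Qed.

Lemma integral_mpres (f : T -> \bar R) : measurable_fun setT f ->
  \int[mu]_x f (phi x) = \int[mu]_x f x.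
Proof.
move=> mf; rewrite [LHS]integralE [RHS]integralE; congr (_ - _).
  by rewrite -(ge0_integral_mpres (measurable_funepos mf))//; by apply: eq_integral => x _; rewrite ?(funepos_comp f phi) ?(funeneg_comp f phi).
by rewrite -(ge0_integral_mpres (measurable_funeneg mf))//; by apply: eq_integral => x _; rewrite ?(funepos_comp f phi) ?(funeneg_comp f phi).
Qed.

Lemma Rintegral_mpres (f : T -> R) : measurable_fun setT f ->
  (\int[mu]_x f (phi x) = \int[mu]_x f x)%R.
Proof.
by move=> mf; rewrite /Rintegral (integral_mpres (f := EFin \o f))//; exact/measurable_EFinP.
Qed.

End measure_preserving.

Section bounded_L1_convergence.
Context d (T : measurableType d) (R : realType) (mu : {measure set T -> \bar R}).
Variables (K : set T).
Hypotheses (mK : measurable K) (Kfin : (mu K < +oo)%E).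

(** The uniform bound makes this mode of convergence stable under products, which convergence in
    mean alone is not; determinants of difference quotients then pass to the limit. *)
Definition bcvgL1 (f : nat -> T -> R) (F : T -> R) :=
  [/\ forall k, measurable_fun setT (f k), measurable_fun setT F,
      exists B : R, (forall k x, `|f k x| <= B) /\ (forall x, `|F x| <= B) &
      (fun k => \int[mu]_(x in K) `|f k x - F x|) @ \oo --> 0].

Let bm (f : nat -> T -> R) F k : bcvgL1 f F -> bmeas (f k).
Proof. by move=> [mf mF [B [fB FB]] _]; split => //; exists B. Qed.

Let bmF (f : nat -> T -> R) F : bcvgL1 f F -> bmeas F.
Proof. by move=> [mf mF [B [fB FB]] _]; split => //; exists B. Qed.

Lemma bcvgL1_cst (c : R) : bcvgL1 (fun _ _ => c) (fun=> c).
Proof.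
split => //; first by exists `|c|.
under eq_fun do (under eq_Rintegral do rewrite subrr normr0).
under eq_fun do rewrite Rintegral_cst// mul0r.
exact: cvg_cst.
Qed.

Lemma bcvgL1D f F g G : bcvgL1 f F -> bcvgL1 g G ->
  bcvgL1 (fun k x => f k x + g k x) (fun x => F x + G x).
Proof.
move=> Hf Hg; have [mf mF [A [fA FA]] cf] := Hf; have [mg mG [B [gB GB]] cg] := Hg.
split.
- by move=> k; exact: measurable_funD.
- exact: measurable_funD.
- exists (A + B); split => [k x|x]; by rewrite (le_trans (ler_normD _ _))// lerD.
apply: (@squeeze_cvgr _ _ _ _ (fun=> 0) (fun k => \int[mu]_(x in K) `|f k x - F x| + \int[mu]_(x in K) `|g k x - G x|)).
- near=> k; rewrite Rintegral_ge0//= -RintegralD//.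
  + apply: le_Rintegral => //.
    * apply: bmeas_integrable => //; apply: bmeas_norm; apply: bmeasB; apply: bmeasD;
        by [exact: bm Hf|exact: bm Hg|exact: bmF Hf|exact: bmF Hg].
    * apply: bmeas_integrable => //; apply: bmeasD; apply: bmeas_norm; apply: bmeasB;
        by [exact: bm Hf|exact: bm Hg|exact: bmF Hf|exact: bmF Hg].
    * move=> x _; rewrite (le_trans _ (ler_normD _ _))// le_eqVlt; apply/orP; left.
      by apply/eqP; congr (`| _ |); ring.
  + apply: bmeas_integrable => //; apply: bmeas_norm; apply: bmeasB; by [exact: bm Hf|exact: bmF Hf].
  + apply: bmeas_integrable => //; apply: bmeas_norm; apply: bmeasB; by [exact: bm Hg|exact: bmF Hg].
- exact: cvg_cst.
- by rewrite -[0]addr0; exact: cvgD.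
Unshelve. all: by end_near. Qed.

Lemma bcvgL1M f F g G : bcvgL1 f F -> bcvgL1 g G ->
  bcvgL1 (fun k x => f k x * g k x) (fun x => F x * G x).
Proof.
move=> Hf Hg; have [mf mF [A [fA FA]] cf] := Hf; have [mg mG [B [gB GB]] cg] := Hg.
have bfF k : mu.-integrable K (EFin \o (fun x => `|f k x - F x|)).
  by apply: bmeas_integrable => //; apply: bmeas_norm; apply: bmeasB; [exact: bm Hf|exact: bmF Hf].
have bgG k : mu.-integrable K (EFin \o (fun x => `|g k x - G x|)).
  by apply: bmeas_integrable => //; apply: bmeas_norm; apply: bmeasB; [exact: bm Hg|exact: bmF Hg].
split.
- by move=> k; exact: measurable_funM.
- exact: measurable_funM.
- by exists (A * B); split => [k x|x]; rewrite normrM ler_pM.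
apply: (@squeeze_cvgr _ _ _ _ (fun=> 0) (fun k => B * \int[mu]_(x in K) `|f k x - F x| + A * \int[mu]_(x in K) `|g k x - G x|)).
- near=> k; rewrite Rintegral_ge0//= -!RintegralZl// -RintegralD//.
  + apply: le_Rintegral => //.
    * apply: bmeas_integrable => //; apply: bmeas_norm; apply: bmeasB; apply: bmeasM;
        by [exact: bm Hf|exact: bm Hg|exact: bmF Hf|exact: bmF Hg].
    * apply: bmeas_integrable => //; apply: bmeasD; apply: bmeasM; first exact: bmeas_cst.
      - by apply: bmeas_norm; apply: bmeasB; [exact: bm Hf|exact: bmF Hf].
      - exact: bmeas_cst.
      - by apply: bmeas_norm; apply: bmeasB; [exact: bm Hg|exact: bmF Hg].
    * move=> x _.
      rewrite (_ : _ - _ = (f k x - F x) * g k x + F x * (g k x - G x)); last by ring.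
      rewrite (le_trans (ler_normD _ _))// !normrM lerD//.
        by rewrite mulrC ler_wpM2r.
      by rewrite ler_wpM2r.
  + apply: bmeas_integrable => //; apply: bmeasM; first exact: bmeas_cst.
    by apply: bmeas_norm; apply: bmeasB; [exact: bm Hf|exact: bmF Hf].
  + apply: bmeas_integrable => //; apply: bmeasM; first exact: bmeas_cst.
    by apply: bmeas_norm; apply: bmeasB; [exact: bm Hg|exact: bmF Hg].
- exact: cvg_cst.
- have := cvgD (cvgM (cvg_cst B) cf) (cvgM (cvg_cst A) cg); rewrite !mulr0 addr0; exact.
Unshelve. all: by end_near. Qed.

Lemma bcvgL1_sum I (r : seq I) (f : I -> nat -> T -> R) F :
  (forall i, bcvgL1 (f i) (F i)) ->
  bcvgL1 (fun k x => \sum_(i <- r) f i k x) (fun x => \sum_(i <- r) F i x).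
Proof.
move=> H; elim: r => [|i r IH].
  have := bcvgL1_cst 0; congr bcvgL1.
    by do 2 apply/funext => ?; rewrite big_nil.
  by apply/funext => ?; rewrite big_nil.
have := bcvgL1D (H i) IH; congr bcvgL1.
  by do 2 apply/funext => ?; rewrite big_cons.
by apply/funext => ?; rewrite big_cons.
Qed.

Lemma bcvgL1_prod I (r : seq I) (f : I -> nat -> T -> R) F :
  (forall i, bcvgL1 (f i) (F i)) ->
  bcvgL1 (fun k x => \prod_(i <- r) f i k x) (fun x => \prod_(i <- r) F i x).
Proof.
move=> H; elim: r => [|i r IH].
  have := bcvgL1_cst 1; congr bcvgL1.
    by do 2 apply/funext => ?; rewrite big_nil.
  by apply/funext => ?; rewrite big_nil.
have := bcvgL1M (H i) IH; congr bcvgL1.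
  by do 2 apply/funext => ?; rewrite big_cons.
by apply/funext => ?; rewrite big_cons.
Qed.

Lemma bcvgL1_Rintegral f F : bcvgL1 f F ->
  (fun k => \int[mu]_(x in K) f k x) @ \oo --> \int[mu]_(x in K) F x.
Proof.
move=> Hf; have [mf mF [A [fA FA]] cf] := Hf.
apply/subr_cvg0/norm_cvg0P.
apply: (@squeeze_cvgr _ _ _ _ (fun=> 0) (fun k => \int[mu]_(x in K) `|f k x - F x|)) => //; last exact: cvg_cst.
near=> k; rewrite normr_ge0/= -RintegralB//.
- apply: le_normr_Rintegral => //; apply: bmeas_integrable => //.
  by apply: bmeasB; [exact: bm Hf|exact: bmF Hf].
- by apply: bmeas_integrable => //; exact: bm Hf.
- by apply: bmeas_integrable => //; exact: bmF Hf.
Unshelve. all: by end_near. Qed.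

End bounded_L1_convergence.

Lemma near_harmonic_le (R : realType) (delta : R) : 0 < delta ->
  \forall k \near \oo, (0 : R) <= k.+1%:R^-1 <= delta.
Proof.
move=> delta0; have /cvgrPdist_le/(_ _ delta0) := @cvg_harmonic R.
apply: filterS => k; by rewrite sub0r normrN ger0_norm ?harmonic_ge0// => ->.
Qed.

Lemma mem_path_set m (s : 'S_m.+1) k i : (i \in path_set s k) = ((s^-1)%g i < k)%N.
Proof.
rewrite -{1}(permKV s i) (mem_imset _ _ (@perm_inj _ s)).
by rewrite inE.
Qed.

Lemma mem_tail_set m (s : 'S_m.+1) k i : (i \in tail_set s k) = (0 < (s^-1)%g i <= k)%N.
Proof.
rewrite -{1}(permKV s i) (mem_imset _ _ (@perm_inj _ s)).
by rewrite inE.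
Qed.

(* Difference quotients along the edges of the cube spanned by the e i: summed with signs over the
   m.+1 factorial monotone paths, their products integrate to exactly 0 because the measure is
   invariant under the shifts tr; the step h then tends to 0. *)
Section null_lagrangian.
Context d (T : measurableType d) (R : realType) (mu : {measure set T -> \bar R}).
Variables (V : lmodType R) (tr : V -> T -> T) (m : nat) (e : 'I_m.+1 -> V).
Hypothesis mtr : forall v, measurable_fun setT (tr v).
Hypothesis trP : forall v A, measurable A -> mu (tr v @^-1` A) = mu A.
Hypothesis tr0 : forall x, tr 0 x = x.
Hypothesis trD : forall v w x, tr (v + w) x = tr v (tr w x).
Variables (u : 'I_m.+1 -> T -> R) (L B delta : R) (K0 K1 : set T).
Hypothesis mu_ : forall j, measurable_fun setT (u j).
Hypothesis uL : forall j i h x, `|u j (tr (h *: e i) x) - u j x| <= L * `|h|.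
Hypothesis uB : forall x, `|u ord0 x| <= B.
Hypothesis delta0 : 0 < delta.
Hypotheses (mK0 : measurable K0) (mK1 : measurable K1).
Hypotheses (K0fin : (mu K0 < +oo)%E) (K1fin : (mu K1 < +oo)%E).
(** Integration takes place on [K0], outside of which [u ord0] and its small shifts vanish. The
    larger [K1] receives the translates of [K0]; there difference quotients are compared with their
    limits. *)
Hypothesis suppK0 : forall x (h : R) i, 0 <= h <= delta -> ~ K0 x -> u ord0 (tr (h *: e i) x) = 0.
Hypothesis K01 : forall x (h : R) (S : {set 'I_m.+1}), 0 <= h <= delta -> K0 x ->
  K1 (tr (h *: \sum_(i in S) e i) x).

Let vS (S : {set 'I_m.+1}) := \sum_(i in S) e i.

Let shift_lip j h (S : {set 'I_m.+1}) x :
  `|u j (tr (h *: vS S) x) - u j x| <= m.+1%:R * L * `|h|.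
Proof.
have L0 : 0 <= L * `|h| by rewrite (le_trans _ (uL ord0 ord0 h x)).
have H (r : seq 'I_m.+1) :
    `|u j (tr (h *: \sum_(i <- r) e i) x) - u j x| <= (size r)%:R * L * `|h|.
  elim: r => [|i r IH].
    by rewrite big_nil scaler0 tr0 subrr normr0 !mul0r.
  rewrite big_cons scalerDr trD -(subrKA (u j (tr (h *: \sum_(j <- r) e j) x))).
  rewrite (le_trans (ler_normD _ _))//.
  rewrite /= (le_trans (lerD (uL _ _ _ _) IH))//.
  by rewrite -natr1 -!mulrA mulrDl mul1r addrC.
rewrite /vS -big_enum (le_trans (H _))// -!mulrA ler_wpM2r// ler_nat.
by rewrite -cardE (leq_trans (max_card _))// card_ord.
Qed.

Let vS_path (s : 'S_m.+1) (j : 'I_m.+1) :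
  vS (path_set s j.+1) = e (s j) + vS (path_set s j).
Proof.
rewrite /vS -big_setU1/=; last by rewrite mem_path_set permK ltnn.
apply: eq_bigl => i; rewrite in_setU1 !mem_path_set ltnS leq_eqVlt; congr (_ || _).
by rewrite -[in i == _](permKV s i) (inj_eq (@perm_inj _ s)).
Qed.

Let vS_tail (s : 'S_m.+1) (j : nat) :
  vS (path_set s j.+1) = vS (tail_set s j) + e (s ord0).
Proof.
rewrite addrC /vS -big_setU1/=; last by rewrite mem_tail_set permK ltnn.
apply: eq_bigl => i; rewrite in_setU1 !mem_path_set mem_tail_set ltnS.
rewrite -[in i == _](permKV s i) (inj_eq (@perm_inj _ s)) -val_eqE /=.
by case: (val _).
Qed.

Let suppu0 x : ~ K0 x -> u ord0 x = 0.
Proof.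
move=> /(@suppK0 x 0 ord0); rewrite scale0r tr0; apply.
by rewrite lexx ltW.
Qed.

Let bmu0 : bmeas (u ord0).
Proof. by split => //; exists B. Qed.

Let bmdiff j h S S' : bmeas (fun x => u j (tr (h *: vS S) x) - u j (tr (h *: vS S') x)).
Proof.
split; first by apply: measurable_funB; apply: measurableT_comp => //; exact: mtr.
exists (m.+1%:R * L * `|h| + m.+1%:R * L * `|h|) => x.
rewrite -(subrKA (u j x)) (le_trans (ler_normD _ _))// lerD//.
by rewrite /= distrC.
Qed.

Let Rintegral_tr v f : measurable_fun setT f ->
  \int[mu]_x f (tr v x) = \int[mu]_x f x.
Proof. exact: (Rintegral_mpres (mtr v) (trP v)). Qed.

(** Summation by parts. The first factor of each product is a difference of [u ord0]; a translation
    by the first edge moves its shifted half onto the other factors and replaces [P s] by [Q s].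
    What is left is [u ord0] times a signed sum that [path_prod_cycle] annihilates at every
    point. *)
Let exact_sum h : 0 <= h <= delta ->
  \int[mu]_(x in K0) (\sum_(s : 'S_m.+1) (-1) ^+ s * \prod_(j < m.+1)
     (u j (tr (h *: vS (path_set s j.+1)) x) - u j (tr (h *: vS (path_set s j)) x))) = 0.
Proof.
move=> hd.
pose v x (j : 'I_m) S := u (lift ord0 j) (tr (h *: vS S) x).
pose P s x := path_prod (v x) 0 s.
pose Q s x := \prod_(j < m) (v x j (tail_set s j.+1) - v x j (tail_set s j)).
have bP s : bmeas (P s) by apply: bmeas_prod => j _; exact: bmdiff.
have bQ s : bmeas (Q s) by apply: bmeas_prod => j _; exact: bmdiff.
have PQ s x : P s x = Q s (tr (h *: e (s ord0)) x).
  rewrite /P /path_prod /Q; apply: eq_bigr => j _; rewrite /v /=.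
  by rewrite -!trD -!scalerDr -!vS_tail.
have bu0t (s : 'S_m.+1) : bmeas (fun x => u ord0 (tr (h *: e (s ord0)) x)).
  by apply: bmeas_comp => //; exact: mtr.
transitivity (\int[mu]_(x in K0) (\sum_(s : 'S_m.+1)
   (-1) ^+ s * (u ord0 (tr (h *: e (s ord0)) x) * P s x - u ord0 x * P s x))).
  apply: eq_Rintegral => x _; apply: eq_bigr => s _; congr (_ * _).
  rewrite big_ord_recl /= -mulrBl; congr (_ * _).
    rewrite vS_tail; congr (u _ (tr _ x) - u _ _).
      rewrite /vS big_pred0 ?add0r// => i; rewrite mem_tail_set.
      by case: (val _).
    rewrite /vS big_pred0 ?scaler0 ?tr0// => i.
    by rewrite mem_path_set.
rewrite Rintegral_sum//; last first.
  by move=> s; apply: bmeasM (bmeas_cst _ _) _; apply: bmeasB; apply: bmeasM.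
transitivity (\sum_(s : 'S_m.+1) \int[mu]_(x in K0)
   ((-1) ^+ s * (u ord0 x * Q s x - u ord0 x * P s x))).
  apply: eq_bigr => s _.
  rewrite !RintegralZl//; try by apply: bmeas_integrable => //; apply: bmeasB; apply: bmeasM.
  congr (_ * _); rewrite !RintegralB//; try by apply: bmeas_integrable => //; apply: bmeasM.
  congr (_ - _).
  (* Translation invariance concerns the whole space, so both integrals are first extended from [K0]
     by means of the support of [u ord0]. *)
  transitivity (\int[mu]_x (u ord0 (tr (h *: e (s ord0)) x) * P s x)).
    by apply: Rintegral_setT_supp => x K0x; rewrite suppK0// mul0r.
  transitivity (\int[mu]_x (u ord0 x * Q s x)); last first.
    by apply/esym/Rintegral_setT_supp => x /suppu0 ->; rewrite mul0r.
  under eq_Rintegral do rewrite PQ.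
  by rewrite (@Rintegral_tr _ (fun y => u ord0 y * Q s y))//; apply: (bmeasM _ _).1.
rewrite -Rintegral_sum//; last first.
  by move=> s; apply: bmeasM (bmeas_cst _ _) _; apply: bmeasB; apply: bmeasM.
under eq_Rintegral => x _.
  rewrite (_ : \sum_s _ = 0); first over.
  under eq_bigr do rewrite -mulrBr mulrCA mulrBr.
  rewrite -mulr_sumr sumrB.
  by rewrite -[X in _ - X](path_prod_cycle (v x)) subrr mulr0.
by rewrite Rintegral_cst// mul0r.
Qed.

Variable D : 'I_m.+1 -> 'I_m.+1 -> T -> R.
Hypothesis mD : forall j i, measurable_fun setT (D j i).
Hypothesis DL : forall j i x, `|D j i x| <= L.
Hypothesis Dcvg : forall j i, {ae mu, forall x, K1 x ->
  (fun k : nat => k.+1%:R * (u j (tr (k.+1%:R^-1 *: e i) x) - u j x)) @ \oo --> D j i x}.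

Let dq j i (k : nat) x := k.+1%:R * (u j (tr (k.+1%:R^-1 *: e i) x) - u j x).

Let mdq j i k : measurable_fun setT (dq j i k).
Proof.
apply: measurable_funM; first exact: measurable_cst.
by apply: measurable_funB => //; apply: measurableT_comp => //; exact: mtr.
Qed.

Let dqL j i k x : `|dq j i k x| <= L.
Proof.
rewrite /dq normrM ger0_norm// mulrC -ler_pdivlMr// (le_trans (uL _ _ _ _))//.
by rewrite ger0_norm.
Qed.

Let mpres_le v g : (forall x, K0 x -> K1 (tr v x)) -> bmeas g -> (forall x, 0 <= g x) ->
  \int[mu]_(x in K0) g (tr v x) <= \int[mu]_(x in K1) g x.
Proof.
move=> K01v bg g0.
rewrite (_ : \int[mu]_(x in K1) g x = \int[mu]_x (g x * \1_K1 x)); last first.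
  by rewrite Rintegral_mkcond; apply: eq_Rintegral => x _; rewrite patchE indicE; case: ifPn; rewrite ?mulr1 ?mulr0.
rewrite -(@Rintegral_tr v); last first.
  by apply: (bmeasM bg _).1; exact: bmeas_indic.
rewrite (_ : \int[mu]_(x in K0) g (tr v x) = \int[mu]_x (g (tr v x) * \1_K0 x)); last first.
  by rewrite Rintegral_mkcond; apply: eq_Rintegral => x _; rewrite patchE indicE; case: ifPn; rewrite ?mulr1 ?mulr0.
have bgv : bmeas (fun x => g (tr v x)) by apply: bmeas_comp => //; exact: mtr.
have mtK : measurable (tr v @^-1` K1) by rewrite -[X in measurable X]setTI; exact: mtr.
apply: le_Rintegral => //.
- apply: (@bmeas_integrableT _ _ _ _ K0) => //.
    by apply: bmeasM => //; exact: bmeas_indic.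
  by move=> x K0x; rewrite indicE memNset// mulr0.
- apply: (@bmeas_integrableT _ _ _ _ (tr v @^-1` K1)) => //.
  + by rewrite trP.
  + by apply: bmeasM => //; apply: (bmeas_comp (mtr v)); exact: bmeas_indic.
  + by move=> x K1x; rewrite indicE memNset// mulr0.
- move=> x _; rewrite ler_wpM2l// !indicE ler_nat.
  by case: (boolP (x \in K0)) => //; rewrite inE => /K01v /mem_set ->.
Qed.

(** Along a path the quotients are evaluated at points that move with the step, and convergence at
    fixed points says nothing about these. As for the continuity of translations in L1, the limit
    [D j i] is compared with one quotient of fixed index [l], which is Lipschitz and hardly notices
    the shift. *)
Let shift_cvg j i (S : {set 'I_m.+1}) :
  bcvgL1 mu K0 (fun k x => dq j i k (tr (k.+1%:R^-1 *: vS S) x)) (D j i).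
Proof.
split => //.
- by move=> k; apply: measurableT_comp; [exact: mdq|exact: mtr].
- by exists L.
pose a k := \int[mu]_(x in K1) `|dq j i k x - D j i x|.
have a0 : a @ \oo --> 0 by exact: (bmeas_dominated mK1 K1fin (mdq j i) (mD j i) (dqL j i) (Dcvg j i)).
have bdq k : bmeas (dq j i k) by split => //; exists L.
have bD : bmeas (D j i) by split => //; exists L.
(* A Lipschitz constant along the shifts for the quotient of index [l]: it blows up with [l], but
   [l] is fixed before [k] tends to infinity. *)
pose C (l : nat) := l.+1%:R * (m.+1%:R * L + m.+1%:R * L).
have HC l h x : `|dq j i l (tr (h *: vS S) x) - dq j i l x| <= C l * `|h|.
  rewrite /dq -mulrBr normrM ger0_norm// /C -mulrA ler_wpM2l//.
  have -> : tr (l.+1%:R^-1 *: e i) (tr (h *: vS S) x) = tr (h *: vS S) (tr (l.+1%:R^-1 *: e i) x).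
    by rewrite -!trD addrC.
  rewrite mulrDl.
  rewrite (_ : _ - _ = (u j (tr (h *: vS S) (tr (l.+1%:R^-1 *: e i) x)) - u j (tr (l.+1%:R^-1 *: e i) x))
     - (u j (tr (h *: vS S) x) - u j x)); last by ring.
  by rewrite (le_trans (ler_normB _ _))// lerD.
pose M := fine (mu K0).
have h0 : (fun k : nat => k.+1%:R^-1 : R) @ \oo --> 0 by exact: cvg_harmonic.
(* The terms are, in order: quotient [k] against the limit at the shifted point, the limit against
   quotient [l] there, the shift of quotient [l], and quotient [l] against the limit at the original
   point. *)
have main (k l : nat) : k.+1%:R^-1 <= delta ->
    \int[mu]_(x in K0) `|dq j i k (tr (k.+1%:R^-1 *: vS S) x) - D j i x| <=
    a k + a l + C l * k.+1%:R^-1 * M + a l.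
  move=> kd; set h := k.+1%:R^-1.
  have h_ : 0 <= h <= delta by rewrite kd andbT invr_ge0.
  have btr v f : bmeas f -> bmeas (fun x => f (tr v x)).
    by move=> bf; apply: bmeas_comp => //; exact: mtr.
  have bI (K : set T) f : measurable K -> (mu K < +oo)%E -> bmeas f -> mu.-integrable K (EFin \o f).
    by move=> *; exact: bmeas_integrable.
  have b1 : bmeas (fun x => `|dq j i k (tr (h *: vS S) x) - D j i (tr (h *: vS S) x)|).
    by apply: bmeas_norm; apply: bmeasB; exact: btr.
  have b2 : bmeas (fun x => `|dq j i l (tr (h *: vS S) x) - D j i (tr (h *: vS S) x)|).
    by apply: bmeas_norm; apply: bmeasB; exact: btr.
  have b3 : bmeas (fun x => `|dq j i l (tr (h *: vS S) x) - dq j i l x|).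
    by apply: bmeas_norm; apply: bmeasB => //; exact: btr.
  have b4 : bmeas (fun x => `|dq j i l x - D j i x|).
    by apply: bmeas_norm; apply: bmeasB.
  have b12 := bmeasD b1 b2; have b123 := bmeasD b12 b3; have b1234 := bmeasD b123 b4.
  apply: (@le_trans _ _ (\int[mu]_(x in K0) (`|dq j i k (tr (h *: vS S) x) - D j i (tr (h *: vS S) x)|
    + `|dq j i l (tr (h *: vS S) x) - D j i (tr (h *: vS S) x)| +
    `|dq j i l (tr (h *: vS S) x) - dq j i l x| + `|dq j i l x - D j i x|))).
    apply: le_Rintegral => //.
    - by apply: bI => //; apply: bmeas_norm; apply: bmeasB => //; exact: btr.
    - exact: bI.
    - move=> x _.
      rewrite (_ : dq j i k (tr (h *: vS S) x) - D j i x =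
        (dq j i k (tr (h *: vS S) x) - D j i (tr (h *: vS S) x)) -
        (dq j i l (tr (h *: vS S) x) - D j i (tr (h *: vS S) x)) +
        (dq j i l (tr (h *: vS S) x) - dq j i l x) + (dq j i l x - D j i x)); last by ring.
      rewrite (le_trans (ler_normD _ _))// lerD// (le_trans (ler_normD _ _))// lerD//.
      exact: ler_normB.
  rewrite !RintegralD//; try exact: bI.
  rewrite !lerD//.
  - apply: (mpres_le (g := fun x => `|dq j i k x - D j i x|)) => //.
    + by move=> x; exact: K01.
    + by apply: bmeas_norm; apply: bmeasB.
  - apply: (mpres_le (g := fun x => `|dq j i l x - D j i x|)) => //.
    by move=> x; exact: K01.
  - apply: Rintegral_norm_le => //.
      by apply: bmeasB => //; exact: btr.
    by move=> x _; rewrite (le_trans (HC _ _ _))// ger0_norm// invr_ge0.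
  - rewrite /a; have := @mpres_le 0 (fun x => `|dq j i l x - D j i x|).
    under [X in (_ -> _ -> _ -> X <= _) -> _]eq_Rintegral do rewrite tr0.
    apply => // x K0x; have := @K01 x 0 finset.set0; rewrite scale0r; apply => //.
    by rewrite lexx ltW.
apply/cvgrPdist_le => eps eps0.
have e4 : 0 < eps / 4 by lra.
have /cvgrPdist_le/(_ _ e4)[l _ /(_ l (leqnn _))] := a0.
rewrite sub0r normrN => al.
have hC : (fun k : nat => C l * k.+1%:R^-1 * M) @ \oo --> C l * 0 * M.
  by apply: cvgM (cvg_cst _); apply: cvgM => //; exact: cvg_cst.
near=> k.
rewrite sub0r normrN ger0_norm; last exact: Rintegral_ge0.
have /andP[_ kd] : (0 : R) <= k.+1%:R^-1 <= delta.
  by near: k; exact: near_harmonic_le.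
apply: (le_trans (main k l kd)).
have ak : `|a k| <= eps / 4.
  near: k; move/cvgrPdist_le : a0 => /(_ _ e4); apply: filterS => k.
  by rewrite sub0r normrN.
have hk : `|C l * k.+1%:R^-1 * M| <= eps / 4.
  near: k; move/cvgrPdist_le : hC => /(_ _ e4); apply: filterS => k.
  by rewrite mulr0 mul0r sub0r normrN.
rewrite [leRHS](_ : _ = eps / 4 + eps / 4 + eps / 4 + eps / 4); last by field.
by rewrite !lerD// (le_trans (ler_norm _)).
Unshelve. all: by end_near. Qed.

(** By the Leibniz formula the determinant is the limit in mean of signed sums of products of
    quotients along paths. For small steps these sums are a power of [k.+1] times those of
    [exact_sum], so their integrals are exactly zero. *)
Theorem null_lagrangian :
  \int[mu]_(x in K0) (\det (\matrix_(j, i) D j i x)) = 0.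
Proof.
have H : bcvgL1 mu K0 (fun k x => \sum_(s : 'S_m.+1) (-1) ^+ s *
    \prod_(j < m.+1) dq j (s j) k (tr (k.+1%:R^-1 *: vS (path_set s j)) x))
    (fun x => \det (\matrix_(j, i) D j i x)).
  rewrite (_ : (fun x => \det _) = (fun x => \sum_(s : 'S_m.+1) (-1) ^+ s *
    \prod_(j < m.+1) D j (s j) x)); last first.
    apply/funext => x; apply: eq_bigr => s _; congr (_ * _).
    by apply: eq_bigr => j _; rewrite mxE.
  apply: bcvgL1_sum => // s; apply: bcvgL1M => //; first exact: bcvgL1_cst.
  by apply: bcvgL1_prod => // j; exact: shift_cvg.
have := bcvgL1_Rintegral mK0 K0fin H.
move/cvg_lim => <-//; apply/cvg_lim => //.
apply: cvg_near_cst; near=> k.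
have kd : (0 : R) <= k.+1%:R^-1 <= delta.
  by near: k; exact: near_harmonic_le.
have := exact_sum kd => /(congr1 (fun z => k.+1%:R ^+ m.+1 * z)); rewrite mulr0.
rewrite -RintegralZl//; last first.
  apply: bmeas_integrable => //; apply: bmeas_sum => s _; apply: bmeasM; first exact: bmeas_cst.
  by apply: bmeas_prod => j _; exact: bmdiff.
move=> H0; rewrite -[RHS]H0; apply: eq_Rintegral => x _; rewrite [RHS]mulr_sumr; apply: eq_bigr => s _.
rewrite [RHS]mulrCA; congr (_ * _); rewrite -[in _ ^+ m.+1](card_ord m.+1) -prodr_const -big_split /=.
by apply: eq_bigr => j _; rewrite /dq vS_path scalerDr trD.
Unshelve. all: by end_near. Qed.

End null_lagrangian.

(** * Lebesgue measure on row vectors *)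

Lemma pushforward_measure_ex d d' (T : measurableType d) (T' : measurableType d')
  (R : realType) (mu : {measure set T -> \bar R}) (phi : T -> T') :
  measurable_fun setT phi ->
  exists m' : {measure set T' -> \bar R}, forall A, m' A = mu (phi @^-1` A).
Proof.
move=> mphi; unshelve refine (ex_intro _ (pushforward mu phi : {measure set T' -> \bar R}) _).
  exact: mphi.
by [].
Qed.

Section row_vectors.
Variables (R : realType) (N : nat).
Local Notation E := (E R N).
Local Notation ME := (ME R N).

Lemma rv_norm_coord (x : E) i : `|x 0 i| <= `|x|.
Proof.
rewrite [leRHS]/Num.Def.normr /= mx_normrE.
exact: (le_bigmax_cond _ (fun ij : 'I_1 * 'I_N => `|x ij.1 ij.2|) (P := predT) (j := (0, i))).
Qed.

Lemma rv_norm_le (x : E) r : 0 <= r -> (forall i, `|x 0 i| <= r) -> `|x| <= r.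
Proof.
move=> r0 xr; rewrite [leLHS]/Num.Def.normr /= mx_normrE.
by apply: bigmax_le => // -[i j] _ /=; rewrite (ord1 i).
Qed.

Lemma rv_norm_lt (x : E) r : 0 < r -> (forall i, `|x 0 i| < r) -> `|x| < r.
Proof.
move=> r0 xr; rewrite [ltLHS]/Num.Def.normr /= mx_normrE.
by apply: bigmax_lt => // -[i j] _ /=; rewrite (ord1 i).
Qed.

Lemma open_rv_norm (U : set E) x : open U -> U x ->
  exists2 e, 0 < e & forall y, `|x - y| < e -> U y.
Proof.
rewrite openE => /[apply]; rewrite /interior -nbhs_ballE => -[e /= e0 xU].
by exists e => // y xy; apply: xU; rewrite mx_norm_ball.
Qed.

Lemma continuous_measurable_rv (f : E -> R) :
  continuous f -> measurable_fun setT (f : ME -> R).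
Proof.
move=> /continuousP cf; apply: (measurability _ (RGenOpens.measurableE R)).
move=> _ [_ [a [b ->] <-]]; rewrite setTI; apply: sub_sigma_algebra.
exact/cf/interval_open.
Qed.

Lemma measurable_coord i : measurable_fun setT (fun x : ME => (x : E) 0 i).
Proof.
apply: (@continuous_measurable_rv (fun x => x 0 i)).
exact: (@coord_continuous R 1 N 0 i).
Qed.

Definition boxes : set (set ME) := [set A | exists a b : E, A = box a b].

Lemma measurable_box (a b : E) : measurable (box a b : set ME).
Proof.
rewrite (_ : box a b = \bigcap_(i in [set: 'I_N]) ((fun x : ME => (x : E) 0 i) @^-1` `]a 0 i, b 0 i])); last first.
  apply/seteqP; split => x /= xab; first by move=> i _ /=; rewrite in_itv; exact: xab.
  by move=> i; have := xab i I; rewrite /= in_itv.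
apply: fin_bigcap_measurable; first exact: finite_finset.
move=> i _; rewrite -[X in measurable X]setTI.
by apply: measurable_coord.
Qed.

Lemma open_bigcup_box (U : set E) : open U ->
  U = \bigcup_(q in [set q : 'rV[rat]_N * 'rV[rat]_N |
       box (map_mx ratr q.1) (map_mx ratr q.2) `<=` U])
      box (map_mx ratr q.1) (map_mx ratr q.2).
Proof.
move=> oU; apply/seteqP; split; last by move=> x [q /= qU /qU].
move=> x Ux; have [e e0 xU] := open_rv_norm oU Ux.
have [p pP] : {p : 'I_N -> rat & forall i, ratr (p i) \in `]x 0 i - e, x 0 i[%R}.
  apply: (@choice _ _ (fun i q => ratr q \in `](x 0 i - e), (x 0 i)[%R)).
  by move=> i; apply: rat_in_itvoo; rewrite ltrBlDr ltrDl.
have [q qP] : {q : 'I_N -> rat & forall i, ratr (q i) \in `]x 0 i, x 0 i + e[%R}.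
  apply: (@choice _ _ (fun i q => ratr q \in `](x 0 i), (x 0 i + e)[%R)).
  by move=> i; apply: rat_in_itvoo; rewrite ltrDl.
exists (\row_i p i, \row_i q i) => /=.
- move=> y /= yb; apply: xU; apply: rv_norm_lt => // i.
  have := yb i; have := pP i; have := qP i; rewrite !mxE !in_itv /= ltr_norml.
  by move=> /andP[? ?] /andP[? ?] /andP[? ?]; apply/andP; split; lra.
- move=> i; have := pP i; have := qP i; rewrite !mxE !in_itv /=.
  by move=> /andP[? ?] /andP[? ?]; apply/andP; split; lra.
Qed.

Lemma measurable_rvE : (measurable : set (set ME)) = <<s boxes >>.
Proof.
apply/seteqP; split.
  apply: smallest_sub; first exact: smallest_sigma_algebra.
  move=> U oU; rewrite (open_bigcup_box oU) bigcup_mkcond.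
  apply: (@countable_bigcupT_measurable _ (g_sigma_algebraType boxes)) => //.
  move=> q; case: ifP => // _; apply: sub_sigma_algebra.
  by eexists; eexists.
apply: smallest_sub; first exact: sigma_algebra_measurable.
by move=> _ [a [b ->]]; exact: measurable_box.
Qed.

Lemma measurable_rv d (T : measurableType d) (f : T -> ME) :
  (forall i, measurable_fun setT (fun t => (f t : E) 0 i)) -> measurable_fun setT f.
Proof.
move=> mf; apply: (measurability _ measurable_rvE) => _ [_ [a [b ->] <-]].
rewrite setTI (_ : f @^-1` _ = \bigcap_(i in [set: 'I_N]) ((fun t => (f t : E) 0 i) @^-1` `]a 0 i, b 0 i])); last first.
  apply/seteqP; split => x /= xab; first by move=> i _ /=; rewrite in_itv; exact: xab.
  by move=> i; have := xab i I; rewrite /= in_itv.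
apply: fin_bigcap_measurable; first exact: finite_finset.
by move=> i _; rewrite -[X in measurable X]setTI; exact: mf.
Qed.

Lemma measurable_rv_shift (v : E) : measurable_fun setT (fun x : ME => (x + v : E) : ME).
Proof.
apply: measurable_rv => i; under eq_fun do rewrite mxE.
by apply: measurable_funD => //; exact: measurable_coord.
Qed.

Lemma measurable_rv_norm : measurable_fun setT (fun x : ME => `|x : E|).
Proof. by apply: continuous_measurable_rv; exact: norm_continuous. Qed.

Definition rball (r : R) : set ME := [set x : E | `|x| <= r].

Lemma measurable_rball r : measurable (rball r).
Proof.
rewrite (_ : rball r = (fun x : ME => `|x : E|) @^-1` `]-oo, r]).
  by rewrite -[X in measurable X]setTI; apply: measurable_rv_norm.
by apply/seteqP; split => x /=; rewrite in_itv.
Qed.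

Definition cube (k : nat) : set ME := box (const_mx (- k%:R)) (const_mx k%:R).

Lemma cube_cover : \bigcup_k cube k = setT.
Proof.
apply/seteqP; split => // x _; have [k xk] : exists k : nat, `|x : E| < k%:R.
  by exists (Num.Def.truncn (`|x : E|)).+1; exact: truncnS_gt.
exists k => // i; rewrite !mxE.
have := le_lt_trans (rv_norm_coord x i) xk.
by rewrite ltr_norml => /andP[-> /ltW].
Qed.

Lemma boxesI : setI_closed boxes.
Proof.
move=> _ _ [a [b ->]] [c [d ->]].
exists (\row_i Num.max (a 0 i) (c 0 i)), (\row_i Num.min (b 0 i) (d 0 i)).
apply/seteqP; split => x /=.
  by move=> [ab cd] i; rewrite !mxE gt_max le_min; have /andP[-> ->] := ab i; have /andP[-> ->] := cd i.
move=> h; split => i; have := h i; rewrite !mxE gt_max le_min.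
  by move=> /andP[/andP[-> _] /andP[-> _]].
by move=> /andP[/andP[_ ->] /andP[_ ->]].
Qed.

Lemma rv_measure_unique (m1 m2 : {measure set ME -> \bar R}) :
  (forall a b : E, m1 (box a b) = m2 (box a b)) ->
  (forall a b : E, (m1 (box a b) < +oo)%E) ->
  forall A, measurable A -> m1 A = m2 A.
Proof.
move=> m12 m1fin; have bI := boxesI; have cc := cube_cover.
apply: (measure_unique boxes cube) => //.
- exact: measurable_rvE.
- by move=> k; eexists; eexists.
- by move=> _ [a [b ->]].
- by move=> k; exact: m1fin.
Qed.

Lemma box_set0 (a b : E) : ~ (forall i, a 0 i <= b 0 i) -> box a b = set0.
Proof.
move=> /existsNP[i]/negP; rewrite -ltNge => ba; apply/seteqP; split => // x /(_ i).
by move=> /andP[ax xb]; have := lt_trans (lt_le_trans ax xb) ba; rewrite ltxx.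
Qed.

Variable lam : {measure set ME -> \bar R}.
Hypothesis lamP : is_lebesgue lam.

Lemma lebesgue_box_fin (a b : E) : (lam (box a b) < +oo)%E.
Proof.
have [ab|/box_set0 ->] := pselect (forall i, a 0 i <= b 0 i).
  by rewrite lamP// ltry.
by rewrite measure0.
Qed.

Lemma lebesgue_shift (v : E) A : measurable A ->
  lam ((fun x : ME => (x + v : E) : ME) @^-1` A) = lam A.
Proof.
have [m' m'E] := pushforward_measure_ex lam (measurable_rv_shift v).
move=> mA; rewrite -m'E; apply/esym; move: A mA; apply: rv_measure_unique.
  move=> a b; rewrite m'E.
  have -> : (fun x : ME => (x + v : E) : ME) @^-1` box a b = box (a - v) (b - v).
    by apply/seteqP; split => x /= h i; have := h i; rewrite !mxE ltrBlDr lerBrDr.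
  have [ab|ab] := pselect (forall i, a 0 i <= b 0 i); last first.
    rewrite !box_set0 ?measure0// => h; apply: ab => i.
    by have := h i; rewrite !mxE lerD2r.
  rewrite !lamP//; last by move=> i; rewrite !mxE lerD2r.
  by congr (_%:E); apply: eq_bigr => i _; rewrite !mxE opprB addrA subrK.
exact: lebesgue_box_fin.
Qed.

Lemma lebesgue_rball_fin r : (lam (rball r) < +oo)%E.
Proof.
apply: le_lt_trans (lebesgue_box_fin (const_mx (- r - 1)) (const_mx (r + 1))).
apply: le_measure; rewrite ?inE; [exact: measurable_rball|exact: measurable_box|].
move=> x /= xr i; rewrite !mxE; have := le_trans (rv_norm_coord x i) xr.
by rewrite ler_norml => /andP[? ?]; apply/andP; split; lra.
Qed.

(** The theorem is given a bare measure, while Fubini arguments need the sigma-finite structure.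
    Equality as measures allows [lam] to be replaced once and for all. *)
Lemma lebesgue_sigma_finite :
  exists lam' : {sigma_finite_measure set ME -> \bar R}, lam = lam' :> {measure set ME -> \bar R}.
Proof.
have sf : sigma_finite setT lam.
  exists cube; first exact/esym/cube_cover.
  by move=> k; split; [exact: measurable_box|exact: lebesgue_box_fin].
move: sf; move: (lam) => [f [c1 c2]] sf.
pose mf : {measure set ME -> \bar R} := Measure.Pack (Measure.Class c2).
pose X := Measure_isSigmaFinite.Build _ _ _ mf sf.
pose lam' : {sigma_finite_measure set ME -> \bar R} := HB.pack f c1 c2 X.
by exists lam'.
Qed.

End row_vectors.

Lemma measurable_real_shift (R : realType) (s : R) :
  measurable_fun setT (fun x : measurableTypeR R => (x : R) + s : measurableTypeR R).
Proof. by apply: measurable_funD => //; exact: measurable_cst. Qed.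

Lemma lebesgue_measure_shift (R : realType) (s : R) (A : set (measurableTypeR R)) :
  measurable A ->
  lebesgue_measure ((fun x : measurableTypeR R => (x : R) + s : measurableTypeR R) @^-1` A)
  = lebesgue_measure A.
Proof.
have [m' m'E] := pushforward_measure_ex (@lebesgue_measure R) (@measurable_real_shift R s).
move=> mA; transitivity (m' A); first by rewrite m'E.
apply/esym; move: A mA; apply: lebesgue_measure_unique => _ [[a b] _ <-] /=; rewrite m'E.
have -> : (fun x : measurableTypeR R => (x : R) + s : measurableTypeR R) @^-1` `]a, b] = [set` `](a - s : R), (b - s)]].
  by apply/seteqP; split => x /=; rewrite !in_itv /= ltrBlDr lerBrDr.
apply: (etrans _ (esym (lebesgue_measure_itv `](a - s), (b - s)]))).
rewrite lebesgue_measure_itv /= !lte_fin.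
have -> : (a - s < b - s) = (a < b) by rewrite ltrD2r.
case: ifP => // _.
by rewrite -!EFinD opprB addrA subrK.
Qed.

Section time_space.
Variables (R : realType) (N : nat).
Local Notation E := (E R N).
Local Notation ME := (ME R N).
Local Notation MR := (measurableTypeR R).
Local Notation TE := (MR * ME)%type.

Definition ts_shift (v : R^o * E) (p : TE) : TE := ((p.1 : R) + v.1, (p.2 : E) + v.2).

Lemma measurable_ts_shift v : measurable_fun setT (ts_shift v).
Proof.
apply: measurable_fun_pair.
  by apply: measurable_funD; [exact: measurable_fst|exact: measurable_cst].
by apply: (measurableT_comp (measurable_rv_shift v.2)); exact: measurable_snd.
Qed.

Lemma ts_shift0 p : ts_shift 0 p = p.
Proof. by case: p => t x; rewrite /ts_shift /= !addr0. Qed.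

Lemma ts_shiftD v w p : ts_shift (v + w) p = ts_shift v (ts_shift w p).
Proof.
rewrite /ts_shift /=; congr pair.
  by rewrite [v.1 + _]addrC addrA.
by rewrite [v.2 + _]addrC addrA.
Qed.

(** An open set of space-time is a countable union of products of a rational interval and a rational
    box, hence belongs to the product sigma-algebra. *)
Lemma continuous_measurable_ts (f : R * E -> R) :
  continuous f -> measurable_fun setT (f : TE -> R).
Proof.
move=> /continuousP cf; apply: (measurability _ (RGenOpens.measurableE R)).
move=> _ [_ [a [b ->] <-]]; rewrite setTI.
set U := (_ @^-1` _); have oU : open U.
  by apply: cf; exact: interval_open.
pose Q (q : (rat * rat) * ('rV[rat]_N * 'rV[rat]_N)) : set TE :=
  [set` `](ratr q.1.1 : R), (ratr q.1.2)[] `*` (box (map_mx ratr q.2.1) (map_mx ratr q.2.2)).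
rewrite (_ : U = \bigcup_(q in [set q | Q q `<=` U]) Q q).
  rewrite bigcup_mkcond; apply: countable_bigcupT_measurable => // q.
  case: ifP => // _; apply: measurableX; [exact: measurable_itv|exact: measurable_box].
apply/seteqP; split; last by move=> x [q /= qU /qU].
suff H (t : R) (x : E) : U (t, x) -> (\bigcup_(q in [set q | Q q `<=` U]) Q q) (t, x) by case; exact: H.
move=> Utx; move: (oU); rewrite openE => /(_ _ Utx).
rewrite /interior -nbhs_ballE => -[e /= e0 xU].
have oB : open (ball x e) by exact: ball_open.
have := open_bigcup_box oB => /seteqP[/(_ x (ballxx _ e0))[[c d] /= cdB xcd] _].
have [p pP] : exists p : rat, ratr p \in `]t - e, t[%R.
  by apply: rat_in_itvoo; rewrite ltrBlDr ltrDl.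
have [q qP] : exists q : rat, ratr q \in `]t, t + e[%R.
  by apply: rat_in_itvoo; rewrite ltrDl.
exists ((p, q), (c, d)) => //=; last first.
  split => //=; rewrite in_itv /=; move: pP qP; rewrite !in_itv /=.
  by move=> /andP[_ ->] /andP[-> _].
suff H (s : R) (y : E) : (Q ((p, q), (c, d))) (s, y) -> U (s, y) by case; exact: H.
move=> [/= spq ycd]; apply: xU; split => /=; last exact: cdB.
have {}spq : ratr p < s < ratr q by move: spq; rewrite in_itv.
move: pP qP spq; rewrite !in_itv /= /ball /= ltr_norml.
by move=> /andP[? ?] /andP[? ?] /andP[? ?]; apply/andP; split; lra.
Qed.

Variable lam : {sigma_finite_measure set ME -> \bar R}.
Hypothesis lamP : is_lebesgue lam.

Local Notation tsmu := (product_measure1 (@lebesgue_measure R) lam).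

Lemma tsmu_shift v A : measurable A -> tsmu (ts_shift v @^-1` A) = tsmu A.
Proof.
move=> mA; have [m' m'E] := pushforward_measure_ex tsmu (measurable_ts_shift v).
rewrite -m'E; apply/esym; apply: product_measure_unique => // B C mB mC.
rewrite m'E; have -> : ts_shift v @^-1` (B `*` C) =
  ((fun x : MR => (x : R) + v.1 : MR) @^-1` B) `*` ((fun x : ME => (x + v.2 : E) : ME) @^-1` C) by [].
have mB' : measurable ((fun x : MR => (x : R) + v.1 : MR) @^-1` B).
  by rewrite -[X in measurable X]setTI; exact: (@measurable_real_shift R v.1).
have mC' : measurable ((fun x : ME => (x + v.2 : E) : ME) @^-1` C).
  by rewrite -[X in measurable X]setTI; exact: (measurable_rv_shift v.2).
apply: (etrans (product_measure1E lebesgue_measure lam mB' mC')).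
by congr (_ * _)%E; [exact: lebesgue_measure_shift|exact: lebesgue_shift].
Qed.

(** Fubini along an arbitrary direction without a change of coordinates: in the set of pairs
    [(s, x)] with [s] in [[0, 1]] and [x + s *: e] in [A], the section at each such [s] is a
    translate of [A], and the section at each [x] is null. Both orders of integration give the
    measure of the set. *)
Lemma null_lines (e : E) (A : set ME) : measurable A ->
  (forall x : E, (@lebesgue_measure R).-negligible [set s : MR | A (x + (s : R) *: e : E)]) ->
  lam A = 0%E.
Proof.
move=> mA A0.
have mf : measurable_fun setT (fun p : TE => ((p.2 : E) + p.1 *: e : E) : ME).
  apply: measurable_rv => i; under eq_fun do rewrite !mxE.
  apply: measurable_funD.
    exact: (measurableT_comp (measurable_coord i) measurable_snd).
  by apply: measurable_funM; [exact: measurable_fst|exact: measurable_cst].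
pose B : set TE := (`[0, 1] `*` setT) `&` ((fun p : TE => ((p.2 : E) + p.1 *: e : E) : ME) @^-1` A).
have mB : measurable B.
  apply: measurableI; first exact: measurableX.
  by rewrite -[X in measurable X]setTI; exact: mf.
have := @indic_fubini_tonelli _ _ _ _ R lebesgue_measure lam B mB.
rewrite indic_fubini_tonelli_FE// indic_fubini_tonelli_GE// => H.
have : (\int[lebesgue_measure]_s (lam \o xsection B) s)%E = lam A.
  transitivity (\int[lebesgue_measure]_(s in `[0%R, 1%R]) lam A)%E; last first.
    by rewrite integral_cst//= lebesgue_measure_itv /= lte01 oppr0 adde0 mule1.
  rewrite [RHS]integral_mkcond; apply: eq_integral => s _ /=; rewrite patchE.
  case: ifPn => [|]; rewrite ?inE ?notin_setE /= => s01.
    rewrite -(lebesgue_shift lamP (s *: e) mA); congr (lam _).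
    apply/seteqP; split => x; rewrite /xsection /= inE /B /=; first by case.
    by [].
  rewrite (_ : xsection _ _ = set0) ?measure0//; apply/seteqP; split => // x.
  by rewrite /xsection /= inE /B /= => -[[/s01]].
move=> <-; rewrite H; apply: integral0_eq => x _ /=.
apply: measure_negligible; first exact: measurable_ysection.
apply: negligibleS (A0 x) => s; rewrite /ysection /= inE /B /=.
by case.
Qed.

End time_space.

(** * Lipschitz functions are differentiable almost everywhere along lines *)

Section lipschitz_derivable.
Variable R : realType.
Local Notation mu := (@lebesgue_measure R).

Let LS_itvoc (g : cumulative R R) (a b : R) : (a <= b)%R ->
  lebesgue_stieltjes_measure g `]a, b]%classic = (g b - g a)%:E.
Proof.
move=> ab; rewrite /lebesgue_stieltjes_measure/= /measure_extension/=.
by rewrite measurable_mu_extE/= ?wlength_itv_bnd//; exact: is_ocitv.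
Qed.

(** With the constant 1/2, both [g = x/2 + f] and [h = x/2 - f] are nondecreasing and their sum is
    the identity. Their Stieltjes measures thus add up to Lebesgue measure, so that of [g] is
    absolutely continuous; its Radon-Nikodym density is integrated back and differentiated almost
    everywhere. *)
Let half_lipschitz_derivable (f : R -> R) :
  (forall x y, `|f x - f y| <= 2^-1 * `|x - y|) ->
  mu.-negligible [set x | ~ derivable f x 1].
Proof.
move=> fL.
pose g x := 2^-1 * x + f x; pose h x := 2^-1 * x - f x.
have fle x y : x <= y -> `|f x - f y| <= 2^-1 * (y - x).
  by move=> xy; rewrite (le_trans (fL x y))// distrC ger0_norm// subr_ge0.
have gnd : nondecreasing g.
  move=> x y /fle; rewrite ler_norml /g => /andP[? ?]; lra.
have hnd : nondecreasing h.
  move=> x y /fle; rewrite ler_norml /h => /andP[? ?]; lra.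
have fc : continuous f.
  move=> x; apply/cvgrPdist_le => e e0; near=> y.
  rewrite (le_trans (fL x y))//.
  have : `|x - y| <= e by near: y; exact: cvgr_dist_le.
  by have := normr_ge0 (x - y); lra.
have grc : right_continuous g.
  apply: right_continuousW => x; apply: cvgD; last exact: fc.
  by apply: cvgM; [exact: cvg_cst|exact: cvg_id].
have hrc : right_continuous h.
  apply: right_continuousW => x; apply: cvgB; last exact: fc.
  by apply: cvgM; [exact: cvg_cst|exact: cvg_id].
pose G : cumulative R R := HB.pack g (isCumulative.Build R _ R g gnd grc).
pose H : cumulative R R := HB.pack h (isCumulative.Build R _ R h hnd hrc).
pose nuG := lebesgue_stieltjes_measure G; pose nuH := lebesgue_stieltjes_measure H.
have GH A : measurable A -> mu A = (nuG A + nuH A)%E.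
  move=> mA; rewrite -(measure_addE nuG nuH).
  apply: lebesgue_measure_unique => // _ [[a b] _ <-].
  apply: (etrans _ (esym (measure_addE nuG nuH _))) => /=.
  have [ab|/ltW ba] := leP a b.
    rewrite /nuG /nuH !LS_itvoc//= lebesgue_measure_itv /= lte_fin.
    rewrite -EFinD /g /h.
    case: ifPn => [_|]; first by rewrite -EFinD; congr (_%:E); field.
    rewrite -leNgt => ba; have -> : a = b by apply/eqP; rewrite eq_le ab ba.
    by congr (_%:E); field.
  have -> : `]a, b]%classic = set0 :> set R.
    by rewrite set_itv_ge// -leNgt bnd_simp.
  by rewrite /nuG /nuH !measure0 adde0.
(* The Stieltjes measure of [g] is restricted to a bounded interval to become finite; inside that
   interval the primitive [F] of the density is [g] up to a constant. *)
have main (n : nat) : mu.-negligible [set x | `|x| < n%:R /\ ~ derivable f x 1].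
  pose r : R := n%:R; have r0 : - r <= r by rewrite ge0_cp// ler0n.
  have mI : measurable (`](- r), r]%classic : set (measurableTypeR R)).
    exact: measurable_itv.
  have Ifin : (nuG `](- r)%R, r]%classic < +oo)%E.
    by rewrite /nuG LS_itvoc ?ltry.
  pose nu : {finite_measure set (measurableTypeR R) -> \bar R} := mfrestr mI Ifin.
  have numu : nu `<< mu.
    apply/null_content_dominatesP => A mA muA0.
    have nuGH0 : (nuG A + nuH A = 0)%E := etrans (esym (GH A mA)) muA0.
    have nuG0 : (nuG A <= 0)%E by rewrite -nuGH0 leeDl.
    apply/eqP; rewrite -measure_le0; apply: le_trans nuG0.
    by rewrite /nu /= /mfrestr /= /mrestr; apply: le_measure; rewrite ?inE//; exact: measurableI.
  have [phi [phi0 phif phii phiE]] := radon_nikodym_sigma_finite numu.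
  pose F x := \int[mu]_(t in `](- r), x]) fine (phi t).
  have phiE' : phi = EFin \o (fine \o phi).
    by apply/funext => x; rewrite /= fineK.
  have FE x : - r <= x <= r -> F x = g x - g (- r).
    move=> /andP[nx xn]; rewrite /F /Rintegral.
    have -> : (\int[mu]_(x0 in `](- r)%R, x]) (fine (phi x0))%:E)%E = nu `](- r)%R, x]%classic.
      rewrite phiE; last exact: measurable_itv.
      by apply: eq_integral => y _; rewrite fineK.
    rewrite /nu /= /mfrestr /= /mrestr setIidl; first by rewrite LS_itvoc.
    by move=> y /=; rewrite !in_itv /= => /andP[-> /le_trans]; apply.
  have phi_i : mu.-integrable setT (EFin \o (fine \o phi)) by rewrite -phiE'.
  have phi_iI y : mu.-integrable [set` Interval (BRight (- r)) (BRight y)] (EFin \o (fine \o phi)).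
    by apply: integrableS phi_i => //; exact: measurable_itv.
  have [Z [mZ Z0 ZP]] := FTC1 phi_iI (open_integrable_locally openT phi_i).
  exists Z; split => // x /= [xn fx]; apply: ZP => /= K; apply: fx.
  have {xn} := xn; rewrite ltr_norml => /andP[nx xn].
  have [] := K; first by rewrite lte_fin.
  move=> dF _.
  have dF' : derivable (fun y => F y + g (- r) - 2^-1 *: y) x 1.
    apply: derivableB; last by apply: derivableZ; exact: derivable_id.
    exact: (@derivableD _ _ _ F (cst (g (- r))) x 1 dF (derivable_cst _ _ _)).
  apply: near_eq_derivable dF' => //.
  near=> y; rewrite FE; first by rewrite /g subrK addrAC subrr add0r.
  apply/andP; split; near: y.
    by apply: lt_le_nbhsr.
  by apply: lt_le_nbhsl.
apply: negligibleS (negligible_bigcup main) => x /= fx.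
have [k xk] : exists k : nat, `|x| < k%:R.
  by exists (Num.Def.truncn `|x|).+1; exact: truncnS_gt.
by exists k.
Unshelve. all: by end_near. Qed.

Lemma lipschitz_derivable_ae (L : R) (f : R -> R) :
  (forall x y, `|f x - f y| <= L * `|x - y|) ->
  mu.-negligible [set x | ~ derivable f x 1].
Proof.
move=> fL; pose M := 2 * (`|L| + 1).
have M0 : 0 < M by rewrite mulr_gt0// ltr_wpDl.
apply: negligibleS (@half_lipschitz_derivable (fun x => M^-1 *: f x) _).
  move=> x /= fx dx; apply: fx.
  have E : M \*: (fun y => M^-1 *: f y) = f.
    by apply/funext => y /=; rewrite scalerA divff ?gt_eqF// scale1r.
  by rewrite -E; exact: derivableZ.
move=> x y; rewrite -scalerBr normrM gtr0_norm ?invr_gt0//.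
rewrite mulrC ler_pdivrMr// (le_trans (fL x y))//.
rewrite mulrAC /M mulKf ?pnatr_eq0// ler_wpM2r// (le_trans (ler_norm _))//.
by rewrite lerDl.
Qed.

End lipschitz_derivable.

(** The upper limit is taken in the extended reals and then made real, with 0 as default. The result
    is total and measurable for every sequence of measurable functions, and is the limit wherever
    there is one. *)
Definition slim (T : Type) (R : realType) (q : nat -> T -> R) (x : T) : R :=
  fine (limn_esup (fun k => (q k x)%:E)).

Section real_limsup.
Variables (T : Type) (R : realType).
Implicit Types q : nat -> T -> R.

Lemma slim_cvg q x l : q ^~ x @ \oo --> l -> slim q x = l.
Proof.
move=> ql; have qle : (fun k => (q k x)%:E) @ \oo --> l%:E.
  by apply: cvg_EFin => //; near=> k.
rewrite /slim is_cvg_limn_esupE; last by apply/cvg_ex; exists l%:E.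
by rewrite (cvg_lim _ qle).
Unshelve. all: by end_near. Qed.

Lemma slim_bound q x L : (forall k, `|q k x| <= L) -> `|slim q x| <= L.
Proof.
move=> qL; rewrite /slim; set u := (fun k => _).
have uL : (limn_esup u <= L%:E)%E.
  rewrite limn_esup_lim; apply: lime_le; first exact: is_cvg_esups.
  apply: nearW => n; apply: ge_ereal_sup => _ [k _ <-]; rewrite lee_fin.
  exact: le_trans (ler_norm _) (qL k).
have uL' : ((- L)%:E <= limn_esup u)%E.
  apply: le_trans (limn_einf_sup u).
  rewrite limn_einf_lim; apply: lime_ge; first exact: is_cvg_einfs.
  apply: nearW => n; apply: le_ereal_inf_tmp => _ [k _ <-]; rewrite lee_fin.
  by have := qL k; rewrite ler_norml => /andP[].
have uf : limn_esup u \is a fin_num.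
  by rewrite fin_numElt (lt_le_trans _ uL') ?ltNyr//= (le_lt_trans uL) ?ltry.
by rewrite ler_norml -!lee_fin fineK// uL uL'.
Qed.

End real_limsup.

Lemma measurable_slim d (T : measurableType d) (R : realType) (q : nat -> T -> R) : (forall k, measurable_fun setT (q k)) ->
  measurable_fun setT (slim q).
Proof.
move=> mq; apply: (measurableT_comp (fine_measurable measurableT)).
by apply: measurable_fun_limn_esup => k; exact/measurable_EFinP.
Qed.

Lemma ex_harmonic_lt (R : realType) (e : R) : 0 < e -> exists k : nat, k.+1%:R^-1 < e.
Proof.
move=> e0; have e20 : 0 < e / 2 by lra.
have [k _ /(_ k (leqnn _)) /andP[_ ke]] := near_harmonic_le e20.
by exists k; rewrite (le_lt_trans ke)//; lra.
Qed.

Section isolated_zeros.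
Variable R : realType.

(* Zeros with nonzero derivative are isolated, hence countably many. *)
Lemma zeros_derive_neq0_negligible (f : R -> R) : (@lebesgue_measure R).-negligible
  [set s : measurableTypeR R | f s = 0 /\ derivable f s 1 /\ 'D_1 f s != 0].
Proof.
pose S k := [set s : R | f s = 0 /\ forall t, 0 < `|t - s| < k.+1%:R^-1 -> f t != 0].
have cS k : countable (S k).
  (* Distinct points of [S k] are at least [k.+1%:R^-1] apart, so rationals chosen within that
     distance to their right are distinct, which makes [S k] countable. *)
  have [p pP] : {p : R -> rat & forall s, ratr (p s) \in `]s, s + k.+1%:R^-1[%R}.
    apply: (@choice _ _ (fun s q => ratr q \in `]s, (s + k.+1%:R^-1)[%R)) => s.
    by apply: rat_in_itvoo; rewrite ltrDl invr_gt0.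
  apply/countable_injP; exists (pickle \o p) => s t; rewrite !inE => Ss St /=.
  move=> /(pcan_inj pickleK) pst; apply/eqP; apply/negPn/negP => st.
  wlog lt_st : s t Ss St pst st / s < t.
    by move=> W; have [/W|/W|/eqP] := ltgtP s t; [apply|apply => //; rewrite eq_sym|exact/negP].
  have := pP s; have := pP t; rewrite pst !in_itv /= => /andP[tp _] /andP[_ pt].
  have /Ss.2 : 0 < `|t - s| < k.+1%:R^-1 by rewrite gtr0_norm ?subr_gt0// lt_st ltrBlDl (lt_trans tp).
  by rewrite St.1 eqxx.
have nS k : (@lebesgue_measure R).-negligible (S k : set (measurableTypeR R)).
  apply/negligibleP; first exact: countable_measurable.
  exact: countable_lebesgue_measure0.
apply: negligibleS (negligible_bigcup nS) => s /= [fs [df Df]].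
have : \forall h \near 0^', h^-1 *: (f (h *: 1 + s) - f s) != 0.
  by apply: cvgr_neq0 Df; exact: df.
move=> [e /= e0 He].
have [k ke] := ex_harmonic_lt e0.
exists k => //; split => // t /andP[ts0 tsk].
have : (t - s)^-1 *: (f ((t - s) *: 1 + s) - f s) != 0.
  apply: He; last by rewrite -normr_gt0.
  by rewrite /ball_ /= sub0r normrN (lt_trans tsk).
rewrite fs subr0 [_ *: 1]mulr1 subrK; apply: contra => /eqP ->.
by rewrite scaler0.
Qed.

End isolated_zeros.

Lemma lip_continuous (R : realType) (V : normedModType R) (f : V -> R) (L : R) : (forall x y, `|f x - f y| <= L * `|x - y|) ->
  continuous f.
Proof.
move=> fL x; apply/cvgrPdist_le => e e0.
have L0 : 0 < `|L| + 1 by rewrite ltr_wpDl.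
near=> y; rewrite (le_trans (fL x y))//.
apply: (@le_trans _ _ ((`|L| + 1) * `|x - y|)).
  by rewrite ler_wpM2r// (le_trans (ler_norm _))// lerDl.
rewrite -ler_pdivlMl//; near: y; apply: cvgr_dist_le => //.
by rewrite mulr_gt0// invr_gt0.
Unshelve. all: by end_near. Qed.

Lemma harmonic_dnbhs0 (R : realType) : (fun k : nat => k.+1%:R^-1 : R) @ \oo --> (0 : R)^'.
Proof.
move=> A [e /= e0 eA]; have [k ke] := ex_harmonic_lt e0.
exists k => // n /= kn; apply: eA; last by rewrite invr_eq0 pnatr_eq0.
rewrite /ball_ /= sub0r normrN ger0_norm// (le_lt_trans _ ke)//.
by rewrite lef_pV2 ?posrE// ler_nat.
Qed.

Lemma derivable_quotient_cvg (R : realType) (V : normedModType R) (f : V -> R) (x e : V) : derivable f x e ->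
  (fun k : nat => k.+1%:R * (f (x + k.+1%:R^-1 *: e) - f x)) @ \oo --> 'D_e f x.
Proof.
move=> df; have H : h^-1 *: ((f \o shift x) (h *: e) - f x) @[h --> 0^'] --> 'D_e f x by exact: df.
have := cvg_comp _ _ (@harmonic_dnbhs0 R) H.
apply: cvg_trans; apply: near_eq_cvg; near=> k => /=.
by rewrite invrK [x + _]addrC.
Unshelve. all: by end_near. Qed.

Section partial_derivatives.
Variables (R : realType) (N : nat).
Local Notation E := (E R N).
Local Notation ME := (ME R N).
Implicit Types (f : E -> R) (x e : E).

(** The countably many steps [k.+1%:R^-1] make it a Borel function for continuous [f], and a
    Lipschitz bound carries over at every point. Where [f] is not derivable the value is arbitrary
    within that bound. *)
Definition pder f e : E -> R :=
  slim (fun k x => k.+1%:R * (f (x + k.+1%:R^-1 *: e) - f x)).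

Lemma pder_derivable f x e : derivable f x e -> pder f e x = 'D_e f x.
Proof. by move=> /derivable_quotient_cvg; exact: slim_cvg. Qed.

Lemma pder_bound f e x (L : R) : (forall x y, `|f x - f y| <= L * `|x - y|) ->
  `|pder f e x| <= L * `|e|.
Proof.
move=> fL; apply: slim_bound => k; rewrite normrM ger0_norm//.
rewrite mulrC -ler_pdivlMr// (le_trans (fL _ _))//.
by rewrite addrAC subrr add0r normrZ ger0_norm// mulrCA mulrC.
Qed.

Lemma measurable_pder f e : continuous f -> measurable_fun setT (pder f e : ME -> R).
Proof.
move=> cf; have mf := continuous_measurable_rv cf.
apply: measurable_slim => k; apply: measurable_funM; first exact: measurable_cst.
apply: measurable_funB => //.
exact: (measurableT_comp mf (measurable_rv_shift _)).
Qed.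

Section almost_everywhere.
Variable lam : {sigma_finite_measure set ME -> \bar R}.
Hypothesis lamP : is_lebesgue lam.
Variables (f : E -> R) (e : E) (L : R).
Hypothesis fL : forall x y, `|f x - f y| <= L * `|x - y|.

Let cf : continuous f. Proof. exact: lip_continuous fL. Qed.

Let quot (h : R) x := h^-1 * (f (x + h *: e) - f x).

Let mquot h : measurable_fun setT (quot h : ME -> R).
Proof.
have mf := continuous_measurable_rv cf.
apply: measurable_funM; first exact: measurable_cst.
apply: measurable_funB => //.
exact: (measurableT_comp mf (measurable_rv_shift _)).
Qed.

(** The set [bad] below is the failure of the Cauchy criterion for the difference quotients,
    expressed with rational steps only, so that it is Borel. *)
Let osc (m k : nat) : set ME := \bigcup_(q in [set q : rat * rat |
    0 < `|ratr q.1 : R| < k.+1%:R^-1 /\ 0 < `|ratr q.2 : R| < k.+1%:R^-1])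
  [set x : ME | m.+1%:R^-1 < `|quot (ratr q.1) x - quot (ratr q.2) x|].

Let bad : set ME := \bigcup_m \bigcap_k osc m k.

Let mbad : measurable bad.
Proof.
apply: bigcupT_measurable => m; apply: bigcapT_measurable => k.
rewrite /osc bigcup_mkcond; apply: countable_bigcupT_measurable => // q.
case: ifP => // _.
rewrite (_ : mkset _ = (fun x : ME => `|quot (ratr q.1) x - quot (ratr q.2) x|) @^-1` `]m.+1%:R^-1, +oo[); last first.
  by apply/seteqP; split => x /=; rewrite in_itv /= andbT.
rewrite -[X in measurable X]setTI.
have mq : measurable_fun setT (fun x : ME => `|quot (ratr q.1) x - quot (ratr q.2) x|).
  apply: measurableT_comp => //; apply: measurable_funB; exact: mquot.
by apply: mq.
Qed.

Let quot_cts x h : h != 0 -> {for h, continuous (quot ^~ x)}.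
Proof.
move=> h0; apply: cvgM; first exact: cvgV.
apply: cvgB; last exact: cvg_cst.
apply: (@cvg_comp _ _ _ (fun h => x + h *: e) f (nbhs h) (nbhs (x + h *: e))); last exact: cf.
apply: cvgD; first exact: cvg_cst.
exact: cvgZr_tmp.
Qed.

(** At nonzero steps the quotient is continuous in the step, so a real step violating the Cauchy
    criterion has a rational neighbour that violates it too. *)
Let good_derivable x : ~ bad x -> derivable f x e.
Proof.
move=> bx; apply/cauchy_cvgP; apply: cauchy_exP => eps eps0.
have [m meps] := ex_harmonic_lt eps0.
have [k kx] : exists k, ~ osc m k x.
  by apply: contrapT => /forallNP H; apply: bx; exists m => // k _; apply: contrapT; exact: H.
have k0 : (0 : R) < k.+1%:R^-1 by rewrite invr_gt0.
have [h0 h0P] := rat_in_itvoo k0.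
have {}h0P : 0 < `|ratr h0 : R| < k.+1%:R^-1.
  by move: h0P; rewrite in_itv /= => /andP[h00 h0k]; rewrite gtr0_norm ?h00.
exists (quot (ratr h0) x); exists k.+1%:R^-1 => //= h.
rewrite /ball_ /= sub0r normrN => hk hn0.
rewrite /ball /= (_ : _ *: _ = quot h x); last by rewrite /quot [x + _]addrC.
rewrite ltNge; apply/negP => epsq.
have : \forall h' \near h, m.+1%:R^-1 < `|quot (ratr h0) x - quot h' x| /\ 0 < `|h'| < k.+1%:R^-1.
  near=> h'; split.
    near: h'; apply: (@cvgr_gt _ _ _ _ _ (`|quot (ratr h0) x - quot h x|)); last exact: lt_le_trans epsq.
    by apply: cvg_norm; apply: cvgB; [exact: cvg_cst|exact: quot_cts].
  apply/andP; split.
    near: h'; apply: (@cvgr_gt _ _ _ _ _ `|h|); last by rewrite normr_gt0.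
    by apply: cvg_norm; exact: cvg_id.
  near: h'; apply: (@cvgr_lt _ _ _ _ _ `|h|) => //.
  by apply: cvg_norm; exact: cvg_id.
move=> [d /= d0 hd].
have [q qP] : exists q : rat, ratr q \in `]h, h + d[%R by apply: rat_in_itvoo; rewrite ltrDl.
have [] := hd (ratr q).
  move: qP; rewrite in_itv /= ltr_norml => /andP[? ?]; apply/andP; split; lra.
by move=> qm qk; apply: kx; exists (h0, q).
Unshelve. all: by end_near. Qed.

Let bad_line x : [set s : R | bad (x + s *: e : E)] `<=`
  [set s | ~ derivable (fun s : R => f (x + s *: e)) s 1].
Proof.
move=> s [m _ bm] ds.
have /cvg_ex[l H] : cvg (h^-1 *: (f (x + (h *: 1 + s) *: e) - f (x + s *: e)) @[h --> 0^']) := ds.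
have m0 : (0 : R) < m.+1%:R^-1 / 2 by rewrite divr_gt0.
move/cvgrPdist_lt : H => /(_ _ m0)[d /= d0 Hd].
have [k kd] := ex_harmonic_lt d0.
have [[p q] /= [pk qk]] := bm k I.
have E1 h : quot h (x + s *: e) = h^-1 *: (f (x + (h *: 1 + s) *: e) - f (x + s *: e)).
  have -> : x + (h *: 1 + s) *: e = x + s *: e + h *: e.
    by rewrite [h *: 1]mulr1 scalerDl [h *: e + _]addrC addrA.
  by [].
rewrite !E1.
have Hp r : 0 < `|r| < k.+1%:R^-1 ->
    `|l - r^-1 *: (f (x + (r *: 1 + s) *: e) - f (x + s *: e))| < m.+1%:R^-1 / 2.
  move=> /andP[r0 rk]; apply: Hd; last by rewrite -normr_gt0.
  by rewrite /ball_ /= sub0r normrN (lt_trans rk).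
have := ltrD (Hp _ qk) (Hp _ pk); rewrite -splitr; set P := _ *: _; set Q := _ *: _ => PQ'.
move=> PQ; have := lt_le_trans PQ (ler_distD l _ _).
by rewrite [`|_ - l|]distrC addrC => /lt_trans/(_ PQ'); rewrite ltxx.
Qed.

Let lineL x : forall s t : R, `|f (x + s *: e) - f (x + t *: e)| <= (L * `|e|) * `|s - t|.
Proof.
move=> s t; rewrite (le_trans (fL _ _))//.
by rewrite opprD addrACA subrr add0r -scalerBl normrZ -mulrA [`|e| * _]mulrC.
Qed.

(** Every line of direction [e] meets [bad] in a null set, by the one-dimensional theorem; since
    [bad] is Borel, [null_lines] applies. Neither Rademacher's theorem nor any differential
    appears. *)
Lemma lip_derivable_ae : {ae lam, forall x : ME, derivable f (x : E) e}.
Proof.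
exists bad; split; first exact: mbad.
  apply: (null_lines lamP (e := e)) => // x.
  have [Z [mZ Z0 ZP]] := lipschitz_derivable_ae (@lineL x).
  by exists Z; split => // s /bad_line /ZP.
by move=> x /= dx; apply: contrapT => /good_derivable.
Qed.

(** On a line, zeros with a nonzero derivative are isolated, so the exceptional set is null on every
    line of direction [e]. Applied to the difference of two flows, this compares their gradients
    where they coincide, with no appeal to density points. *)
Lemma pder_zeros_ae : {ae lam, forall x : ME, f x = 0 -> pder f e x = 0}.
Proof.
pose A : set ME := [set x : ME | f x = 0 /\ pder f e x != 0].
have mA : measurable A.
  have -> : A = (f : ME -> R) @^-1` [set 0] `&` ~` ((pder f e : ME -> R) @^-1` [set 0]).
    by apply/seteqP; split => x [fx] /= /eqP.
  apply: measurableI.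
    by rewrite -[X in measurable X]setTI; apply: continuous_measurable_rv.
  apply: measurableC.
  by rewrite -[X in measurable X]setTI; apply: measurable_pder.
exists A; split => //; last by move=> x /= /not_implyP[fx] /eqP.
apply: (null_lines lamP (e := e)) => // x.
have := negligibleU (lipschitz_derivable_ae (@lineL x))
  (zeros_derive_neq0_negligible (fun s => f (x + s *: e))).
apply: negligibleS => s /= [fs ps].
have [ds|ds] := pselect (derivable (fun s : R => f (x + s *: e)) s 1); last by left.
right; split => //; split => //; apply: contra ps => /eqP Ds; apply/eqP.
apply: slim_cvg; have := derivable_quotient_cvg ds; rewrite Ds.
apply: cvg_trans; apply: near_eq_cvg; near=> k.
by rewrite /= [_ *: 1]mulr1 scalerDl addrA.
Unshelve. all: by end_near. Qed.

End almost_everywhere.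
End partial_derivatives.

(** * Gradient determinants are null Lagrangians *)

Lemma det_row0 (R : comRingType) n (A : 'M[R]_n) i : (forall j, A i j = 0) -> \det A = 0.
Proof.
by move=> A0; rewrite (expand_det_row _ i) big1// => j _; rewrite A0 mul0r.
Qed.

Section gradient_determinant.
Variables (R : realType) (N : nat).
Local Notation E := (E R N).

Lemma norm_evec (i : 'I_N) : `|evec R i| <= 1.
Proof.
apply: rv_norm_le => // j; rewrite /evec mxE eqxx /=.
by case: eqP => _; rewrite ?normr1 ?normr0.
Qed.

Lemma norm_sum_evec (S : {set 'I_N}) : `|\sum_(i in S) evec R i| <= N%:R.
Proof.
rewrite (le_trans (ler_norm_sum _ _ _))//.
apply: (@le_trans _ _ (\sum_(i in S) (1 : R))).
  by apply: ler_sum => i _; exact: norm_evec.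
by rewrite sumr_const ler_nat (leq_trans (max_card _))// card_ord.
Qed.

Definition grad_det (u : 'I_N -> E -> R) (x : E) : R :=
  \det (\matrix_(i, j) pder (u i) (evec R j) x).

(** The margin [1] absorbs the largest step, [k.+1%:R^-1] at [k = 0]. *)
Lemma pder_outside (f : E -> R) (r : R) e x : (forall x, r < `|x| -> f x = 0) ->
  `|e| <= 1 -> r + 1 < `|x| -> pder f e x = 0.
Proof.
move=> fr e1 rx; apply: slim_cvg; apply: cvg_near_cst; near=> k.
rewrite !fr ?subrr ?mulr0//; first by lra.
rewrite -ltrBrDr in rx; rewrite (lt_le_trans rx)//.
have k1 : `|k.+1%:R^-1 *: e| <= 1.
  rewrite normrZ ger0_norm// mulr_ile1//.
  by rewrite invf_le1// ler1n.
have := ler_normB (x + k.+1%:R^-1 *: e) (k.+1%:R^-1 *: e); rewrite addrK.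
by move=> H; rewrite lerBlDr (le_trans H)// lerD2l.
Unshelve. all: by end_near. Qed.

Lemma bmeas_det d (T : measurableType d) n (M : 'I_n -> 'I_n -> T -> R) :
  (forall i j, bmeas (M i j)) -> bmeas (fun x => \det (\matrix_(i, j) M i j x)).
Proof.
move=> bM; apply: (@bmeas_sum _ T R _ _ xpredT) => s _.
apply: bmeasM; first exact: bmeas_cst.
apply: (@bmeas_prod _ T R _ _ xpredT (fun i x => (\matrix_(i, j) M i j x) i (s i))) => i _.
by under eq_fun do rewrite mxE.
Qed.

Lemma bmeas_pder (f : E -> R) (L : R) e : (forall x y, `|f x - f y| <= L * `|x - y|) ->
  bmeas (pder f e : ME R N -> R).
Proof.
move=> fL; split; first by apply: measurable_pder; exact: lip_continuous fL.
by exists (L * `|e|) => x; exact: pder_bound.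
Qed.

Lemma bmeas_grad_det (u : 'I_N -> E -> R) (L : R) :
  (forall i x y, `|u i x - u i y| <= L * `|x - y|) -> bmeas (grad_det u : ME R N -> R).
Proof. by move=> uL; apply: bmeas_det => i j; exact: bmeas_pder. Qed.

Lemma grad_det_outside (u : 'I_N -> E -> R) (r : R) i x :
  (forall x, r < `|x| -> u i x = 0) -> r + 1 < `|x| -> grad_det u x = 0.
Proof.
move=> ur rx; apply: (@det_row0 _ _ _ i) => j; rewrite mxE.
by apply: pder_outside ur _ rx; exact: norm_evec.
Qed.

End gradient_determinant.

Section space_null_lagrangian.
Variables (R : realType) (m : nat).
Local Notation N := m.+1.
Local Notation E := (E R N).
Local Notation ME := (ME R N).
Variable lam : {sigma_finite_measure set ME -> \bar R}.
Hypothesis lamP : is_lebesgue lam.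

Let first_row (u : 'I_N -> E -> R) (L B r : R) :
  (forall i x y, `|u i x - u i y| <= L * `|x - y|) ->
  (forall x, `|u ord0 x| <= B) ->
  (forall x, r < `|x| -> u ord0 x = 0) ->
  \int[lam]_x grad_det u x = 0.
Proof.
move=> uL uB ur.
have L0 : 0 <= L.
  have := uL ord0 0 (evec R ord0); move=> /(le_trans (normr_ge0 _)).
  rewrite sub0r normrN pmulr_lge0// lt_neqAle normr_ge0 andbT eq_sym normr_eq0.
  by apply/eqP => /matrixP/(_ 0 ord0)/eqP; rewrite !mxE !eqxx oner_eq0.
have D0 x : ~ rball (r + 1) x -> grad_det u x = 0.
  by move=> /negP; rewrite -ltNge; exact: grad_det_outside ur.
rewrite -(Rintegral_setT_supp _ D0).
have uc i : continuous (u i) := lip_continuous (uL i).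
have hS (h : R) (S : {set 'I_N}) : 0 <= h <= 1 -> `|h *: \sum_(i in S) evec R i| <= N%:R.
  move=> /andP[h0 h1]; rewrite normrZ ger0_norm// -[leRHS]mul1r ler_pM//.
  exact: norm_sum_evec.
apply: (@null_lagrangian _ ME R lam E (fun v (x : ME) => (x + v : E) : ME) m (@evec R N)
  _ _ _ _ u L B 1 (rball (r + 1)) (rball (r + 1 + N%:R)) _ _ _ _ _ _ _ _ _ _
  (fun i j => pder (u i) (evec R j))).
- exact: measurable_rv_shift.
- by move=> v A mA; exact: lebesgue_shift.
- by move=> x; rewrite addr0.
- by move=> v w x; rewrite addrA addrAC.
- by move=> j; apply: continuous_measurable_rv.
- move=> j i h x; rewrite (le_trans (uL _ _ _))// ler_wpM2l//.
  by rewrite addrAC subrr add0r normrZ ler_piMr// norm_evec.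
- by [].
- exact: ltr01.
- exact: measurable_rball.
- exact: measurable_rball.
- exact: lebesgue_rball_fin.
- exact: lebesgue_rball_fin.
- move=> x h i /andP[h0 h1] /negP; rewrite -ltNge => rx; apply: ur.
  have h1' : `|h *: evec R i| <= 1.
    by rewrite normrZ ger0_norm// mulr_ile1// norm_evec.
  rewrite -ltrBrDr in rx; rewrite (lt_le_trans rx)//.
  have := ler_normB (x + h *: evec R i) (h *: evec R i); rewrite addrK.
  by move=> H; rewrite lerBlDr (le_trans H)// lerD2l.
- move=> x h S h01 rx; rewrite /rball /= (le_trans (ler_normD _ _))// lerD//.
  exact: hS.
- by move=> j i; exact: measurable_pder.
- move=> j i x; rewrite (le_trans (pder_bound _ _ (uL j)))// ler_piMr//.
  exact: norm_evec.
- move=> j i; have := lip_derivable_ae lamP (evec R i) (uL j).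
  apply: filterS => x dx _; rewrite (pder_derivable dx).
  exact: derivable_quotient_cvg.
Qed.

Lemma grad_det_integral0 (u : 'I_N -> E -> R) (i0 : 'I_N) (L B r : R) :
  (forall i x y, `|u i x - u i y| <= L * `|x - y|) ->
  (forall x, `|u i0 x| <= B) ->
  (forall x, r < `|x| -> u i0 x = 0) ->
  \int[lam]_x grad_det u x = 0.
Proof.
move=> uL uB ur; pose s : 'S_N := tperm ord0 i0.
have := @first_row (fun i => u (s i)) L B r.
rewrite /s tpermL => /(_ (fun i => uL _) uB ur).
move=> H; rewrite -[RHS](mulr0 ((-1) ^+ s)) -[in RHS]H.
have E x : grad_det (fun i => u (s i)) x = (-1) ^+ s * grad_det u x.
  rewrite /grad_det -det_perm -det_mulmx -row_permE; congr (\det _).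
  by apply/matrixP => i j; rewrite !mxE.
have E' x : grad_det u x = (-1) ^+ s * grad_det (fun i => u (s i)) x.
  by rewrite E mulrA -signr_addb addbb mul1r.
under eq_Rintegral do rewrite E'.
rewrite RintegralZl//.
apply: (@bmeas_integrableT _ _ _ _ (rball (r + 1))).
- exact: measurable_rball.
- exact: lebesgue_rball_fin.
- by apply: (bmeas_grad_det (L := L)) => i x y; exact: uL.
- move=> x /negP; rewrite -ltNge; apply: (@grad_det_outside _ _ _ _ ord0).
  by rewrite tpermL.
Qed.

End space_null_lagrangian.

(** * Derivatives and determinants in space-time *)

Section space_time_derivatives.
Variables (R : realType) (N : nat).
Local Notation E := (E R N).
Local Notation ME := (ME R N).
Local Notation MR := (measurableTypeR R).
Local Notation TE := (MR * ME)%type.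
Implicit Types f : R -> E -> R.

Definition st_lip (L : R) f :=
  forall t s x y, `|f t x - f s y| <= L * (`|t - s| + `|x - y|).

Definition tder f (t : R) (x : E) : R :=
  slim (fun k (p : R * E) => k.+1%:R * (f (p.1 + k.+1%:R^-1) p.2 - f p.1 p.2)) (t, x).

Lemma st_lip_space L f t : st_lip L f -> forall x y, `|f t x - f t y| <= L * `|x - y|.
Proof. by move=> fL x y; have := fL t t x y; rewrite subrr normr0 add0r. Qed.

Lemma st_lip_time L f x : st_lip L f -> forall t s, `|f t x - f s x| <= L * `|t - s|.
Proof. by move=> fL t s; have := fL t s x x; rewrite subrr normr0 addr0. Qed.

Lemma st_lip_ge0 L f : st_lip L f -> 0 <= L.
Proof.
move=> /(st_lip_time 0)/(_ 0 1)/(le_trans (normr_ge0 _)).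
by rewrite sub0r normrN normr1 mulr1.
Qed.

Lemma st_lip_continuous L f : st_lip L f -> continuous (fun p : R^o * E => f p.1 p.2).
Proof.
move=> fL; apply: (@lip_continuous _ _ _ (L * 2)) => p q.
rewrite (le_trans (fL _ _ _ _))// -mulrA ler_wpM2l ?(st_lip_ge0 fL)//.
by rewrite prod_normE mulrDl !mul1r lerD// le_max lexx ?orbT.
Qed.

Lemma measurable_st L f : st_lip L f -> measurable_fun setT (fun p : TE => f p.1 p.2).
Proof. by move=> /st_lip_continuous; exact: continuous_measurable_ts. Qed.

Lemma measurable_tder L f : st_lip L f ->
  measurable_fun setT (fun p : TE => tder f p.1 p.2).
Proof.
move=> fL; have mf := measurable_st fL.
apply: (@measurable_slim _ TE R (fun k p => k.+1%:R * (f ((p.1 : R) + k.+1%:R^-1) p.2 - f p.1 p.2))) => k.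
apply: measurable_funM; first exact: measurable_cst.
apply: measurable_funB => //.
have := measurableT_comp mf (@measurable_ts_shift R N (k.+1%:R^-1, 0)).
congr (measurable_fun _ _); apply/funext => p /=.
by rewrite addr0.
Qed.

Lemma measurable_st_pder L f e : st_lip L f ->
  measurable_fun setT (fun p : TE => pder (f p.1) e p.2).
Proof.
move=> fL; have mf := measurable_st fL.
apply: (@measurable_slim _ TE R (fun k p => k.+1%:R * (f p.1 ((p.2 : E) + k.+1%:R^-1 *: e) - f p.1 p.2))) => k.
apply: measurable_funM; first exact: measurable_cst.
apply: measurable_funB => //.
have := measurableT_comp mf (@measurable_ts_shift R N (0, k.+1%:R^-1 *: e)).
congr (measurable_fun _ _); apply/funext => p /=.
by rewrite addr0.
Qed.

Lemma tder_bound L f t x : st_lip L f -> `|tder f t x| <= L.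
Proof.
move=> fL; apply: slim_bound => k /=; rewrite normrM ger0_norm//.
rewrite mulrC -ler_pdivlMr// (le_trans (st_lip_time _ fL _ _))//.
by rewrite addrAC subrr add0r ger0_norm.
Qed.

Lemma st_pder_bound L f t e x : st_lip L f -> `|e| <= 1 -> `|pder (f t) e x| <= L.
Proof.
move=> fL e1; rewrite (le_trans (pder_bound _ _ (st_lip_space t fL)))//.
by rewrite ler_piMr// (st_lip_ge0 fL).
Qed.

Lemma bmeas_tder L f : st_lip L f -> bmeas (fun p : TE => tder f p.1 p.2).
Proof.
move=> fL; split; first exact: measurable_tder fL.
by exists L => p; exact: tder_bound.
Qed.

Lemma bmeas_st_pder L f j : st_lip L f ->
  bmeas (fun p : TE => pder (f p.1) (evec R j) p.2).
Proof.
move=> fL; split; first exact: measurable_st_pder fL.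
by exists L => p; apply: st_pder_bound => //; exact: norm_evec.
Qed.

Lemma tder_derivable f t x : derivable (fun s : R => f s x) t 1 ->
  tder f t x = 'D_1 (fun s : R => f s x) t.
Proof.
move=> /derivable_quotient_cvg ft; apply: slim_cvg; apply: cvg_trans ft.
by apply: near_eq_cvg; near=> k; rewrite /= [_ *: 1]mulr1.
Unshelve. all: by end_near. Qed.

Definition st_der (f : R -> E -> R) (j : 'I_N.+1) (t : R) (x : E) : R :=
  if unlift ord0 j is Some i then pder (f t) (evec R i) x else tder f t x.

Definition st_grad_det (u : 'I_N.+1 -> R -> E -> R) (t : R) (x : E) : R :=
  \det (\matrix_(i, j) st_der (u i) j t x).

Lemma bmeas_st_der L f j : st_lip L f -> bmeas (fun p : TE => st_der f j p.1 p.2).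
Proof.
move=> fL; rewrite /st_der; case: unliftP => [i _|_].
  exact: bmeas_st_pder fL.
exact: bmeas_tder fL.
Qed.

Lemma bmeas_st_grad_det L u : (forall i, st_lip L (u i)) ->
  bmeas (fun p : TE => st_grad_det u p.1 p.2).
Proof.
move=> uL; apply: (@bmeas_det R _ TE N.+1 (fun i j p => st_der (u i) j p.1 p.2)) => i j.
exact: bmeas_st_der (uL i).
Qed.

End space_time_derivatives.

Section space_time_null_lagrangian.
Variables (R : realType) (N : nat).
Local Notation E := (E R N).
Local Notation ME := (ME R N).
Local Notation MR := (measurableTypeR R).
Local Notation TE := (MR * ME)%type.
Variable lam : {sigma_finite_measure set ME -> \bar R}.
Hypothesis lamP : is_lebesgue lam.
Local Notation tsmu := (product_measure1 (@lebesgue_measure R) lam).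

Definition slab (a b r : R) : set TE := [set` `[a, b]] `*` rball r.

Lemma slabP a b r (p : TE) : slab a b r p <-> a <= p.1 <= b /\ `|p.2 : E| <= r.
Proof. by rewrite /slab /rball /=; split => -[]; rewrite in_itv. Qed.

Lemma measurable_slab a b r : measurable (slab a b r).
Proof. by apply: measurableX; [exact: measurable_itv|exact: measurable_rball]. Qed.

Lemma tsmu_slab_fin a b r : (tsmu (slab a b r) < +oo)%E.
Proof.
have mI : measurable ([set` `[a, b]] : set MR) by exact: measurable_itv.
rewrite [ltLHS](product_measure1E lebesgue_measure lam mI (measurable_rball r)).
have H : (@lebesgue_measure R [set` `[a, b]] < +oo)%E.
  by rewrite lebesgue_measure_itv /=; case: ifP => // _; rewrite ltry.
by apply: lte_mul_pinfty => //; [rewrite ge0_fin_numE|exact: lebesgue_rball_fin].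
Qed.

Definition st_dir (j : 'I_N.+1) : R^o * E :=
  if unlift ord0 j is Some i then (0, evec R i) else (1, 0).

Lemma norm_sum_st_dir (S : {set 'I_N.+1}) :
  0 <= (\sum_(i in S) st_dir i).1 <= 1 /\ `|(\sum_(i in S) st_dir i).2| <= N.+1%:R.
Proof.
have E1 (r : seq 'I_N.+1) (P : pred 'I_N.+1) :
    (\sum_(i <- r | P i) st_dir i).1 = \sum_(i <- r | P i) (st_dir i).1.
  by apply: (big_morph (fun p : R^o * E => p.1)).
have E2 (r : seq 'I_N.+1) (P : pred 'I_N.+1) :
    (\sum_(i <- r | P i) st_dir i).2 = \sum_(i <- r | P i) (st_dir i).2.
  by apply: (big_morph (fun p : R^o * E => p.2)).
rewrite E1 E2; split.
  have H (i : 'I_N.+1) : 0 <= (st_dir i).1 by rewrite /st_dir; case: unliftP => /=.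
  rewrite sumr_ge0//=.
  apply: (@le_trans _ _ (\sum_i (st_dir i).1)).
    by rewrite big_mkcond /=; apply: ler_sum => i _; case: ifP.
  rewrite big_ord_recl /= {1}/st_dir unlift_none /= big1 ?addr0// => i _.
  by rewrite /st_dir liftK.
rewrite (le_trans (ler_norm_sum _ _ _))//.
apply: (@le_trans _ _ (\sum_(i in S) (1 : R))).
  apply: ler_sum => i _; rewrite /st_dir; case: unliftP => [j _|_] /=.
    exact: norm_evec.
  by rewrite normr0.
by rewrite sumr_const ler_nat (leq_trans (max_card _))// card_ord.
Qed.

Variables (u : 'I_N.+1 -> R -> E -> R) (L B a b r eta : R).
Hypothesis uL : forall i, st_lip L (u i).
Hypothesis uB : forall t x, `|u ord0 t x| <= B.
Hypothesis u0 : forall t x, t < a \/ b < t \/ r < `|x| -> u ord0 t x = 0.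
Hypothesis eta0 : 0 < eta.
Hypothesis u_der : {ae tsmu, forall p : TE, a - eta <= p.1 <= b + eta -> forall i,
  derivable (fun s : R => u i s p.2) p.1 1 /\
  (forall j, derivable (u i p.1) (p.2 : E) (evec R j))}.

Let delta := Num.min 1 (eta / 2).

Let delta0 : 0 < delta.
Proof. by rewrite lt_min ltr01/= divr_gt0. Qed.

Let st_der0 (t : R) (x : E) : t < a - eta / 2 \/ b + eta / 2 < t \/ r + 1 < `|x| ->
  forall j, st_der (u ord0) j t x = 0.
Proof.
have e0 := eta0; move=> tx j; rewrite /st_der; case: unliftP => [i _|_].
  case: tx => [ta|[tb|rx]].
  - apply: slim_cvg; apply: cvg_near_cst; apply: nearW => k.
    by rewrite !u0 ?subrr ?mulr0//; left; lra.
  - apply: slim_cvg; apply: cvg_near_cst; apply: nearW => k.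
    by rewrite !u0 ?subrr ?mulr0//; right; left; lra.
  - apply: pder_outside rx; last exact: norm_evec.
    by move=> y ry; apply: u0; right; right.
have e20 : 0 < eta / 2 by lra.
apply: slim_cvg; apply: cvg_near_cst; near=> k => /=.
have /andP[k0 ke] : (0 : R) <= k.+1%:R^-1 <= eta / 2.
  by near: k; exact: near_harmonic_le.
move: (k.+1%:R^-1 : R) k0 ke => h k0 ke.
case: tx => [ta|[tb|rx]].
- by rewrite !u0 ?subrr ?mulr0//; left; lra.
- by rewrite !u0 ?subrr ?mulr0//; right; left; lra.
- by rewrite !u0 ?subrr ?mulr0//; right; right; lra.
Unshelve. all: by end_near. Qed.

Lemma st_grad_det_outside t x : t <= a - eta \/ b + eta <= t -> st_grad_det u t x = 0.
Proof.
have e0 := eta0; move=> tx; apply: (@det_row0 _ _ _ ord0) => j; rewrite mxE; apply: st_der0.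
by case: tx => ?; [left; lra|right; left; lra].
Qed.

(** A flow is differentiable only at interior times, hence the derivatives are required only within
    [eta] of the time support [[a, b]]. Half of this margin is used by [K0], which must contain the
    supports of the shifted functions, the other half by [K1], which must contain the translates of
    [K0]; this is why the step is at most [eta / 2]. *)
Lemma st_grad_det_integral0 :
  \int[tsmu]_p st_grad_det u p.1 p.2 = 0.
Proof.
have e0 := eta0.
have D0 (p : TE) : ~ slab (a - eta / 2) (b + eta / 2) (r + 1) p -> st_grad_det u p.1 p.2 = 0.
  move=> Kp; apply: (@det_row0 _ _ _ ord0) => j; rewrite mxE; apply: st_der0.
  case: (ltP p.1 (a - eta / 2)) => [|ap]; first by left.
  case: (ltP (b + eta / 2) p.1) => [|pb]; first by right; left.
  right; right; rewrite ltNge; apply/negP => pr; apply: Kp; apply/slabP.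
  by rewrite ap pb.
rewrite -(Rintegral_setT_supp _ D0).
apply: (@null_lagrangian _ TE R tsmu (R^o * E)%type (@ts_shift R N) N st_dir
  _ _ _ _ (fun i p => u i p.1 p.2) L B delta (slab (a - eta / 2) (b + eta / 2) (r + 1))
  (slab (a - eta) (b + eta) (r + 1 + N.+1%:R)) _ _ _ _ _ _ _ _ _ _
  (fun i j p => st_der (u i) j p.1 p.2)).
- exact: measurable_ts_shift.
- by move=> v A mA; exact: tsmu_shift.
- exact: ts_shift0.
- exact: ts_shiftD.
- by move=> j; exact: measurable_st (uL j).
- move=> j i h [t x] /=; rewrite (le_trans (uL _ _ _ _ _))// ler_wpM2l ?(st_lip_ge0 (uL ord0))//.
  rewrite addrAC subrr add0r [x in `|x - _|]addrC addrK /st_dir.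
  case: unliftP => [k _|_] /=.
    by rewrite [_ *: 0]mulr0 normr0 add0r normrZ ler_piMr// norm_evec.
  by rewrite scaler0 normr0 addr0 [_ *: 1]mulr1.
- by move=> p; exact: uB.
- exact: delta0.
- exact: measurable_slab.
- exact: measurable_slab.
- exact: tsmu_slab_fin.
- exact: tsmu_slab_fin.
- move=> [t x] h i /andP[h0]; rewrite le_min => /andP[h1 he] Kp /=; apply: u0.
  have htx : (0 <= (st_dir i).1 <= 1) /\ `|(st_dir i).2| <= 1.
    rewrite /st_dir; case: unliftP => [k _|_] /=; rewrite ?lexx ?ler01 ?normr0//.
    by split=> //; exact: norm_evec.
  have [/andP[d0 d1] dx] := htx.
  have hd0 : 0 <= h * (st_dir i).1 by rewrite mulr_ge0.
  have hd1 : h * (st_dir i).1 <= eta / 2 by rewrite (le_trans _ he)// ler_piMr.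
  have hdx : `|h *: (st_dir i).2| <= 1.
    by rewrite normrZ ger0_norm// mulr_ile1.
  have [ta|ta] := ltP t (a - eta / 2).
    left; rewrite -[X in _ + X]/(h * (st_dir i).1); lra.
  have [tb|tb] := ltP (b + eta / 2) t.
    right; left; rewrite -[X in _ + X]/(h * (st_dir i).1); lra.
  right; right; have rx : r + 1 < `|x : E|.
    by rewrite ltNge; apply/negP => xr; apply: Kp; apply/slabP; rewrite ta tb.
  have := ler_normB ((x : E) + h *: (st_dir i).2) (h *: (st_dir i).2); rewrite addrK; lra.
- move=> [t x] h S /andP[h0]; rewrite le_min => /andP[h1 he] /slabP[/= /andP[at_ tb] xr].
  have [/andP[d0 d1] dx] := norm_sum_st_dir S.
  set v := \sum_(i in S) _ in d0 d1 dx *.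
  have hd0 : 0 <= h * v.1 by rewrite mulr_ge0.
  have hd1 : h * v.1 <= eta / 2 by rewrite (le_trans _ he)// ler_piMr.
  have hdx : `|h *: v.2| <= N.+1%:R.
    by rewrite normrZ ger0_norm// -[leRHS]mul1r ler_pM.
  apply/slabP; split.
    have : a - eta <= t + h * v.1 <= b + eta by apply/andP; split; lra.
    by [].
  by rewrite /= (le_trans (ler_normD _ _))// lerD.
- by move=> j i; exact: (bmeas_st_der i (uL j)).1.
- move=> j i p; rewrite /st_der; case: unliftP => [k _|_].
    by apply: st_pder_bound => //; exact: norm_evec.
  exact: tder_bound.
- move=> j i; apply: filterS u_der => p + Kp.
  rewrite /st_dir /st_der; case: p Kp => t x /slabP[/= tab _] /(_ tab j) [dt dx].
  case: unliftP => [k _|_] /=.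
    have := derivable_quotient_cvg (dx k); rewrite -(pder_derivable (dx k)).
    apply: cvg_trans; apply: near_eq_cvg; near=> n.
    by rewrite -[X in t + X]/(n.+1%:R^-1 * 0) mulr0 addr0.
  have := derivable_quotient_cvg dt; rewrite -(tder_derivable dt).
  apply: cvg_trans; apply: near_eq_cvg; near=> n.
  by rewrite -[X in x + X]/(n.+1%:R^-1 *: 0) scaler0 addr0.
Unshelve. all: by end_near. Qed.

End space_time_null_lagrangian.

(** * Transport along the speed *)

(** Cramer's rule: [M *m c] has a single nonzero entry, so the first entry of [\adj M *m (M *m c)],
    which is [\det M], is this entry times a cofactor. *)
Lemma det_column (R : comRingType) n (M : 'M[R]_n.+1) (c : 'cV[R]_n.+1) :
  c ord0 0 = 1 -> (forall i, (M *m c) (lift ord0 i) 0 = 0) ->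
  \det M = (M *m c) ord0 0 * \det (\matrix_(i, j) M (lift ord0 i) (lift ord0 j)).
Proof.
move=> c0 Mc; have : (\adj M *m (M *m c)) ord0 0 = \det M.
  by rewrite mulmxA mul_adj_mx mul_scalar_mx mxE c0 mulr1.
rewrite mxE big_ord_recl big1 => [|i _]; last by rewrite Mc mulr0.
rewrite addr0 => <-; rewrite mulrC; congr (_ * _).
rewrite mxE /cofactor addn0 expr0 mul1r; congr (\det _).
by apply/matrixP => i j; rewrite !mxE.
Qed.

Section transport.
Variables (R : realType) (N : nat).
Local Notation E := (E R N).
Local Notation ME := (ME R N).
Local Notation MR := (measurableTypeR R).
Local Notation TE := (MR * ME)%type.
Variable lam : {sigma_finite_measure set ME -> \bar R}.
Hypothesis lamP : is_lebesgue lam.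
Local Notation tsmu := (product_measure1 (@lebesgue_measure R) lam).
Variables (T : R) (a : R -> E -> E).
Implicit Types (w f g : R -> E -> R).

Definition der_at w (t : R) (x : E) :=
  derivable (fun s : R => w s x) t 1 /\ forall j, derivable (w t) x (evec R j).

Definition mat_der w (t : R) (x : E) : R :=
  'D_1 (fun s : R => w s x) t + \sum_(j < N) a t x 0 j * 'D_(evec R j) (w t) x.

(** Derivability is part of the condition because [derive] has a meaning without it. Such functions
    are closed under sums, products and one-variable composition, which is all that building test
    functions of a flow requires. *)
Definition transported w := {ae tsmu, forall p : TE, 0 < (p.1 : R) < T ->
  der_at w p.1 p.2 /\ mat_der w p.1 p.2 = 0}.

Lemma der_atD f g t x : der_at f t x -> der_at g t x ->
  der_at (fun t x => f t x + g t x) t x /\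
  mat_der (fun t x => f t x + g t x) t x = mat_der f t x + mat_der g t x.
Proof.
move=> [ft fx] [gt gx]; split.
  split; first exact: (derivableD ft gt).
  by move=> j; exact: (derivableD (fx j) (gx j)).
rewrite /mat_der (deriveD ft gt) addrACA -big_split /=; congr (_ + _).
by apply: eq_bigr => j _; rewrite (deriveD (fx j) (gx j)) mulrDr.
Qed.

Lemma der_atM f g t x : der_at f t x -> der_at g t x ->
  der_at (fun t x => f t x * g t x) t x /\
  mat_der (fun t x => f t x * g t x) t x = f t x * mat_der g t x + g t x * mat_der f t x.
Proof.
move=> [ft fx] [gt gx]; split.
  split; first exact: (derivableM ft gt).
  by move=> j; exact: (derivableM (fx j) (gx j)).
rewrite /mat_der (deriveM ft gt) !mulrDr addrACA !mulr_sumr -big_split /=; congr (_ + _).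
apply: eq_bigr => j _; rewrite (deriveM (fx j) (gx j)) mulrDr.
by congr (_ + _); rewrite mulrCA.
Qed.

Lemma der_at_cst c t x : der_at (fun _ _ => c) t x /\ mat_der (fun _ _ => c) t x = 0.
Proof.
split; first by split => [|j]; exact: derivable_cst.
rewrite /mat_der derive_cst add0r big1// => j _.
by rewrite derive_cst mulr0.
Qed.

Lemma transportedD f g : transported f -> transported g ->
  transported (fun t x => f t x + g t x).
Proof.
apply: filterS2 => p hf hg pT; have [df mf] := hf pT; have [dg mg] := hg pT.
by have [d ->] := der_atD df dg; rewrite mf mg addr0.
Qed.

Lemma transportedM f g : transported f -> transported g ->
  transported (fun t x => f t x * g t x).
Proof.
apply: filterS2 => p hf hg pT; have [df mf] := hf pT; have [dg mg] := hg pT.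
by have [d ->] := der_atM df dg; rewrite mf mg !mulr0 addr0.
Qed.

Lemma transported_cst c : transported (fun _ _ => c).
Proof. by apply: aeW => p _; exact: der_at_cst. Qed.

Lemma transported_prod (I : Type) (r : seq I) (f : I -> R -> E -> R) :
  (forall i, transported (f i)) -> transported (fun t x => \prod_(i <- r) f i t x).
Proof.
move=> tf; elim: r => [|i r IH].
  have := transported_cst 1; congr transported.
  by apply/funext => t; apply/funext => x; rewrite big_nil.
have := transportedM (tf i) IH; congr transported.
by apply/funext => t; apply/funext => x; rewrite big_cons.
Qed.

(** The quadratic remainder stands for the differentiability of [S]. Divided by the step [h], it is
    at most [C * |h| * |q h| ^ 2], where the quotient [q h] converges, hence it vanishes in the
    limit. *)
Lemma derivable_comp_quadratic (V : normedModType R) (f : V -> R) (S S' : R -> R) (C : R) x v :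
  (forall y h, `|S (y + h) - S y - S' y * h| <= C * h ^+ 2) ->
  derivable f x v ->
  derivable (S \o f) x v /\ 'D_v (S \o f) x = S' (f x) * 'D_v f x.
Proof.
move=> SC df; pose q (h : R) := h^-1 *: (f (h *: v + x) - f x).
have qD : q @ 0^' --> 'D_v f x := df.
suff H : h^-1 *: ((S \o f) (h *: v + x) - (S \o f) x) @[h --> 0^'] --> S' (f x) * 'D_v f x.
  by split; [apply/cvg_ex; eexists; exact: H|exact: (cvg_lim (@Rhausdorff R) H)].
have C0 : 0 <= C.
  by have := SC 0 1; rewrite expr1n !mulr1; apply: le_trans.
apply: (@cvg_trans _ ((fun h => S' (f x) * q h + h^-1 *: ((S \o f) (h *: v + x) - (S \o f) x - S' (f x) * (f (h *: v + x) - f x))) @ 0^')).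
  apply: near_eq_cvg; near=> h; by rewrite /q /GRing.scale /=; ring.
rewrite -[S' (f x) * 'D_v f x]addr0; apply: cvgD.
  by apply: cvgM => //; exact: cvg_cst.
apply: norm_cvg0; apply: (@squeeze_cvgr _ _ _ _ (fun=> 0) (fun h => C * `|h| * `|q h| ^+ 2)).
- near=> h; rewrite normr_ge0 /=.
  have h0 : h != 0 by near: h; exact: nbhs_dnbhs_neq.
  have fq : f (h *: v + x) - f x = h * q h.
    by rewrite /q -[h^-1 *: _]/(h^-1 * _) mulrA divff// mul1r.
  rewrite normrM normfV ler_pdivrMl ?normr_gt0//.
  have := SC (f x) (f (h *: v + x) - f x); rewrite [f x + _]addrC subrK.
  move=> /le_trans; apply; rewrite fq exprMn -normrX [`|q h ^+ 2|]ger0_norm ?sqr_ge0//.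
  rewrite [leRHS](_ : _ = C * (`|h| ^+ 2 * q h ^+ 2)); last by ring.
  by rewrite real_normK ?num_real.
- exact: cvg_cst.
- have K : C * `|h| * (`|q h| * `|q h|) @[h --> (0 : R)^'] --> C * 0 * (`|'D_v f x| * `|'D_v f x|).
    apply: cvgM; last by apply: cvgM; exact: cvg_norm.
    apply: cvgM; first exact: cvg_cst.
    have n0 : `|h| @[h --> (0 : R)] --> `|0 : R| by apply: cvg_norm; exact: cvg_id.
    by rewrite normr0 in n0; exact: cvg_within_filter.
  by move: K; rewrite mulr0 mul0r.
Unshelve. all: by end_near. Qed.

Lemma transported_comp (S S' : R -> R) (C : R) f :
  (forall y h, `|S (y + h) - S y - S' y * h| <= C * h ^+ 2) ->
  transported f -> transported (fun t x => S (f t x)).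
Proof.
move=> SC; apply: filterS => p hf pT; have [[ft fx] mf] := hf pT.
have [dt Dt] := derivable_comp_quadratic SC ft.
split.
  split; first exact: dt.
  by move=> j; have [dj _] := derivable_comp_quadratic SC (fx j); exact: dj.
rewrite /mat_der [X in X + _]Dt.
under eq_bigr => j _ do rewrite (derivable_comp_quadratic SC (fx j)).2 mulrCA.
by rewrite -mulr_sumr -mulrDr -[_ + _]/(mat_der f p.1 p.2) mf mulr0.
Qed.

End transport.

Section flow.
Variables (R : realType) (N : nat).
Local Notation E := (E R N).
Local Notation ME := (ME R N).
Local Notation MR := (measurableTypeR R).
Local Notation TE := (MR * ME)%type.
Variable lam : {sigma_finite_measure set ME -> \bar R}.
Hypothesis lamP : is_lebesgue lam.
Local Notation tsmu := (product_measure1 (@lebesgue_measure R) lam).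
Variables (T : R) (a : R -> E -> E).
Hypothesis T0 : 0 < T.

Lemma st_aeP (P : R -> E -> Prop) : st_ae lam P <-> {ae tsmu, forall p : TE, P p.1 p.2}.
Proof. by split=> -[Z [mZ Z0 ZP]]; exists Z. Qed.

(** The retraction of the line onto [[0, T]]. With other lengths in place of [T] it later serves as
    a ramp, to build cutoffs in time and in space. *)
Definition clamp (t : R) := Num.max 0 (Num.min t T).

Lemma clamp_itv t : 0 <= clamp t <= T.
Proof. by rewrite /clamp le_max lexx ge_max ge_min lexx orbT (ltW T0). Qed.

Lemma clamp_id t : 0 <= t <= T -> clamp t = t.
Proof. by rewrite /clamp => /andP[t0 tT]; rewrite (min_idPl tT) (max_idPr t0). Qed.

Lemma clamp_lip t s : `|clamp t - clamp s| <= `|t - s|.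
Proof.
have T0' := T0; have h1 := ler_norm (t - s); have := ler_norm (s - t).
rewrite distrC => h2.
rewrite /clamp; case: (leP t T) => tT; case: (leP s T) => sT;
  rewrite ?(max_idPr (ltW T0)); (try case: (leP 0 t) => t0); (try case: (leP 0 s) => s0);
  rewrite ler_norml; apply/andP; split; lra.
Qed.

(* Extending the flow by its boundary values makes it Lipschitz on the whole space-time. *)
Definition comp_flow (X : R -> E -> E) (i : 'I_N) (t : R) (x : E) : R := X (clamp t) x 0 i.

(** A bounded Borel representative of [jac], defined at all times and points; computations are made
    with it and translated back by [jac_Jac_ae]. *)
Definition Jac (X : R -> E -> E) (t : R) (x : E) : R := grad_det (fun i => comp_flow X i t) x.

Variable X : R -> E -> E.
Hypothesis flowX : transport_flow lam T a X.

Lemma flow_lip : exists L, (forall i, st_lip L (comp_flow X i)) /\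
  forall t s (x y : E), 0 <= t <= T -> 0 <= s <= T -> `|X t x - X s y| <= L * (`|t - s| + `|x - y|).
Proof.
have [[L XL] _] := flowX; exists L; split => // i t s x y.
have := XL _ _ x y (clamp_itv t) (clamp_itv s).
have := rv_norm_coord (X (clamp t) x - X (clamp s) y) i; rewrite !mxE => /le_trans H /H.
move=> /le_trans; apply; have L0 : 0 <= L.
  have := XL T 0 0 0; rewrite subr0 subrr normr0 addr0 gtr0_norm// !lexx !(ltW T0).
  by move=> /(_ isT isT)/(le_trans (normr_ge0 _)); rewrite pmulr_lge0.
by rewrite ler_wpM2l// lerD2r clamp_lip.
Qed.

Lemma comp_flow_end i t x : T <= t -> comp_flow X i t x = x 0 i.
Proof.
move=> tT; have [_ [_ [XT _]]] := flowX.
by rewrite /comp_flow /clamp (min_idPr tT) (max_idPr (ltW T0)) XT.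
Qed.

Lemma near_clamp t : 0 < t < T -> \forall s \near t, clamp s = s.
Proof.
move=> /andP[t0 tT]; near=> s; apply: clamp_id; apply/andP; split; near: s.
  exact: lt_le_nbhsr.
exact: lt_le_nbhsl.
Unshelve. all: by end_near. Qed.

Lemma comp_flow_transported i : transported lam T a (comp_flow X i).
Proof.
have [_ [/st_aeP Xd _]] := flowX; apply: filterS Xd => -[t x] /= H t0T.
have [dt [dx eq]] := H t0T i.
have nE : {near t, (fun s : R => X s x 0 i) =1 (fun s : R => comp_flow X i s x)}.
  by apply: filterS (near_clamp t0T) => s; rewrite /comp_flow => ->.
have tT : clamp t = t.
  by apply: clamp_id; case/andP: t0T => ? ?; rewrite !ltW.
split.
  split; first exact: near_eq_derivable dt.
  by move=> j; rewrite /comp_flow tT; exact: dx.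
rewrite /mat_der -[RHS]eq /comp_flow tT; congr (_ + _).
by apply: near_eq_derive; apply: filterS nE => s ->.
Qed.

Lemma bmeas_Jac : bmeas (fun p : TE => Jac X p.1 p.2).
Proof.
have [L [XL _]] := flow_lip.
apply: (@bmeas_det R _ TE N (fun i j p => pder (comp_flow X i p.1) (evec R j) p.2)) => i j.
exact: bmeas_st_pder (XL i).
Qed.

Lemma bmeas_Jac_space t : bmeas (Jac X t : ME -> R).
Proof.
have [L [XL _]] := flow_lip.
by apply: (bmeas_grad_det (L := L)) => i; exact: st_lip_space.
Qed.

Lemma Jac_end x : Jac X T x = 1.
Proof.
rewrite /Jac /grad_det (_ : \matrix_(i, j) _ = 1%:M) ?det1//.
apply/matrixP => i j; rewrite !mxE; apply: slim_cvg; apply: cvg_near_cst.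
apply: nearW => k; rewrite !comp_flow_end// !mxE eqxx /= addrAC subrr add0r mulrA divff ?pnatr_eq0// mul1r.
by rewrite eq_sym; case: eqP.
Qed.

(** It holds at every single time, because it rests on the spatial Lipschitz bound and not on the
    transport equation, which is silent on null sets of times. *)
Lemma jac_Jac_ae t : 0 <= t <= T -> {ae lam, forall x : ME, jac X t x = Jac X t x}.
Proof.
move=> tT; have [L [XL _]] := flow_lip.
have H i j : {ae lam, forall x : ME, derivable (comp_flow X i t) (x : E) (evec R j)}.
  exact: (lip_derivable_ae lamP (evec R j) (st_lip_space t (XL i))).
have H2 : {ae lam, forall x : ME, forall ij : 'I_N * 'I_N, derivable (comp_flow X ij.1 t) (x : E) (evec R ij.2)}.
  apply: filter_forall => -[i j]; exact: H.
apply: filterS H2 => x Hx; rewrite /jac /Jac /grad_det; congr (\det _).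
apply/matrixP => i j; rewrite !mxE (pder_derivable (Hx (i, j))).
by rewrite /comp_flow clamp_id.
Qed.

(* Column operation: multiplying the space-time gradients by the column (1, a) turns them into material derivatives. *)
Lemma st_grad_det_flow (v : R -> E -> R) (p : TE) : 0 < (p.1 : R) < T ->
  der_at v p.1 p.2 ->
  (forall i, der_at (comp_flow X i) p.1 p.2 /\ mat_der a (comp_flow X i) p.1 p.2 = 0) ->
  st_grad_det (fun j => if unlift ord0 j is Some i then comp_flow X i else v) p.1 p.2 =
  mat_der a v p.1 p.2 * Jac X p.1 p.2.
Proof.
case: p => t x /= t0T vd Xd; rewrite /st_grad_det.
set u := fun j => _; set M := \matrix_(i, j) _.
pose c : 'cV[R]_N.+1 := \col_i (if unlift ord0 i is Some j then a t x 0 j else 1).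
have Mc w : der_at w t x ->
    \sum_k st_der w k t x * c k 0 = mat_der a w t x.
  move=> [wt wx]; rewrite big_ord_recl /c mxE /st_der unlift_none mulr1 (tder_derivable wt).
  rewrite /mat_der; congr (_ + _); apply: eq_bigr => i _.
  by rewrite mxE liftK (pder_derivable (wx i)) mulrC.
rewrite (det_column (c := c)).
- congr (_ * _).
    rewrite mxE -(Mc v vd); apply: eq_bigr => k _; rewrite mxE /u unlift_none//.
  rewrite /Jac /grad_det; congr (\det _); apply/matrixP => i j; rewrite !mxE.
  by rewrite /u liftK /st_der liftK.
- by rewrite /c mxE unlift_none.
- move=> i; rewrite mxE -[RHS](Xd i).2 -(Mc _ (Xd i).1); apply: eq_bigr => k _.
  by rewrite mxE /u liftK.
Qed.

End flow.

Section conservation.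
Variables (R : realType) (N : nat).
Local Notation E := (E R N).
Local Notation ME := (ME R N).
Local Notation MR := (measurableTypeR R).
Local Notation TE := (MR * ME)%type.
Variable lam : {sigma_finite_measure set ME -> \bar R}.
Hypothesis lamP : is_lebesgue lam.
Local Notation tsmu := (product_measure1 (@lebesgue_measure R) lam).
Variables (T : R) (a : R -> E -> E).
Hypothesis T0 : 0 < T.

Lemma tsmu_Rintegral (g : TE -> R) (s1 s2 r : R) : bmeas g ->
  (forall p, ~ slab s1 s2 r p -> g p = 0) ->
  \int[tsmu]_p g p = \int[@lebesgue_measure R]_t \int[lam]_x g (t, x).
Proof.
move=> bg g0; have ig : tsmu.-integrable setT (EFin \o g).
  apply: bmeas_integrableT bg g0; [exact: measurable_slab|exact: tsmu_slab_fin].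
rewrite {1}/Rintegral -[X in fine X = _](integral12_prod_meas1 ig).
rewrite /Rintegral; congr fine; apply: eq_integral => t _ /=.
rewrite fineK//; apply: integral_fune_fin_num => //.
apply: (@bmeas_integrableT _ _ _ _ (rball r) (fun x => g (t, x))).
- exact: measurable_rball.
- exact: lebesgue_rball_fin.
- apply: bmeas_comp bg; exact: pair1_measurable.
- by move=> x xr; apply: g0 => /slabP[_ /=].
Qed.

Variable X : R -> E -> E.
Hypothesis flowX : transport_flow lam T a X.

(* The integrand agrees a.e. with the space-time determinant of (phi w, X_1, ..., X_N), a null Lagrangian. *)
Lemma flow_integral0 (w phi : R -> E -> R) (Lw Bw Lp Bp al be r : R) (g : TE -> R) :
  st_lip Lw w -> (forall t x, `|w t x| <= Bw) ->
  st_lip Lp phi -> (forall t x, `|phi t x| <= Bp) ->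
  transported lam T a w ->
  {ae tsmu, forall p : TE, 0 < (p.1 : R) < T -> der_at phi p.1 p.2} ->
  0 < al -> al <= be -> be < T ->
  (forall t x, t < al \/ be < t \/ r < `|x| -> phi t x * w t x = 0) ->
  measurable_fun setT g ->
  {ae tsmu, forall p : TE, 0 < (p.1 : R) < T ->
     g p = w p.1 p.2 * Jac T X p.1 p.2 * mat_der a phi p.1 p.2} ->
  (forall p : TE, ~ (0 < (p.1 : R) < T) -> g p = 0) ->
  \int[tsmu]_p g p = 0.
Proof.
move=> wL wB pL pB tw dphi al0 albe beT sup mg gE g0.
have [L [XL _]] := flow_lip T0 flowX.
(* Only the product needs a compact support: [phi] may depend on time alone when [w] has compact
   support in space, and [w] may live at all times when [phi] is a test function. *)
pose v t x := phi t x * w t x.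
have Bw0 : 0 <= Bw := le_trans (normr_ge0 _) (wB 0 0).
have Bp0 : 0 <= Bp := le_trans (normr_ge0 _) (pB 0 0).
have Lw0 := st_lip_ge0 wL; have Lp0 := st_lip_ge0 pL.
have L0 : 0 <= Num.max L (Bp * Lw + Lp * Bw).
  by rewrite le_max; apply/orP; right; rewrite addr_ge0// mulr_ge0.
have vL : st_lip (Bp * Lw + Lp * Bw) v.
  move=> t s x y; rewrite /v.
  have -> : phi t x * w t x - phi s y * w s y =
    phi t x * (w t x - w s y) + (phi t x - phi s y) * w s y by ring.
  rewrite (le_trans (ler_normD _ _))// !normrM mulrDl lerD//.
    by rewrite -mulrA ler_pM.
  by rewrite mulrAC ler_pM.
pose u j := if unlift ord0 j is Some i then comp_flow T X i else v.
(* Half of the room between the support and the ends of [[0, T]], so that the enlarged time interval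
   stays where the equation holds. *)
pose eta := Num.min al (T - be) / 2.
have [eta0 [e1 e2]] : 0 < eta /\ eta < al /\ be + eta < T.
  rewrite /eta; case: (leP al (T - be)) => H; split => //; lra.
have uL j : st_lip (Num.max L (Bp * Lw + Lp * Bw)) (u j).
  move=> t s x y; have d0 : 0 <= `|t - s| + `|x - y| by rewrite addr_ge0.
  rewrite /u; case: unliftP => [i _|_].
    by rewrite (le_trans (XL _ _ _ _ _))// ler_wpM2r// le_max lexx.
  by rewrite (le_trans (vL _ _ _ _))// ler_wpM2r// le_max lexx orbT.
have uB t x : `|u ord0 t x| <= Bp * Bw.
  by rewrite /u unlift_none /v normrM ler_pM.
have u0 t x : t < al \/ be < t \/ r < `|x| -> u ord0 t x = 0.
  by rewrite /u unlift_none; exact: sup.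
have AX : {ae tsmu, forall p : TE, forall i, 0 < (p.1 : R) < T ->
    der_at (comp_flow T X i) p.1 p.2 /\ mat_der a (comp_flow T X i) p.1 p.2 = 0}.
  apply: filter_forall => i; exact: comp_flow_transported.
have uder : {ae tsmu, forall p : TE, al - eta <= (p.1 : R) <= be + eta -> forall i,
    derivable (fun s : R => u i s p.2) p.1 1 /\
    (forall j, derivable (u i p.1) (p.2 : E) (evec R j))}.
  apply: filterS3 AX dphi tw => p hX hp hw pt i.
  have pT : 0 < (p.1 : R) < T.
    by case/andP: pt => p1 p2; apply/andP; split; lra.
  rewrite /u; case: unliftP => [k _|_].
    exact: (hX k pT).1.
  exact: (der_atM a (hp pT) (hw pT).1).1.
have H := st_grad_det_integral0 lamP uL uB u0 eta0 uder.
rewrite -[RHS]H /Rintegral; congr fine; apply: ae_eq_integral => //.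
- exact/measurable_EFinP.
- by apply/measurable_EFinP; exact: (bmeas_st_grad_det uL).1.
suff [Z [mZ Z0 ZP]] : {ae tsmu, forall p : TE, g p = st_grad_det u p.1 p.2}.
  exists Z; split => // p np; apply: ZP => gp; by apply: np => _; rewrite /= gp.
have dw : {ae tsmu, forall p : TE, 0 < (p.1 : R) < T -> der_at phi p.1 p.2 /\
    der_at w p.1 p.2 /\ mat_der a w p.1 p.2 = 0}.
  by apply: filterS2 dphi tw => p hp hw pT; split; [exact: hp|exact: hw].
apply: filterS3 AX dw gE => p hX hw hg.
have [pT|pT] := boolP (0 < (p.1 : R) < T); last first.
  rewrite (g0 p (negP pT)) (@st_grad_det_outside _ _ u al be r eta u0 eta0)//.
  move: pT; rewrite negb_and -!leNgt => /orP[?|?]; [left|right]; lra.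
have [dp [dw' mw]] := hw pT; have [vd vm] := der_atM a dp dw'.
rewrite (hg pT) (st_grad_det_flow pT vd (fun i => hX i pT)) vm mw mulr0 add0r.
by rewrite mulrAC.
Qed.


End conservation.

(** * Integration by parts for Jacobians and regularity in time *)

Lemma det_entries_bound (R : realDomainType) n (M : 'M[R]_n) (K : R) :
  0 <= K -> (forall i j, `|M i j| <= K) -> `|\det M| <= n`!%:R * K ^+ n.
Proof.
move=> K0 MK; rewrite /determinant (le_trans (ler_norm_sum _ _ _))//.
have -> : n`!%:R * K ^+ n = \sum_(s : 'S_n) K ^+ n.
  by rewrite sumr_const card_Sn mulr_natl.
apply: ler_sum => s _; rewrite normrM normrX normrN1 expr1n mul1r normr_prod.
rewrite -[n in leRHS]card_ord -prodr_const; apply: ler_prod => i _.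
by rewrite normr_ge0 MK.
Qed.

Lemma Rintegral_abs_le d (T : measurableType d) (R : realType) (mu : {measure set T -> \bar R})
    (K : set T) (f : T -> R) (B : R) :
  measurable K -> (mu K < +oo)%E -> bmeas f -> (forall x, ~ K x -> f x = 0) ->
  (forall x, `|f x| <= B) -> `|\int[mu]_x f x| <= B * fine (mu K).
Proof.
move=> mK Kfin bf f0 fB; rewrite -(Rintegral_setT_supp _ f0).
have fi := bmeas_integrable mK Kfin bf.
by rewrite (le_trans (le_normr_Rintegral _ _))// Rintegral_norm_le.
Qed.

Lemma grad_det_integral0_ord (R : realType) N (lam : {sigma_finite_measure set ME R N -> \bar R})
    (u : 'I_N -> E R N -> R) (i0 : 'I_N) (L B r : R) : is_lebesgue lam ->
  (forall i x y, `|u i x - u i y| <= L * `|x - y|) ->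
  (forall x, `|u i0 x| <= B) -> (forall x, r < `|x| -> u i0 x = 0) ->
  \int[lam]_x grad_det u x = 0.
Proof.
by case: N lam u i0 => [? ? []//|m] lam u i0 lamP; exact: grad_det_integral0.
Qed.

Section integration_by_parts.
Variables (R : realType) (N : nat).
Local Notation E := (E R N).
Local Notation ME := (ME R N).
Variable lam : {sigma_finite_measure set ME -> \bar R}.
Hypothesis lamP : is_lebesgue lam.
Implicit Types (u : 'I_N -> E -> R) (w : E -> R).

Definition lip (L : R) (f : E -> R) := forall x y, `|f x - f y| <= L * `|x - y|.

Definition upd u (i0 : 'I_N) w := fun i => if i == i0 then w else u i.

Lemma bmeas_lip L B f : lip L f -> (forall x, `|f x| <= B) -> bmeas (f : ME -> R).
Proof.
move=> fL fB; split; last by exists B.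
by apply: continuous_measurable_rv; exact: lip_continuous fL.
Qed.

Lemma grad_det_linear u u1 u2 i0 b c x :
  (forall i, i != i0 -> u1 i = u i) -> (forall i, i != i0 -> u2 i = u i) ->
  (forall j, pder (u i0) (evec R j) x =
     b * pder (u1 i0) (evec R j) x + c * pder (u2 i0) (evec R j) x) ->
  grad_det u x = b * grad_det u1 x + c * grad_det u2 x.
Proof.
move=> h1 h2 h; apply: (determinant_multilinear (i0 := i0)).
- by apply/rowP => j; rewrite !mxE.
- by apply/matrixP => i j; rewrite !mxE h1// eq_sym neq_lift.
- by apply/matrixP => i j; rewrite !mxE h2// eq_sym neq_lift.
Qed.

Lemma grad_det_bound u L x : 0 <= L -> (forall i, lip L (u i)) ->
  `|grad_det u x| <= N`!%:R * L ^+ N.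
Proof.
move=> L0 uL; apply: det_entries_bound => // i j; rewrite mxE.
rewrite (le_trans (pder_bound _ _ (uL i)))// ler_piMr//; exact: norm_evec.
Qed.

Lemma grad_derivable_ae (f : E -> R) L : lip L f ->
  {ae lam, forall x : ME, forall j, derivable f (x : E) (evec R j)}.
Proof. move=> fL; apply: filter_forall => j; exact: (lip_derivable_ae lamP (evec R j) fL). Qed.

(** Replacing [u i0] by [w * u i0] gives a determinant of zero integral, which the product rule
    splits in two: the derivatives pass from [u i0] to [w]. The bound thus involves the size [D] of
    [u i0] linearly, while its gradient enters only through the fixed constant [L]. *)
Lemma grad_det_parts u i0 w (L B D r : R) : 0 <= L ->
  (forall i, lip L (u i)) -> lip L w -> (forall x, `|w x| <= B) ->
  (forall x, r < `|x| -> w x = 0) -> (forall x, `|u i0 x| <= D) ->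
  `|\int[lam]_x (w x * grad_det u x)| <= D * (N`!%:R * L ^+ N) * fine (lam (rball (r + 1))).
Proof.
move=> L0 uL wL wB wr uD.
have B0 : 0 <= B := le_trans (normr_ge0 _) (wB 0).
have D0 : 0 <= D := le_trans (normr_ge0 _) (uD 0).
have mK := @measurable_rball R N (r + 1); have fK := lebesgue_rball_fin lamP (r + 1).
pose v x := w x * u i0 x.
have vL : lip (B * L + L * D) v.
  move=> x y; rewrite /v.
  have -> : w x * u i0 x - w y * u i0 y = w x * (u i0 x - u i0 y) + (w x - w y) * u i0 y by ring.
  rewrite (le_trans (ler_normD _ _))// !normrM mulrDl lerD//.
    by rewrite -mulrA ler_pM//; exact: uL.
  by rewrite mulrAC ler_pM//; exact: wL.
have LL : L <= L + (B * L + L * D) by rewrite lerDl addr_ge0// mulr_ge0.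
have LL' : B * L + L * D <= L + (B * L + L * D) by rewrite lerDr.
have u'L i : lip (L + (B * L + L * D)) (upd u i0 v i).
  rewrite /upd => x y; case: eqP => _.
    by rewrite (le_trans (vL _ _))// ler_wpM2r.
  by rewrite (le_trans (uL _ _ _))// ler_wpM2r.
have u2L i : lip L (upd u i0 w i) by rewrite /upd; case: eqP.
have I0 : \int[lam]_x grad_det (upd u i0 v) x = 0.
  apply: (grad_det_integral0_ord (i0 := i0) (B := B * D) (r := r) lamP u'L) => x.
    by rewrite /upd eqxx /v normrM ler_pM.
  by rewrite /upd eqxx /v => /wr ->; rewrite mul0r.
pose f1 x := w x * grad_det u x; pose f2 x := u i0 x * grad_det (upd u i0 w) x.
have bgu : bmeas (grad_det u : ME -> R) := bmeas_grad_det uL.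
have b1 : bmeas (f1 : ME -> R) by apply: bmeasM bgu; exact: bmeas_lip wL wB.
have b2 : bmeas (f2 : ME -> R).
  by apply: bmeasM (bmeas_grad_det u2L); exact: bmeas_lip (uL i0) uD.
have out x : ~ rball (r + 1) x -> f1 x = 0 /\ f2 x = 0.
  move=> /negP; rewrite -ltNge => rx; rewrite /f1 /f2; split.
    by rewrite wr ?mul0r//; lra.
  rewrite (@grad_det_outside _ _ _ r i0) ?mulr0// => y.
  by rewrite /upd eqxx; exact: wr.
have i1 : lam.-integrable setT (EFin \o (f1 : ME -> R)).
  by apply: bmeas_integrableT mK fK b1 _ => x /out[].
have i2 : lam.-integrable setT (EFin \o (f2 : ME -> R)).
  by apply: bmeas_integrableT mK fK b2 _ => x /out[].
have H : \int[lam]_x (f1 x + f2 x) = 0.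
  rewrite -[RHS]I0 /Rintegral; congr fine; apply: ae_eq_integral => //.
  - by apply/measurable_EFinP; exact: (bmeasD b1 b2).1.
  - by apply/measurable_EFinP; exact: (bmeas_grad_det u'L).1.
  suff K : {ae lam, forall x : ME, f1 x + f2 x = grad_det (upd u i0 v) x}.
    by apply: filterS K => x -> _.
  apply: filterS2 (grad_derivable_ae wL) (grad_derivable_ae (uL i0)) => x dw du.
  apply/esym; apply: (grad_det_linear (i0 := i0)).
  - by move=> i; rewrite /upd => /negbTE ->.
  - by move=> i; rewrite /upd => /negbTE ->.
  move=> j; rewrite /upd eqxx (pder_derivable (dw j)) (pder_derivable (du j)).
  by rewrite (pder_derivable (derivableM (dw j) (du j))) (deriveM (dw j) (du j)).
move: H; rewrite RintegralD// => /eqP; rewrite addr_eq0 => /eqP ->; rewrite normrN.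
apply: Rintegral_abs_le => //; first by move=> x /out[].
by move=> x; rewrite normrM ler_pM// grad_det_bound.
Qed.

(** The components are moved from time [s] to time [t] one at a time. Each change is uniformly of
    order [|t - s|] although its gradient is merely bounded, which is the situation of
    [grad_det_parts]. This weak continuity upgrades statements about almost every time to every
    time. *)
Lemma weighted_grad_det_lip (w : R -> E -> R) (Z : 'I_N -> R -> E -> R) (L B r : R) :
  st_lip L w -> (forall t x, `|w t x| <= B) -> (forall t x, r < `|x| -> w t x = 0) ->
  (forall i, st_lip L (Z i)) ->
  exists2 C, 0 <= C & forall t s,
    `|\int[lam]_x (w t x * grad_det (fun i => Z i t) x) -
      \int[lam]_x (w s x * grad_det (fun i => Z i s) x)| <= C * `|t - s|.
Proof.
move=> wL wB wr ZL.
have L0 := st_lip_ge0 wL.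
(* Twice [L], because the difference of a component at two times is among the functions used. *)
have L20 : 0 <= L * 2 by rewrite mulr_ge0.
have LL : L <= L * 2 by lra.
have mK := @measurable_rball R N (r + 1); have fK := lebesgue_rball_fin lamP (r + 1).
pose G := N`!%:R * (L * 2) ^+ N; pose V := fine (lam (rball (r + 1))).
have G0 : 0 <= G by rewrite mulr_ge0// exprn_ge0.
have V0 : 0 <= V by rewrite fine_ge0.
exists (L * G * V + N%:R * (L * G * V)) => [|t s].
  have P0 : 0 <= L * G * V by do 2 apply: mulr_ge0 => //.
  by rewrite addr_ge0// mulr_ge0.
have zL t' i : lip (L * 2) (Z i t').
  by move=> x y; rewrite (le_trans (st_lip_space _ (ZL i) _ _))// ler_wpM2r.
have w2L t' : lip (L * 2) (w t').
  by move=> x y; rewrite (le_trans (st_lip_space _ wL _ _))// ler_wpM2r.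
pose h (k : nat) (i : 'I_N) := if (i < k)%N then Z i t else Z i s.
have hL k i : lip (L * 2) (h k i) by rewrite /h; case: ifP.
have bw t' : bmeas (w t' : ME -> R) := bmeas_lip (w2L t') (wB t').
have iw t' u : (forall i, lip (L * 2) (u i)) ->
    bmeas (fun x : ME => w t' x * grad_det u x) /\ (forall x, ~ rball (r + 1) x -> w t' x * grad_det u x = 0).
  move=> uL; split; first exact: bmeasM (bw t') (bmeas_grad_det uL).
  by move=> x /negP; rewrite -ltNge => rx; rewrite wr ?mul0r//; lra.
have ii t' u : (forall i, lip (L * 2) (u i)) ->
    lam.-integrable setT (EFin \o (fun x : ME => w t' x * grad_det u x)).
  by move=> /(iw t')[b o]; exact: bmeas_integrableT mK fK b o.
have step k : (k <= N)%N ->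
    `|\int[lam]_x (w s x * grad_det (h k) x) - \int[lam]_x (w s x * grad_det (h 0%N) x)|
      <= k%:R * (L * G * V) * `|t - s|.
  elim: k => [|k IH kN]; first by rewrite subrr normr0 !mul0r.
  rewrite (le_trans (ler_distD (\int[lam]_x (w s x * grad_det (h k) x)) _ _))//.
  rewrite -natr1 !mulrDl mul1r [leRHS]addrC; apply: lerD; last exact: IH (ltnW kN).
  pose i0 := Ordinal kN; pose d x := Z i0 t x - Z i0 s x.
  have dL : lip (L * 2) d.
    move=> x y; rewrite /d.
    have -> : Z i0 t x - Z i0 s x - (Z i0 t y - Z i0 s y) =
      (Z i0 t x - Z i0 t y) - (Z i0 s x - Z i0 s y) by ring.
    rewrite (le_trans (ler_normB _ _))// mulrAC mulr_natr mulr2n.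
    by rewrite lerD// (st_lip_space _ (ZL i0)).
  have uL i : lip (L * 2) (upd (h k) i0 d i) by rewrite /upd; case: eqP.
  have dD x : `|upd (h k) i0 d i0 x| <= L * `|t - s|.
    by rewrite /upd eqxx; exact: st_lip_time (ZL i0) t s.
  have := grad_det_parts L20 uL (w2L s) (wB s) (wr s) dD; rewrite -/G -/V.
  have -> : L * `|t - s| * G * V = L * G * V * `|t - s| by ring.
  suff -> : \int[lam]_x (w s x * grad_det (h k.+1) x) - \int[lam]_x (w s x * grad_det (h k) x) =
    \int[lam]_x (w s x * grad_det (upd (h k) i0 d) x) by [].
  rewrite -RintegralB//; [|exact: ii|exact: ii].
  rewrite /Rintegral; congr fine; apply: ae_eq_integral => //.
  - by apply/measurable_EFinP; exact: (bmeasB (iw s _ (hL k.+1)).1 (iw s _ (hL k)).1).1.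
  - by apply/measurable_EFinP; exact: (iw s _ uL).1.1.
  have dt := grad_derivable_ae (zL t i0); have ds := grad_derivable_ae (zL s i0).
  apply: filterS2 dt ds => x dt ds _ /=; congr EFin.
  rewrite (@grad_det_linear (upd (h k) i0 d) (h k.+1) (h k) i0 1 (-1)).
  - by ring.
  - move=> i ii0; rewrite /upd (negbTE ii0) /h ltnS leq_eqVlt.
    by rewrite [val i == k](negbTE ii0).
  - by move=> i /negbTE ii0; rewrite /upd ii0.
  move=> j; rewrite /upd eqxx /h ltnS leqnn ltnn.
  rewrite (pder_derivable (dt j)) (pder_derivable (ds j)) mul1r mulN1r.
  by rewrite (pder_derivable (derivableB (dt j) (ds j))) (deriveB (dt j) (ds j)).
have := step N (leqnn N).
have -> : h N = fun i => Z i t by apply/funext => i; rewrite /h ltn_ord.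
have -> : h 0%N = fun i => Z i s by apply/funext => i.
move=> H; rewrite mulrDl.
rewrite (le_trans (ler_distD (\int[lam]_x (w s x * grad_det (fun i => Z i t) x)) _ _))//.
rewrite lerD// -RintegralB//; [|by apply: ii => i; exact: zL..].
have -> : L * G * V * `|t - s| = L * `|t - s| * G * V by ring.
have E1 x : w t x * grad_det (fun i => Z i t) x - w s x * grad_det (fun i => Z i t) x =
  (w t x - w s x) * grad_det (fun i => Z i t) x by rewrite mulrBl.
under eq_Rintegral do rewrite E1.
apply: Rintegral_abs_le => //.
- by apply: bmeasM (bmeasB (bw t) (bw s)) _; apply: bmeas_grad_det => i; exact: zL.
- by move=> x /negP; rewrite -ltNge => rx; rewrite !wr ?subrr ?mul0r//; lra.
- move=> x; rewrite normrM ler_pM//; first exact: (st_lip_time _ wL).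
  by apply: grad_det_bound => // i; exact: zL.
Qed.

End integration_by_parts.


(** * Conservation of the mass carried by a flow *)

Section conserved_mass.
Variables (R : realType) (N : nat).
Local Notation E := (E R N).
Local Notation ME := (ME R N).
Local Notation MR := (measurableTypeR R).
Local Notation TE := (MR * ME)%type.
Variable lam : {sigma_finite_measure set ME -> \bar R}.
Hypothesis lamP : is_lebesgue lam.
Local Notation tsmu := (product_measure1 (@lebesgue_measure R) lam).
Variables (T : R) (a : R -> E -> E).
Hypothesis T0 : 0 < T.
Variable X : R -> E -> E.
Hypothesis flowX : transport_flow lam T a X.

Lemma clamp_derive (e s t : R) : 0 < e -> t != s -> t != s + e ->
  is_derive t 1 (fun t => clamp e (t - s)) (if s < t < s + e then 1 else 0).
Proof.
move=> e0 ts tse.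
have [st|st|/eqP] := ltgtP t s; last by rewrite (negbTE ts).
  apply: (near_eq_is_derive (f := fun=> 0)).
  near=> u; have us : u < s by near: u; exact: lt_nbhsl.
  by rewrite /clamp (min_idPl _) ?(max_idPl _)//; lra.
have [te|te|/eqP] := ltgtP t (s + e); last by rewrite (negbTE tse).
  apply: (near_eq_is_derive (f := fun u => u - s)); last first.
    by rewrite -[X in is_derive _ _ _ X]subr0; apply: is_deriveB.
  near=> u; have us : s < u by near: u; exact: lt_nbhsr.
  have ue : u < s + e by near: u; exact: lt_nbhsl.
  by rewrite clamp_id//; apply/andP; split; lra.
apply: (near_eq_is_derive (f := fun=> e)).
near=> u; have us : s + e < u by near: u; exact: lt_nbhsr.
by rewrite /clamp (min_idPr _) ?(max_idPr _)//; lra.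
Unshelve. all: by end_near. Qed.

Lemma ae_time_neq (c : R) : {ae tsmu, forall p : TE, (p.1 : R) != c}.
Proof.
have mc : measurable ([set c] : set MR) by exact: measurable_set1.
exists ([set c] `*` setT); split.
- by apply: measurableX.
- rewrite [LHS](product_measure1E lebesgue_measure lam mc measurableT).
  by rewrite -[X in (X * _)%E]/(@lebesgue_measure R [set c]) lebesgue_measure_set1 mul0e.
- by move=> p /negP; rewrite negbK => /eqP pc; split.
Qed.

Lemma window_average (m : R -> R) (C s e : R) : 0 <= C -> 0 < e ->
  (forall t u, `|m t - m u| <= C * `|t - u|) ->
  `|\int[@lebesgue_measure R]_t (m t * \1_(`]s, (s + e)%R[) t) - e * m s| <= C * e * e /\
  (@lebesgue_measure R).-integrable setT (EFin \o (fun t => m t * \1_(`]s, (s + e)%R[) t)).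
Proof.
move=> C0 e0 mL; set I := [set` `]s, (s + e)%R[].
have mI : measurable (I : set MR) by exact: measurable_itv.
have leI : @lebesgue_measure R I = e%:E.
  rewrite /I lebesgue_measure_itv /= lte_fin ltrDl e0 -EFinD; congr EFin; ring.
have fI : (@lebesgue_measure R I < +oo)%E by rewrite leI ltry.
have mm : measurable_fun setT (m : MR -> R).
  by apply: continuous_measurable_fun; exact: lip_continuous mL.
have bd t : `|(m t - m s) * \1_I t| <= C * e.
  rewrite normrM indicE /I mem_setE; have [tI|tI] := boolP (t \in `]s, (s + e)%R[).
    rewrite normr1 mulr1 (le_trans (mL _ _))// ler_wpM2l//.
    by move: tI; rewrite in_itv /= => /andP[? ?]; rewrite ler_norml; apply/andP; split; lra.
  by rewrite normr0 mulr0 mulr_ge0// ltW.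
have b1 : bmeas ((fun t => (m t - m s) * \1_I t) : MR -> R).
  split; last by exists (C * e).
  apply: measurable_funM; last exact: measurable_indic.
  by apply: measurable_funB => //; exact: measurable_cst.
have o1 (t : MR) : ~ I t -> (m t - m s) * \1_I t = 0.
  by move=> It; rewrite indicE memNset// mulr0.
have o2 (t : MR) : ~ I t -> m s * \1_I t = 0.
  by move=> It; rewrite indicE memNset// mulr0.
have b2 : bmeas ((fun t => m s * \1_I t) : MR -> R).
  by apply: bmeasM; [exact: bmeas_cst|exact: bmeas_indic].
have E1 : (fun t => m t * \1_I t) = (fun t => (m t - m s) * \1_I t + m s * \1_I t).
  by apply/funext => t; ring.
have i1 : (@lebesgue_measure R).-integrable setT (EFin \o ((fun t => (m t - m s) * \1_I t) : MR -> R)).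
  exact: bmeas_integrableT mI fI b1 o1.
have i2 : (@lebesgue_measure R).-integrable setT (EFin \o ((fun t => m s * \1_I t) : MR -> R)).
  exact: bmeas_integrableT mI fI b2 o2.
split; last first.
  rewrite E1; have := integrableD measurableT i1 i2; congr (integrable _ _ _).
have -> : \int[@lebesgue_measure R]_t (m t * \1_I t) =
    \int[@lebesgue_measure R]_t ((m t - m s) * \1_I t) + \int[@lebesgue_measure R]_t (m s * \1_I t).
  by rewrite -RintegralD// E1.
have -> : \int[@lebesgue_measure R]_t (m s * \1_I t) = e * m s.
  rewrite -(Rintegral_setT_supp (lebesgue_measure : {measure set MR -> \bar R}) o2).
  rewrite (@eq_Rintegral _ _ _ _ _ (fun=> m s)); last first.
    by move=> t tI; rewrite indicE tI mulr1.
  by rewrite Rintegral_cst// [X in _ * fine X]leI mulrC.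
rewrite addrK (le_trans (Rintegral_abs_le mI fI b1 o1 bd))//.
by rewrite [X in _ * fine X]leI.
Qed.

Lemma close_averages (e K p q I J : R) : 0 < e -> `|I - e * p| <= K * e * e ->
  `|J - e * q| <= K * e * e -> I - J = 0 -> `|p - q| <= 2 * K * e.
Proof.
move=> e0; rewrite !ler_norml => /andP[h1 h2] /andP[h3 h4] h5.
have h6 : e * (p - q) <= e * (2 * K * e) by lra.
have h7 : e * (- (2 * K * e)) <= e * (p - q) by lra.
by rewrite -(ler_pM2l e0) h7 -(ler_pM2l e0).
Qed.

(** The cutoff in time is a trapezoid, whose derivative is the indicator of one short window minus
    that of another. The averages of [m] over the two windows are therefore equal, and as [m] is
    Lipschitz its values at the windows differ by as little as their length [e]. *)
Lemma flow_conserved (w : R -> E -> R) (L B r t : R) :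
  st_lip L w -> (forall t x, `|w t x| <= B) -> (forall t x, r < `|x| -> w t x = 0) ->
  transported lam T a w -> 0 <= t <= T ->
  \int[lam]_x (w t x * Jac T X t x) = \int[lam]_x w T x.
Proof.
move=> wL wB wr tw /andP[t0 tT].
have [LX [XL _]] := flow_lip T0 flowX.
pose m t := \int[lam]_x (w t x * Jac T X t x).
have [C C0 mC] : exists2 C, 0 <= C & forall t u, `|m t - m u| <= C * `|t - u|.
  have LL : L <= Num.max L LX by rewrite le_max lexx.
  have LL' : LX <= Num.max L LX by rewrite le_max lexx orbT.
  apply: (weighted_grad_det_lip lamP (L := Num.max L LX) _ wB wr).
    by move=> u s x y; rewrite (le_trans (wL _ _ _ _))// ler_wpM2r// addr_ge0.
  by move=> i u s x y; rewrite (le_trans (XL _ _ _ _ _))// ler_wpM2r// addr_ge0.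
have -> : \int[lam]_x w T x = m T.
  by apply: eq_Rintegral => x _; rewrite (Jac_end T0 flowX) mulr1.
rewrite -/(m t).
(* The windows lie strictly inside []0, T[], where the transport equation is available; the end
   times are reached afterwards by the Lipschitz bound on [m]. *)
have main e s s' : 0 < e -> 0 < s -> s + e < s' -> s' + e < T -> `|m s - m s'| <= 2 * C * e.
  move=> e0 s0 ss' s'T.
  pose phi (t : R) (x : E) := clamp e (t - s) - clamp e (t - s').
  pose chi (t : R) : R := \1_(`]s, (s + e)%R[) t - \1_(`]s', (s' + e)%R[) t.
  pose g (p : TE) := w p.1 p.2 * Jac T X p.1 p.2 * chi p.1.
  have pL : st_lip 2 phi.
    move=> u v x y; rewrite /phi.
    have -> : clamp e (u - s) - clamp e (u - s') - (clamp e (v - s) - clamp e (v - s')) =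
      (clamp e (u - s) - clamp e (v - s)) - (clamp e (u - s') - clamp e (v - s')) by ring.
    rewrite (le_trans (ler_normB _ _))//.
    have := clamp_lip e0 (u - s) (v - s); have := clamp_lip e0 (u - s') (v - s').
    rewrite !opprB !addrA !subrK => h1 h2.
    by have := normr_ge0 (x - y); lra.
  have pB u x : `|phi u x| <= e.
    have /andP[? ?] := clamp_itv e0 (u - s); have /andP[? ?] := clamp_itv e0 (u - s').
    by rewrite /phi ler_norml; apply/andP; split; lra.
  have pd : {ae tsmu, forall p : TE, (p.1 : R) != s /\ (p.1 : R) != s + e /\
      (p.1 : R) != s' /\ (p.1 : R) != s' + e}.
    have h1 : {ae tsmu, forall p : TE, (p.1 : R) != s /\ (p.1 : R) != s + e}.
      by apply: filterS2 (ae_time_neq s) (ae_time_neq (s + e)).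
    apply: filterS3 h1 (ae_time_neq s') (ae_time_neq (s' + e)) => p [? ?] ? ?; by [].
  have dphi (p : TE) : (p.1 : R) != s /\ (p.1 : R) != s + e /\
      (p.1 : R) != s' /\ (p.1 : R) != s' + e ->
      der_at phi p.1 p.2 /\ mat_der a phi p.1 p.2 = chi p.1.
    case: p => u x /= [p1 [p2 [p3 p4]]].
    have d1 := clamp_derive e0 p1 p2; have d2 := clamp_derive e0 p3 p4.
    have d3 := is_deriveB d1 d2.
    split.
      split; first by exact: (@ex_derive _ _ _ _ _ _ _ d3).
      by move=> j; exact: derivable_cst.
    rewrite /mat_der big1 => [|j _]; last by rewrite derive_cst mulr0.
    rewrite addr0 (@derive_val _ _ _ _ _ _ _ d3) /chi !indicE !mem_setE !in_itv /=.
    by do 2 case: ifP.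
  have mg : bmeas g.
    apply: bmeasM; first apply: bmeasM (bmeas_Jac T0 flowX).
      by split; [exact: measurable_st wL|exists B => p; exact: wB].
    apply: (@bmeas_comp _ _ TE MR R fst chi); first exact: measurable_fst.
    by apply: bmeasB; apply: bmeas_indic; exact: measurable_itv.
  have sup u x : u < s \/ s' + e < u \/ r < `|x| -> phi u x * w u x = 0.
    move=> H; case: H => [us|[us|rx]]; last by rewrite wr ?mulr0.
      by rewrite /phi /clamp !(min_idPl _) ?(max_idPl _) ?subrr ?mul0r//; lra.
    by rewrite /phi /clamp !(min_idPr _) ?(max_idPr _) ?subrr ?mul0r//; lra.
  have g0 (p : TE) : ~ slab s (s' + e) r p -> g p = 0.
    move=> np; have [/wr H|xr] := ltP r `|p.2 : E|; first by rewrite /g H !mul0r.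
    rewrite /g /chi !indicE !mem_setE !in_itv /=.
    case: (boolP (_ && _)) => [/andP[p1 p2]|_].
      by exfalso; apply: np; apply/slabP; split => //; apply/andP; split; lra.
    case: (boolP (_ && _)) => [/andP[p1 p2]|_]; last by rewrite subrr mulr0.
    by exfalso; apply: np; apply/slabP; split => //; apply/andP; split; lra.
  have : \int[tsmu]_p g p = 0.
    apply: (flow_integral0 lamP T0 flowX (al := s) (be := s' + e) wL wB pL pB tw _ s0 _ s'T sup mg.1).
    - by apply: filterS pd => p /dphi[].
    - by lra.
    - by apply: filterS pd => p /dphi[_ ->].
    - move=> p pT; apply: g0 => /slabP[/andP[p1 p2] _]; apply: pT.
      by apply/andP; split; lra.
  rewrite (tsmu_Rintegral lamP mg g0).
  have -> : (fun t0 => \int[lam]_x g (t0, x)) =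
      (fun u => m u * \1_(`]s, (s + e)%R[) u - m u * \1_(`]s', (s' + e)%R[) u).
    apply/funext => u; rewrite -mulrBr -/(chi u) /g /=.
    under eq_Rintegral do rewrite mulrC.
    rewrite RintegralZl// 1?mulrC//.
    apply: (@bmeas_integrableT _ _ _ _ (rball r)).
    - exact: measurable_rball.
    - exact: lebesgue_rball_fin.
    - apply: bmeasM (bmeas_Jac_space T0 flowX u).
      by split; [apply: continuous_measurable_rv; exact: lip_continuous (st_lip_space u wL)|exists B => x; exact: wB].
    - by move=> x /negP; rewrite -ltNge => /wr ->; rewrite mul0r.
  have [a1 i1] := window_average s C0 e0 mC.
  have [a2 i2] := window_average s' C0 e0 mC.
  rewrite [LHS](RintegralB _ i1 i2)//.
  by move=> I12; exact: (close_averages e0 a1 a2 I12).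
have [->//|tT'] := eqVneq t T.
have tT2 : t < T by rewrite lt_neqAle tT' tT.
apply/eqP; rewrite -subr_eq0 -normr_le0; apply/ler_addgt0Pr => eps eps0; rewrite add0r.
have C5 : 0 < 5 * C + 1 by lra.
(* The windows start at [t + e] and [T - 2 * e], and do not meet as long as [4 * e < T - t]. The
   errors [C * e], [2 * C * e] and [2 * C * e] add up to [5 * C * e]. *)
pose e := Num.min ((T - t) / 5) (eps / (5 * C + 1)).
have e0 : 0 < e by rewrite lt_min !divr_gt0//; lra.
have e1 : e <= (T - t) / 5 by rewrite ge_min lexx.
have e2 : e * (5 * C + 1) <= eps by rewrite -ler_pdivlMr// ge_min lexx orbT.
have h : `|m (t + e) - m (T - 2 * e)| <= 2 * C * e by apply: main; lra.
have h1 := mC t (t + e); have h2 := mC (T - 2 * e) T.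
have E1 : `|t - (t + e)| = e by rewrite opprD addrA subrr add0r normrN gtr0_norm.
have E2 : `|T - 2 * e - T| = 2 * e by rewrite addrAC subrr add0r normrN gtr0_norm// mulr_gt0.
rewrite E1 in h1; rewrite E2 in h2.
apply: le_trans (ler_distD (m (t + e)) _ _) _.
apply: le_trans (lerD h1 (le_trans (ler_distD (m (T - 2 * e)) _ _) (lerD h h2))) _.
apply: le_trans e2; rewrite [leLHS](_ : _ = e * (5 * C)); last by ring.
by rewrite ler_pM2l// lerDl ler01.
Qed.

End conserved_mass.

(** * Approximation by functions of the flow *)

Section smoothstep.
Variable R : realType.
Implicit Types (x y h k c : R).

Let psq x := Num.max 0 x ^+ 2.

Let psq_taylor x h : `|psq (x + h) - psq x - 2 * Num.max 0 x * h| <= 1 * h ^+ 2.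
Proof.
rewrite /psq mul1r; case: (leP 0 x) => x0; case: (leP 0 (x + h)) => xh;
  rewrite ler_norml; apply/andP; split; nra.
Qed.

(* A step from 0 to 1 that is only C^{1,1}: a quadratic Taylor remainder suffices for the chain rule. *)
Definition sstep x := 2 * psq x - 4 * psq (x - 2^-1) + 2 * psq (x - 1).

Definition sstep' x :=
  4 * Num.max 0 x - 8 * Num.max 0 (x - 2^-1) + 4 * Num.max 0 (x - 1).

(** The squared positive part has remainder constant 1, and [8 = 2 + 4 + 2] sums the absolute values
    of the coefficients. *)
Lemma sstep_taylor x h : `|sstep (x + h) - sstep x - sstep' x * h| <= 8 * h ^+ 2.
Proof.
have h1 := psq_taylor x h; have h2 := psq_taylor (x - 2^-1) h; have h3 := psq_taylor (x - 1) h.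
move: h1 h2 h3; rewrite /sstep /sstep' ![_ + h - _]addrAC.
move: (psq (x + h)) (psq x) (psq (x - 2^-1 + h)) (psq (x - 2^-1)) (psq (x - 1 + h)) (psq (x - 1)) => a b c d e f.
move: (Num.max 0 x) (Num.max 0 (x - 2^-1)) (Num.max 0 (x - 1)) => u v w.
rewrite !ler_norml => /andP[? ?] /andP[? ?] /andP[? ?]; apply/andP; split; lra.
Qed.

Lemma sstep_le0 x : x <= 0 -> sstep x = 0.
Proof.
by move=> x0; rewrite /sstep /psq !(max_idPl _) ?expr0n ?mulr0 ?subrr ?addr0//; lra.
Qed.

Lemma sstep_ge1 x : 1 <= x -> sstep x = 1.
Proof. by move=> x1; rewrite /sstep /psq !(max_idPr _); lra. Qed.

Lemma sstep_itv x : 0 <= sstep x <= 1.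
Proof.
have [x0|x0] := leP x 0; first by rewrite sstep_le0// lexx ler01.
have [x1|x1] := leP 1 x; first by rewrite sstep_ge1// lexx ler01.
have x10 : x - 1 <= 0 by lra.
rewrite /sstep /psq (max_idPr (ltW x0)) (max_idPl x10).
by case: (leP 0 (x - 2^-1)) => xh; apply/andP; split; nra.
Qed.

Let psq_lip x y : x <= 1 -> y <= 1 -> `|psq x - psq y| <= 2 * `|x - y|.
Proof.
move=> x1 y1; rewrite /psq subr_sqr normrM mulrC.
have M (u : R) : u <= 1 -> 0 <= Num.max 0 u <= 1 by case: (leP 0 u) => u0 u1; apply/andP; split; lra.
have /andP[a0 a1] := M _ x1; have /andP[b0 b1] := M _ y1.
apply: ler_pM => //.
  by rewrite ler_norml; apply/andP; split; lra.
have := ler_norm (x - y); have := ler_norm (y - x); rewrite distrC.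
case: (leP 0 x) => x0; case: (leP 0 y) => y0 h1 h2; rewrite ler_norml; apply/andP; split; lra.
Qed.

(** The squared positive part is Lipschitz, with constant 2, only for arguments up to 1; clamping
    the argument to [[0, 1]] leaves [sstep] unchanged and brings it there. Then
    [16 = 2 * (2 + 4 + 2)]. *)
Lemma sstep_lip x y : `|sstep x - sstep y| <= 16 * `|x - y|.
Proof.
have E u : sstep u = sstep (clamp 1 u).
  rewrite /clamp; case: (leP u 1) => u1; last by rewrite (max_idPr ler01) !sstep_ge1// ltW.
  by case: (leP 0 u) => // u0; rewrite !sstep_le0// ltW.
rewrite [sstep x]E [sstep y]E.
have h0 := clamp_lip (ltr01 : (0 : R) < 1) x y.
have /andP[_ u1] := clamp_itv (ltr01 : (0 : R) < 1) x.
have /andP[_ v1] := clamp_itv (ltr01 : (0 : R) < 1) y.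
move: (clamp 1 x) (clamp 1 y) h0 u1 v1 => u v h0 u1 v1.
have h1 := psq_lip u1 v1.
have h2 : `|psq (u - 2^-1) - psq (v - 2^-1)| <= 2 * `|u - v|.
  by have -> : u - v = (u - 2^-1) - (v - 2^-1); [ring|apply: psq_lip; lra].
have h3 : `|psq (u - 1) - psq (v - 1)| <= 2 * `|u - v|.
  by have -> : u - v = (u - 1) - (v - 1); [ring|apply: psq_lip; lra].
move: h1 h2 h3; rewrite /sstep.
move: (psq u) (psq v) (psq (u - 2^-1)) (psq (v - 2^-1)) (psq (u - 1)) (psq (v - 1)) => p1 p2 p3 p4 p5 p6.
move: (`|u - v|) (`|x - y|) h0 => d d' h0.
rewrite !ler_norml => /andP[? ?] /andP[? ?] /andP[? ?]; apply/andP; split; lra.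
Qed.

Definition kstep k c x := sstep (k * (x - c)).

Lemma kstep_itv k c x : 0 <= kstep k c x <= 1.
Proof. exact: sstep_itv. Qed.

Lemma kstep_taylor k c x h :
  `|kstep k c (x + h) - kstep k c x - (k * sstep' (k * (x - c))) * h| <= (8 * k ^+ 2) * h ^+ 2.
Proof.
have := sstep_taylor (k * (x - c)) (k * h); rewrite /kstep.
have -> : k * (x + h - c) = k * (x - c) + k * h by ring.
have -> : 8 * k ^+ 2 * h ^+ 2 = 8 * (k * h) ^+ 2 by ring.
by have -> : k * sstep' (k * (x - c)) * h = sstep' (k * (x - c)) * (k * h) by ring.
Qed.

Lemma kstep_lip k c x y : 0 <= k -> `|kstep k c x - kstep k c y| <= (16 * k) * `|x - y|.
Proof.
move=> k0; have := sstep_lip (k * (x - c)) (k * (y - c)); rewrite /kstep.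
have -> : k * (x - c) - k * (y - c) = k * (x - y) by ring.
by rewrite normrM ger0_norm// mulrA.
Qed.

(** The steps vanish at [c] itself, so the limit is the indicator of an open half-line. A difference
    of two such limits is exactly the half-open interval used in [box]. *)
Lemma kstep_cvg c x : (fun n : nat => kstep n.+1%:R c x) @ \oo --> (\1_[set y | c < y] x : R).
Proof.
rewrite indicE; have [xc|cx] := leP x c.
  rewrite memNset /=; last by apply/negP; rewrite -leNgt.
  apply: cvg_near_cst; apply: nearW => n; rewrite /kstep sstep_le0//.
  by rewrite mulr_ge0_le0// subr_le0.
rewrite mem_set//=; apply: cvg_near_cst.
have d0 : 0 < x - c by rewrite subr_gt0.
near=> n; rewrite /kstep sstep_ge1//.
have : n.+1%:R^-1 <= x - c by near: n; apply: filterS (near_harmonic_le d0) => n /andP[].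
by rewrite -ler_pdivrMl// mulr1.
Unshelve. all: by end_near. Qed.

End smoothstep.

Section approximation.
Variables (R : realType) (N : nat).
Local Notation E := (E R N).
Local Notation ME := (ME R N).
Local Notation MR := (measurableTypeR R).
Local Notation TE := (MR * ME)%type.
Variable lam : {sigma_finite_measure set ME -> \bar R}.
Hypothesis lamP : is_lebesgue lam.
Local Notation tsmu := (product_measure1 (@lebesgue_measure R) lam).
Variables (T : R) (a : R -> E -> E).
Hypothesis T0 : 0 < T.

Let mf_lip (f : E -> R) L : lip L f -> measurable_fun setT (f : ME -> R).
Proof. by move=> fL; apply: continuous_measurable_rv; exact: lip_continuous fL. Qed.

(** Extended values make the triangle inequality and the change of variables available without
    integrability conditions. *)
Definition L1dist (f g : E -> R) : \bar R := (\int[lam]_x (`|f x - g x|%:E))%E.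

Lemma L1dist_ge0 f g : (0 <= L1dist f g)%E.
Proof. by apply: integral_ge0 => x _; rewrite lee_fin. Qed.

Lemma L1dist_triangle (f g h : E -> R) : measurable_fun setT (f : ME -> R) ->
  measurable_fun setT (g : ME -> R) -> measurable_fun setT (h : ME -> R) ->
  (L1dist f h <= L1dist f g + L1dist g h)%E.
Proof.
move=> mf mg mh.
have m1 (u v : ME -> R) : measurable_fun setT u -> measurable_fun setT v ->
    measurable_fun setT (fun x => (`|u x - v x|)%:E).
  move=> mu mv; apply/measurable_EFinP; apply: measurableT_comp => //.
  exact: measurable_funB.
rewrite /L1dist -ge0_integralD//; [|exact: m1|exact: m1].
apply: ge0_le_integral => //; [exact: m1|by apply: emeasurable_funD; exact: m1|].
by move=> x _; rewrite -EFinD lee_fin ler_distD.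
Qed.

Lemma L1dist_eq (f g : E -> R) (r : R) : bmeas (f : ME -> R) -> bmeas (g : ME -> R) ->
  (forall x, r < `|x| -> f x = g x) ->
  L1dist f g = (\int[lam]_(x in rball r) `|f x - g x|)%:E.
Proof.
move=> bf bg fg; have b := bmeas_norm (bmeasB bf bg).
have o (x : ME) : ~ rball r x -> `|f x - g x| = 0.
  by move=> /negP; rewrite -ltNge => /fg ->; rewrite subrr normr0.
rewrite (Rintegral_setT_supp _ o) /Rintegral fineK//; apply: integral_fune_fin_num => //.
exact: bmeas_integrableT (@measurable_rball R N r) (lebesgue_rball_fin lamP r) b o.
Qed.

(** The functions whose composition with a flow can be used as a weight in [flow_conserved]. The
    flow is quantified inside, so that the class, and approximation by it, do not depend on the
    flow. *)
Definition nice (psi : E -> R) :=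
  (exists L B r : R, [/\ lip L psi, forall x, `|psi x| <= B & forall x, r < `|x| -> psi x = 0]) /\
  forall X, transport_flow lam T a X ->
    transported lam T a (fun t x => psi (X (clamp T t) x)).

Lemma nice0 : nice (fun=> 0).
Proof.
split; last by move=> X _; exact: transported_cst.
exists 0, 0, 0; split=> //; first by move=> x y; rewrite subrr normr0 mul0r.
by move=> x; rewrite normr0.
Qed.

Lemma niceD f g : nice f -> nice g -> nice (fun x => f x + g x).
Proof.
move=> [[L [B [r [fL fB fr]]]] ft] [[L' [B' [r' [gL gB gr]]]] gt]; split.
  exists (L + L'), (B + B'), (Num.max r r'); split.
  - move=> x y; rewrite opprD addrACA (le_trans (ler_normD _ _))// mulrDl lerD//.
  - by move=> x; rewrite (le_trans (ler_normD _ _))// lerD.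
  - by move=> x; rewrite gt_max => /andP[/fr -> /gr ->]; rewrite addr0.
by move=> X hX; exact: transportedD (ft X hX) (gt X hX).
Qed.

Lemma niceZ c f : nice f -> nice (fun x => c * f x).
Proof.
move=> [[L [B [r [fL fB fr]]]] ft]; split.
  exists (`|c| * L), (`|c| * B), r; split.
  - by move=> x y; rewrite -mulrBr normrM -mulrA ler_wpM2l//; exact: fL.
  - by move=> x; rewrite normrM ler_wpM2l.
  - by move=> x /fr ->; rewrite mulr0.
by move=> X hX; exact: transportedM (transported_cst lam T a c) (ft X hX).
Qed.

Lemma nice_bmeas f : nice f -> bmeas (f : ME -> R).
Proof.
by move=> [[L [B [r [fL fB _]]]] _]; split; [exact: mf_lip fL|exists B].
Qed.

Lemma lip_prod (I : Type) (s : seq I) (f : I -> E -> R) L : 0 <= L ->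
  (forall i, lip L (f i)) -> (forall i x, `|f i x| <= 1) ->
  lip ((size s)%:R * L) (fun x => \prod_(i <- s) f i x) /\
  forall x, `|\prod_(i <- s) f i x| <= 1.
Proof.
move=> L0 fL f1; elim: s => [|i s [IH1 IH2]].
  by split=> [x y|x]; rewrite !big_nil ?subrr ?normr0 ?mul0r ?normr1.
split=> [x y|x]; rewrite !big_cons.
  have -> : f i x * \prod_(j <- s) f j x - f i y * \prod_(j <- s) f j y =
    f i x * (\prod_(j <- s) f j x - \prod_(j <- s) f j y) + (f i x - f i y) * \prod_(j <- s) f j y by ring.
  rewrite (le_trans (ler_normD _ _))// !normrM /= -natr1 !mulrDl mul1r lerD//.
    by rewrite -[leRHS]mul1r ler_pM//; exact: IH1.
  by rewrite -[leRHS]mulr1 ler_pM//; exact: fL.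
by rewrite normrM mulr_ile1.
Qed.

(** A smoothed indicator of a box. The product form reduces transport by a flow to each component
    separately. *)
Definition bump (k : nat) (c d x : E) : R :=
  \prod_(i < N) (kstep k.+1%:R (c 0 i) (x 0 i) - kstep k.+1%:R (d 0 i) (x 0 i)).

Let bump_factor_le1 (k c d x : R) : `|kstep k c x - kstep k d x| <= 1.
Proof.
have /andP[? ?] := kstep_itv k c x; have /andP[? ?] := kstep_itv k d x.
by rewrite ler_norml; apply/andP; split; lra.
Qed.

Lemma bump_le1 k c d x : `|bump k c d x| <= 1.
Proof.
rewrite /bump normr_prod; apply: prodr_ile1 => i _.
by rewrite normr_ge0 bump_factor_le1.
Qed.

Lemma bump_lip k c d : lip (N%:R * (2 * (16 * k.+1%:R))) (bump k c d).
Proof.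
pose f (i : 'I_N) (x : E) : R := kstep k.+1%:R (c 0 i) (x 0 i) - kstep k.+1%:R (d 0 i) (x 0 i).
have [] := @lip_prod _ (index_enum 'I_N) f (2 * (16 * k.+1%:R)) _ _ _.
- by rewrite !mulr_ge0.
- move=> i x y; rewrite /f; have k0 : 0 <= k.+1%:R :> R by [].
  have h1 := kstep_lip (c 0 i) (x 0 i) (y 0 i) k0.
  have h2 := kstep_lip (d 0 i) (x 0 i) (y 0 i) k0.
  have h3 : `|x 0 i - y 0 i| <= `|x - y|.
    by have := rv_norm_coord (x - y) i; rewrite !mxE.
  have h4 : 16 * k.+1%:R * `|x 0 i - y 0 i| <= 16 * k.+1%:R * `|x - y|.
    by rewrite ler_wpM2l// mulr_ge0.
  have h5 := le_trans h1 h4; have h6 := le_trans h2 h4; move: h5 h6.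
  have -> : 2 * (16 * k.+1%:R) * `|x - y| = 2 * (16 * k.+1%:R * `|x - y|) by ring.
  move: (kstep _ _ _) (kstep _ _ _) (kstep _ _ _) (kstep _ _ _) (16 * _ * _) => p1 p2 p3 p4 m.
  by rewrite !ler_norml => /andP[? ?] /andP[? ?]; apply/andP; split; lra.
- by move=> i x; exact: bump_factor_le1.
by rewrite /lip -[X in X%:R]/(size (index_enum 'I_N)) [in size _]/index_enum -enumT size_enum_ord.
Qed.

(** The margin [1] covers the width [k.+1%:R^-1] on which a step rises, uniformly in [k]. *)
Lemma bump_outside k (c d x : E) : Num.max `|c| `|d| + 1 < `|x| -> bump k c d x = 0.
Proof.
move=> xr; have [i xi] : exists i, Num.max `|c| `|d| + 1 < `|x 0 i|.
  apply: contrapT => H; move: xr; rewrite ltNge => /negP; apply.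
  apply: rv_norm_le; first by rewrite addr_ge0// le_max normr_ge0.
  by move=> i; rewrite leNgt; apply/negP => xi; apply: H; exists i.
rewrite /bump (bigD1 i)//= [X in X * _](_ : _ = 0) ?mul0r//.
have ci : `|c 0 i| <= Num.max `|c| `|d| by rewrite (le_trans (rv_norm_coord c i))// le_max lexx.
have di : `|d 0 i| <= Num.max `|c| `|d| by rewrite (le_trans (rv_norm_coord d i))// le_max lexx orbT.
move: (Num.max _ _) xi ci di => r xi; rewrite !ler_norml => /andP[c1 c2] /andP[d1 d2].
have k1 : 1 <= k.+1%:R :> R by rewrite ler1n.
have [x0|x0] := leP 0 (x 0 i).
  have {}xi : r + 1 < x 0 i by move: xi; rewrite ger0_norm.
  by rewrite /kstep !sstep_ge1 ?subrr//; apply: mulr_ege1 => //; lra.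
have {}xi : r + 1 < - x 0 i by move: xi; rewrite ltr0_norm.
by rewrite /kstep !sstep_le0 ?subrr//; apply: mulr_ge0_le0 => //; lra.
Qed.

Lemma bump_cvg (c d x : E) : (forall i, c 0 i <= d 0 i) ->
  (fun k => bump k c d x) @ \oo --> (\1_(box c d) (x : ME) : R).
Proof.
move=> cd.
have -> : \1_(box c d) (x : ME) = \prod_(i < N) (\1_[set y | c 0 i < y] (x 0 i) - \1_[set y | d 0 i < y] (x 0 i)) :> R.
  have E i : (\1_[set y | c 0 i < y] (x 0 i) - \1_[set y | d 0 i < y] (x 0 i) : R) =
      (nat_of_bool (c 0 i < x 0 i <= d 0 i)%R)%:R.
    have M (u v : R) : (u \in [set y | v < y]) = (v < u).
      by apply/idP/idP => [/set_mem//|?]; exact: mem_set.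
    rewrite !indicE !M; have := cd i.
    by case: (ltP (c 0 i) (x 0 i)) => h1; case: (ltP (d 0 i) (x 0 i)) => h2 h3 /=; rewrite ?subrr ?subr0//; exfalso; lra.
  rewrite indicE; have [/set_mem xb|xb] := boolP ((x : ME) \in box c d).
    by rewrite big1// => i _; rewrite E (xb i).
  have /existsNP[i /negP/negbTE xi] : ~ forall i, c 0 i < x 0 i <= d 0 i.
    by move=> h; move/negP: xb; apply; exact/mem_set.
  by rewrite (bigD1 i)//= E xi mul0r.
rewrite /bump; elim: (index_enum _) => [|i s IH].
  by under eq_fun do rewrite big_nil; rewrite big_nil; exact: cvg_cst.
under eq_fun do rewrite big_cons; rewrite big_cons.
by apply: cvgM => //; apply: cvgB; exact: kstep_cvg.
Qed.

Lemma nice_bump k c d : nice (bump k c d).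
Proof.
split.
  exists (N%:R * (2 * (16 * k.+1%:R))), 1, (Num.max `|c| `|d| + 1).
  by split; [exact: bump_lip|exact: bump_le1|exact: bump_outside].
move=> X hX; apply: transported_prod => i.
have tX := comp_flow_transported hX i.
have st e : transported lam T a (fun t x => kstep k.+1%:R e (X (clamp T t) x 0 i)).
  exact: transported_comp (kstep_taylor k.+1%:R e) tX.
have := transportedD (st (c 0 i)) (transportedM (transported_cst lam T a (-1)) (st (d 0 i))).
congr transported; apply/funext => t; apply/funext => x.
by rewrite mulN1r.
Qed.

Definition apx (f : E -> R) := forall e : R, 0 < e ->
  exists2 psi, nice psi & (L1dist f psi <= e%:E)%E.

Lemma apx_limit f : measurable_fun setT (f : ME -> R) ->
  (forall e : R, 0 < e -> exists g, [/\ measurable_fun setT (g : ME -> R), apx g & (L1dist f g <= e%:E)%E]) ->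
  apx f.
Proof.
move=> mf H e e0; have e20 : 0 < e / 2 by rewrite divr_gt0.
have [g [mg ag fg]] := H _ e20; have [psi npsi gpsi] := ag _ e20.
exists psi => //; apply: le_trans (L1dist_triangle mf mg (nice_bmeas npsi).1) _.
by rewrite [e in leRHS]splitr EFinD leeD.
Qed.

Lemma apxD f g : measurable_fun setT (f : ME -> R) -> measurable_fun setT (g : ME -> R) ->
  apx f -> apx g -> apx (fun x => f x + g x).
Proof.
move=> mf mg af ag e e0; have e20 : 0 < e / 2 by rewrite divr_gt0.
have [u nu fu] := af _ e20; have [v nv gv] := ag _ e20.
exists (fun x => u x + v x); first exact: niceD.
have E1 : L1dist (fun x => f x + g x) (fun x => u x + g x) = L1dist f u.
  by apply: eq_integral => x _; rewrite opprD addrACA subrr addr0.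
have E2 : L1dist (fun x => u x + g x) (fun x => u x + v x) = L1dist g v.
  by apply: eq_integral => x _; rewrite opprD addrACA subrr add0r.
apply: le_trans (L1dist_triangle (g := fun x => u x + g x) _ _ _) _.
- exact: measurable_funD.
- by apply: measurable_funD => //; exact: (nice_bmeas nu).1.
- by apply: measurable_funD; [exact: (nice_bmeas nu).1|exact: (nice_bmeas nv).1].
by rewrite E1 E2 [e in leRHS]splitr EFinD leeD.
Qed.

Lemma apxZ c f : measurable_fun setT (f : ME -> R) -> apx f -> apx (fun x => c * f x).
Proof.
move=> mf af e e0; have c0 : 0 < `|c| + 1 by rewrite ltr_wpDl.
have [u nu fu] := af _ (divr_gt0 e0 c0).
exists (fun x => c * u x); first exact: niceZ.
have -> : L1dist (fun x => c * f x) (fun x => c * u x) = (`|c|%:E * L1dist f u)%E.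
  rewrite /L1dist -ge0_integralZl//=.
  - by apply: eq_integral => x _; rewrite -mulrBr normrM.
  - apply/measurable_EFinP; apply: measurableT_comp => //.
    by apply: measurable_funB => //; exact: (nice_bmeas nu).1.
apply: le_trans (lee_wpmul2l _ fu) _; first by rewrite lee_fin.
rewrite -EFinM lee_fin mulrCA ler_piMr ?(ltW e0)// ler_pdivrMr// mul1r.
by rewrite lerDl.
Qed.

Lemma apx_cvg (f : nat -> E -> R) (F : E -> R) (r B : R) :
  (forall k, measurable_fun setT (f k : ME -> R)) -> measurable_fun setT (F : ME -> R) ->
  (forall k x, `|f k x| <= B) -> (forall x, (f ^~ x) @ \oo --> F x) ->
  (forall k x, r < `|x| -> f k x = 0) ->
  (forall k, apx (f k)) -> apx F.
Proof.
move=> mf mF fB fF fr af; apply: apx_limit => // e e0.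
have FB x : `|F x| <= B.
  by apply: (ler_cvg_to (cvg_norm (fF x)) (cvg_cst B)); apply: nearW => k; exact: fB.
have Fr x : r < `|x| -> F x = 0.
  move=> rx; apply/esym; apply: (cvg_unique (@Rhausdorff R) _ (fF x)).
  by apply: cvg_near_cst; apply: nearW => k; rewrite fr.
have H : (fun k => \int[lam]_(x in rball r) `|f k x - F x|) @ \oo --> 0.
  apply: (@bmeas_dominated _ ME R lam (rball r) f F B) => //.
  - exact: measurable_rball.
  - exact: lebesgue_rball_fin.
  - by apply: aeW => x _; exact: fF.
have [k _ /(_ k (leqnn k)) Hk] := @cvgr0_norm_le _ _ _ _ _ _ H e e0.
exists (f k); split => //.
rewrite (@L1dist_eq _ _ r).
- rewrite lee_fin; apply: le_trans (ler_norm _) _; move: Hk.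
  by under eq_Rintegral do rewrite distrC.
- by split => //; exists B.
- by split => //; exists B.
- by move=> x rx; rewrite Fr// fr.
Qed.

Lemma apx_box c d : apx (\1_(box c d) : ME -> R).
Proof.
have [cd|/box_set0 ->] := pselect (forall i, c 0 i <= d 0 i); last first.
  move=> e e0; exists (fun=> 0); first exact: nice0.
  rewrite /L1dist; under eq_integral do rewrite indicE in_set0 subrr normr0.
  by rewrite integral0 lee_fin ltW.
apply: (@apx_cvg (fun k => bump k c d) _ (Num.max `|c| `|d| + 1) 1).
- by move=> k; apply: mf_lip; exact: bump_lip.
- by apply: measurable_indic; exact: measurable_box.
- by move=> k x; exact: bump_le1.
- by move=> x; exact: bump_cvg.
- by move=> k x; exact: bump_outside.
- move=> k e e0; exists (bump k c d); first exact: nice_bump.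
  rewrite /L1dist; under eq_integral do rewrite subrr normr0.
  by rewrite integral0 lee_fin ltW.
Qed.

(** Dynkin's argument inside a fixed box: the complement of a set becomes a difference of two
    approximable functions, and increasing unions converge with a common bounded support. *)
Lemma apx_indic (A : set ME) c d : measurable A -> apx (\1_(A `&` box c d) : ME -> R).
Proof.
have mQ := @measurable_box R N c d; have mind (B : set ME) : measurable B ->
    measurable_fun setT (\1_(B `&` box c d) : ME -> R).
  by move=> mB; apply: measurable_indic; exact: measurableI.
rewrite measurable_rvE; move: A; apply: (dynkin_induction (measurable_rvE R N)).
- exact: boxesI.
- by rewrite setTI; exact: apx_box.
- move=> _ [p [q ->]]; have [u [v ->]] := boxesI (ex_intro _ p (ex_intro _ q erefl)) (ex_intro _ c (ex_intro _ d erefl)).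
  exact: apx_box.
- move=> S mS aS; have := apxD _ _ (apx_box c d) (apxZ (-1) (mind S mS) aS).
  have -> : (fun x : ME => \1_(box c d) x + -1 * \1_(S `&` box c d) x) = (\1_(~` S `&` box c d) : ME -> R).
    apply/funext => x; rewrite !indicE !in_setI in_setC.
    by case: (x \in S); case: (x \in box c d); rewrite /= ?mulr1 ?mulr0 ?subrr ?addr0.
  apply; first exact: measurable_indic.
  by apply: measurable_funM; [exact: measurable_cst|exact: mind].
move=> F mF tF aF.
pose U n := \big[setU/set0]_(k < n) F k.
have mU n : measurable (U n) by apply: bigsetU_measurable => i _.
apply: (@apx_cvg (fun n => \1_(U n `&` box c d)) _ (Num.max `|c| `|d|) 1).
- by move=> n; exact: mind.
- by apply: mind; exact: bigcupT_measurable.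
- by move=> n x; rewrite indicE; case: (_ \in _); rewrite ?normr1 ?normr0.
- move=> x; apply: cvg_near_cst; have [[k _ Fk]|nF] := pselect ((\bigcup_k F k) x).
    near=> n; rewrite !indicE !in_setI; congr (_ && _)%:R.
    have xU : U n x.
      by rewrite /U -bigcup_mkord; exists k => //=; near: n; exists k.+1.
    have xF : (\bigcup_k F k) x by exists k.
    by rewrite (mem_set xU) (mem_set xF).
  apply: nearW => n; rewrite !indicE !in_setI; congr (_ && _)%:R.
  have xU : ~ U n x by rewrite /U -bigcup_mkord => -[k _ Fk]; apply: nF; exists k.
  by rewrite (memNset xU) (memNset nF).
- move=> n x rx; rewrite indicE memNset// => -[_ xb].
  move: rx; apply/negP; rewrite -leNgt; apply: rv_norm_le => [|i].
    by rewrite le_max normr_ge0.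
  have /andP[x1 x2] := xb i.
  have ci := rv_norm_coord c i; have di := rv_norm_coord d i.
  move: ci di; rewrite le_max !ler_norml => /andP[? ?] /andP[? ?].
  have [|] := leP 0 (x 0 i) => x0; apply/orP; [right|left]; apply/andP; split; lra.
- elim=> [|n IH].
    rewrite /U big_ord0 set0I => e e0; exists (fun=> 0); first exact: nice0.
    rewrite /L1dist; under eq_integral do rewrite indicE in_set0 subrr normr0.
    by rewrite integral0 lee_fin ltW.
  have := apxD (mind _ (mU n)) (mind _ (mF n)) IH (aF n).
  congr apx; apply/funext => x; rewrite !indicE !in_setI /U big_ord_recr /= in_setU.
  case: (boolP (x \in F n)) => [/set_mem xn|_]; last by rewrite orbF addr0.
  rewrite orbT memNset ?add0r// -bigcup_mkord => -[k /= kn Fk].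
  have kE : k = n by apply: (tF k n I I); exists x.
  by move: kn; rewrite kE ltnn.
Unshelve. all: by end_near. Qed.

Import HBSimple.

(** The simple functions that approximate [f] may have a large support. Multiplying them by the
    indicator of a cube outside of which [f] vanishes does not increase the distance, and reduces
    them to combinations of indicators covered by [apx_indic]. *)
Lemma apx_integrable (f : E -> R) (r : R) : measurable_fun setT (f : ME -> R) ->
  lam.-integrable setT (EFin \o (f : ME -> R)) -> (forall x, r < `|x| -> f x = 0) -> apx f.
Proof.
move=> mf fi fr; have [g [_ _ gc]] := approximation_sfun_integrable measurableT fi.
have [n rn] : exists n : nat, r < n%:R by exists (Num.Def.truncn r).+1; exact: truncnS_gt.
pose Q := @cube R N n; have mQ : measurable Q by exact: measurable_box.
have fQ x : f x = f x * \1_Q (x : ME).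
  rewrite indicE; have [_|/negP xQ] := boolP ((x : ME) \in Q); first by rewrite mulr1.
  rewrite mulr0; apply: fr; rewrite ltNge; apply/negP => xr; apply: xQ; apply/mem_set => i.
  have := le_lt_trans (le_trans (rv_norm_coord x i) xr) rn.
  by rewrite !mxE ltr_norml => /andP[-> /ltW].
have mg (m : nat) : measurable_fun setT (g m) by exact: measurable_funPT.
have mgQ (m : nat) : measurable_fun setT ((fun x => g m x * \1_Q x) : ME -> R).
  by apply: measurable_funM; [exact: mg|exact: measurable_indic].
apply: apx_limit => // e e0.
have /fine_cvgP[gfin] := gc; move=> /(@cvgr0_norm_le _ _ _ _ _ _)/(_ e e0) gle.
near \oo => m.
exists (fun x => g m x * \1_Q (x : ME)); split => //.
  have [s gs] : exists s : seq R, forall x, g m x = \sum_(y <- s) y * \1_(g m @^-1` [set y]) x.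
    by eexists => x; rewrite {1}(fimfunE (g m) x) fsbig_finite//=; reflexivity.
  have Es : (fun x => g m x * \1_Q (x : ME)) =
      (fun x : ME => \sum_(y <- s) y * \1_(g m @^-1` [set y] `&` Q) x).
    apply/funext => x; rewrite gs big_distrl /=.
    by apply: eq_bigr => y _; rewrite -mulrA indicI.
  rewrite Es; elim: s {gs Es} => [|y l IH].
    move=> d d0; exists (fun=> 0); first exact: nice0.
    rewrite /L1dist; under eq_integral do rewrite big_nil subrr normr0.
    by rewrite integral0 lee_fin ltW.
  under eq_fun do rewrite big_cons.
  have mS (z : R) : measurable (g m @^-1` [set z] : set ME).
    by rewrite -[X in measurable X]setTI; apply: mg.
  have mI (z : R) : measurable_fun setT (\1_(g m @^-1` [set z] `&` Q) : ME -> R).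
    by apply: measurable_indic; exact: measurableI.
  apply: apxD => //.
  - by apply: measurable_funM; [exact: measurable_cst|exact: mI].
  - apply: measurable_sum => z; apply: measurable_funM; [exact: measurable_cst|exact: mI].
  - by apply: apxZ; [exact: mI|exact: apx_indic].
have h1 : (\int[lam]_z `|(f z)%:E - (g m z)%:E|)%E \is a fin_num by near: m.
have h2 : `|fine (\int[lam]_z `|(f z)%:E - (g m z)%:E|)%E| <= e by near: m.
apply: (@le_trans _ _ (\int[lam]_z `|(f z)%:E - (g m z)%:E|)%E).
  apply: ge0_le_integral => //.
  - by apply/measurable_EFinP; apply: measurableT_comp => //; exact: measurable_funB.
  - by apply: measurableT_comp => //; apply/measurable_EFinP; exact: measurable_funB.
  - move=> x _; rewrite -EFinB abse_EFin lee_fin [in leLHS]fQ -mulrBl normrM.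
    by rewrite ler_piMr// indicE; case: (_ \in _); rewrite ?normr1 ?normr0.
by rewrite -(fineK h1) lee_fin; apply: le_trans (ler_norm _) h2.
Unshelve. all: by end_near. Qed.

End approximation.


(** * Image of a measure with a density *)

Section weighted_pushforward.
Context d d' (S : measurableType d) (S' : measurableType d') (R : realType).
Variables (mu : {measure set S -> \bar R}) (phi : S -> S') (w : S -> R).
Hypotheses (mphi : measurable_fun setT phi) (mw : measurable_fun setT w).
Hypothesis w0 : forall x, 0 <= w x.

Let m (A : set S') : \bar R := (\int[mu]_(x in phi @^-1` A) (w x)%:E)%E.

Let mpre A : measurable A -> measurable (phi @^-1` A).
Proof. by move=> mA; rewrite -[X in measurable X]setTI; exact: mphi. Qed.

Let m0 : m set0 = 0%E.
Proof. by rewrite /m preimage_set0 integral_set0. Qed.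

Let m_ge0 A : (0 <= m A)%E.
Proof. by apply: integral_ge0 => x _; rewrite lee_fin. Qed.

Let m_sigma_additive : semi_sigma_additive m.
Proof.
move=> F mF tF mU; rewrite /m preimage_bigcup ge0_integral_bigcup//.
- apply: is_cvg_ereal_nneg_natsum => n _; exact: m_ge0.
- by move=> k; exact: mpre.
- by apply: measurable_funTS; exact/measurable_EFinP.
- by move=> x _; rewrite lee_fin.
- by move=> i j _ _ [x [? ?]]; apply: (tF i j I I); exists (phi x).
Qed.

Import HBNNSimple.

(** The weight is nonnegative at every point so that the set function is a measure; the Jacobian is
    truncated to [JacP] for this purpose. The formula then goes from indicators to simple functions
    and to monotone limits. *)
Lemma weighted_pushforward_ex : exists m' : {measure set S' -> \bar R},
  forall g : S' -> \bar R, measurable_fun setT g -> (forall x, (0 <= g x)%E) ->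
    (\int[m']_y g y = \int[mu]_x (g (phi x) * (w x)%:E))%E.
Proof.
pose mix := isMeasure.Build _ S' R m m0 m_ge0 m_sigma_additive.
pose m' : {measure set S' -> \bar R} := HB.pack m mix.
exists m' => g mg g0.
have ind A : measurable A -> (\int[m']_y (\1_A y)%:E = \int[mu]_x ((\1_A (phi x))%:E * (w x)%:E))%E.
  move=> mA; rewrite integral_indic// setIT -[LHS]/(m A) /m integral_mkcond.
  apply: eq_integral => x _; rewrite /patch indicE -EFinM.
  have [xA|xA] := pselect (A (phi x)).
    by rewrite (mem_set (xA : (phi @^-1` A) x)) (mem_set xA) mul1r.
  by rewrite (memNset (xA : ~ (phi @^-1` A) x)) (memNset xA) mul0r.
pose f := nnsfun_approx measurableT mg.
have fnd y : {homo (fun n => (f n y)%:E) : k n / (k <= n)%N >-> (k <= n)%E}.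
  by move=> k n kn; rewrite lee_fin; exact/lefP/nd_nnsfun_approx.
have mf n : measurable_fun setT (f n) by exact: measurable_funPT.
have mfphi n : measurable_fun setT (fun x => f n (phi x) * w x).
  by apply: measurable_funM => //; exact: measurableT_comp.
transitivity (limn (fun n => \int[m']_y (f n y)%:E))%E.
  rewrite -monotone_convergence//.
  - apply: eq_integral => y _; apply/esym/cvg_lim => //.
    exact: cvg_nnsfun_approx.
  - by move=> n; exact/measurable_EFinP.
  - by move=> n y _; rewrite lee_fin.
transitivity (limn (fun n => \int[mu]_x (f n (phi x) * w x)%:E))%E; last first.
  rewrite -monotone_convergence//.
  - apply: eq_integral => x _; apply/cvg_lim => //.
    under eq_fun do rewrite EFinM.
    apply: cvgeZr => //; exact: cvg_nnsfun_approx.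
  - by move=> n; exact/measurable_EFinP.
  - by move=> n y _; rewrite lee_fin mulr_ge0.
  - by move=> x _ k n kn; rewrite lee_fin ler_wpM2r// -lee_fin; exact: fnd.
congr (limn _); apply/funext => n.
have [s fs] : exists s : seq R, forall y, f n y = \sum_(c <- s) c * \1_(f n @^-1` [set c]) y.
  by eexists => y; rewrite {1}(fimfunE (f n) y) fsbig_finite//=; reflexivity.
have [s' [s'0 fs']] : exists s : seq R, all (fun c => 0 <= c) s /\ forall y, f n y = \sum_(c <- s) c * \1_(f n @^-1` [set c]) y.
  exists [seq c <- s | 0 <= c]; split; first exact: filter_all.
  move=> y; rewrite fs big_filter [in RHS]big_mkcond /=; apply: eq_bigr => c _.
  case: ifPn => // /negP c0; rewrite indicE memNset ?mulr0// => /= fy.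
  by apply: c0; rewrite -fy.
have mS c : measurable (f n @^-1` [set c]).
  by rewrite -[X in measurable X]setTI; apply: mf.
have mI c : measurable_fun setT (\1_(f n @^-1` [set c]) : S' -> R) by exact: measurable_indic.
have mIphi c : measurable_fun setT (fun x => \1_(f n @^-1` [set c]) (phi x) : R) by exact: measurableT_comp.
have i0 c y : (0 : R) <= \1_(f n @^-1` [set c]) y by rewrite indicE.
under eq_integral do rewrite fs'; under [RHS]eq_integral do rewrite fs'.
elim: s' s'0 {fs'} => [_|c l IH] => [|/andP[c0 l0]].
  by under eq_integral do rewrite big_nil; under [RHS]eq_integral do rewrite big_nil mul0r; rewrite !integral0.
under eq_integral do rewrite big_cons /= EFinD.
under [RHS]eq_integral do rewrite big_cons /= mulrDl EFinD.
have sum0 y : 0 <= \sum_(j <- l) j * \1_(f n @^-1` [set j]) y.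
  by rewrite big_seq sumr_ge0// => j /(allP l0) j0; rewrite mulr_ge0.
have msum : measurable_fun setT (fun y => \sum_(j <- l) j * \1_(f n @^-1` [set j]) y : R).
  by apply: measurable_sum => j; apply: measurable_funM.
rewrite ge0_integralD//; [|by move=> y _; rewrite lee_fin mulr_ge0
  |by apply/measurable_EFinP; exact: measurable_funM
  |by move=> y _; rewrite lee_fin
  |exact/measurable_EFinP].
rewrite [RHS]ge0_integralD//; [|by move=> y _; rewrite lee_fin !mulr_ge0
  |by apply/measurable_EFinP; do 2 apply: measurable_funM => //
  |by move=> y _; rewrite lee_fin mulr_ge0
  |by apply/measurable_EFinP; apply: measurable_funM => //; exact: (measurableT_comp msum)].
rewrite IH//; congr (_ + _)%E.
under eq_integral do rewrite EFinM; under [RHS]eq_integral do rewrite -mulrA EFinM.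
rewrite ge0_integralZl//; last exact/measurable_EFinP.
rewrite [RHS]ge0_integralZl//; [by rewrite ind
 |by apply/measurable_EFinP; apply: measurable_funM|by move=> y _; rewrite lee_fin mulr_ge0].
Qed.

End weighted_pushforward.

(** * Change of variables and uniqueness *)

Lemma Rintegral_ae_eq d (S : measurableType d) (R : realType) (mu : {measure set S -> \bar R})
    (f g : S -> R) : measurable_fun setT f -> measurable_fun setT g ->
  {ae mu, forall x, f x = g x} -> \int[mu]_x f x = \int[mu]_x g x.
Proof.
move=> mf mg fg; rewrite /Rintegral; congr fine; apply: ae_eq_integral => //.
- exact/measurable_EFinP.
- exact/measurable_EFinP.
- by apply: filterS fg => x -> _.
Qed.

Lemma Rintegral_ge0_eq0 d (S : measurableType d) (R : realType) (mu : {measure set S -> \bar R})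
    (K : set S) (f : S -> R) : measurable K -> (mu K < +oo)%E -> bmeas f ->
  (forall x, ~ K x -> f x = 0) -> (forall x, 0 <= f x) -> \int[mu]_x f x <= 0 ->
  {ae mu, forall x, f x = 0}.
Proof.
move=> mK Kfin bf f0 fge fle.
have mf : measurable_fun setT (EFin \o f) by apply/measurable_EFinP; exact: bf.1.
have fi := bmeas_integrableT mK Kfin bf f0.
suff : ae_eq mu setT (EFin \o f) (cst 0%E).
  by apply: filterS => x /= /(_ I) [].
apply/(ae_eq_integral_abs mu measurableT mf).
under eq_integral => x _ do rewrite /= ger0_norm//.
rewrite -[LHS]fineK; last exact: integral_fune_fin_num.
congr EFin; apply/eqP; rewrite eq_le; apply/andP; split; first exact: fle.
by apply: Rintegral_ge0 => x _.
Qed.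

Lemma Rintegral_cvg_supp d (S : measurableType d) (R : realType) (mu : {measure set S -> \bar R})
    (K : set S) (f : nat -> S -> R) (F : S -> R) (B : R) :
  measurable K -> (mu K < +oo)%E -> (forall k, measurable_fun setT (f k)) -> measurable_fun setT F ->
  (forall k x, `|f k x| <= B) -> (forall x, `|F x| <= B) ->
  (forall k x, ~ K x -> f k x = 0) -> (forall x, ~ K x -> F x = 0) ->
  (forall x, (f ^~ x) @ \oo --> F x) ->
  (fun k => \int[mu]_x f k x) @ \oo --> \int[mu]_x F x.
Proof.
move=> mK Kfin mf mF fB FB f0 F0 fF; rewrite -(Rintegral_setT_supp _ F0).
under eq_fun => k do rewrite -(Rintegral_setT_supp _ (f0 k)).
apply: bcvgL1_Rintegral => //; split => //; first by exists B.
by apply: (bmeas_dominated mK Kfin mf mF fB); apply: aeW => x _; exact: fF.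
Qed.

Section flow_change_of_variables.
Variables (R : realType) (N : nat).
Local Notation E := (E R N).
Local Notation ME := (ME R N).
Local Notation MR := (measurableTypeR R).
Local Notation TE := (MR * ME)%type.
Variable lam : {sigma_finite_measure set ME -> \bar R}.
Hypothesis lamP : is_lebesgue lam.
Local Notation tsmu := (product_measure1 (@lebesgue_measure R) lam).
Variables (T : R) (a : R -> E -> E).
Hypothesis T0 : 0 < T.
Variable X : R -> E -> E.
Hypothesis flowX : transport_flow lam T a X.

(** Finite speed of propagation: the flow is the identity at time [T] and Lipschitz in time.
    Composition with it therefore enlarges supports by a fixed radius, at all times. *)
Lemma flow_displacement : exists2 D : R, 0 <= D & forall t x, `|X (clamp T t) x - x| <= D.
Proof.
have [L [XL X2]] := flow_lip T0 flowX; have [_ [_ [XT _]]] := flowX.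
have TT : 0 <= T <= T by rewrite lexx (ltW T0).
have L0 : 0 <= L.
  have := X2 T 0 0 0 TT; rewrite lexx (ltW T0) !subr0 normr0 addr0 => /(_ isT)/(le_trans (normr_ge0 _)).
  by rewrite gtr0_norm// pmulr_lge0.
exists (L * T) => [|t x]; first by rewrite mulr_ge0// ltW.
have tT := clamp_itv T0 t; have := X2 (clamp T t) T x x tT TT.
rewrite XT subrr normr0 addr0 => /le_trans; apply; rewrite ler_wpM2l//.
by case/andP: tT => ? ?; rewrite ler0_norm; lra.
Qed.

Lemma measurable_flow t : measurable_fun setT (fun x : ME => X (clamp T t) x : ME).
Proof.
have [L [XL _]] := flow_lip T0 flowX; apply: measurable_rv => i.
by apply: continuous_measurable_rv; exact: lip_continuous (st_lip_space t (XL i)).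
Qed.

Lemma nice_flow_lip psi : nice lam T a psi -> exists L B r : R,
  [/\ st_lip L (fun t x => psi (X (clamp T t) x)), forall t x, `|psi (X (clamp T t) x)| <= B &
      forall t x, r < `|x| -> psi (X (clamp T t) x) = 0].
Proof.
move=> [[L [B [r [pL pB pr]]]] _]; have [LX [_ X2]] := flow_lip T0 flowX.
have [D D0 XD] := flow_displacement.
exists (`|L| * `|LX|), B, (r + D); split => //.
- move=> t s x y; apply: le_trans (pL _ _) _; rewrite -mulrA.
  apply: le_trans (ler_wpM2r (normr_ge0 _) (ler_norm L)) _; apply: ler_wpM2l => //.
  apply: le_trans (X2 _ _ _ _ (clamp_itv T0 t) (clamp_itv T0 s)) _.
  apply: le_trans (ler_wpM2r _ (ler_norm LX)) _; first by rewrite addr_ge0.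
  by apply: ler_wpM2l => //; rewrite lerD2r clamp_lip.
- move=> t x rx; apply: pr; have := ler_normB (X (clamp T t) x) (X (clamp T t) x - x).
  by rewrite subKr; have := XD t x; lra.
Qed.

Lemma Jac_ge0_st_ae : {ae tsmu, forall p : TE, 0 < (p.1 : R) < T -> 0 <= Jac T X p.1 p.2}.
Proof.
have AX : {ae tsmu, forall p : TE, forall i, 0 < (p.1 : R) < T ->
    der_at (comp_flow T X i) p.1 p.2 /\ mat_der a (comp_flow T X i) p.1 p.2 = 0}.
  apply: filter_forall => i; exact: comp_flow_transported.
have [_ [_ [_ /st_aeP J0]]] := flowX.
apply: filterS2 AX J0 => -[t x] /= hX hJ tT; have := hJ tT.
have tT' : 0 <= t <= T by case/andP: tT => ? ?; rewrite !ltW.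
congr (0 <= _); rewrite /jac /Jac /grad_det; congr (\det _); apply/matrixP => i j; rewrite !mxE.
have [[_ dx] _] := hX i tT; rewrite (pder_derivable (dx j)).
by rewrite /comp_flow clamp_id.
Qed.

(** The sign is known only for almost every time. It passes to averages over []t, t + e[], and the
    Lipschitz bound in time turns these into [- (C * e) <= m t]. The window lies to the right of
    [t], so [t = 0] is included; at [T] the Jacobian is 1. *)
Lemma test_Jac_ge0 (z : E -> R) (L B r t : R) : lip L z -> (forall x, `|z x| <= B) ->
  (forall x, r < `|x| -> z x = 0) -> (forall x, 0 <= z x) -> 0 <= t <= T ->
  0 <= \int[lam]_x (z x * Jac T X t x).
Proof.
move=> zL zB zr z0 /andP[t0 tT].
have [LX [XL _]] := flow_lip T0 flowX.
have L0 : 0 <= `|L| by [].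
have [C C0 mC] : exists2 C, 0 <= C & forall t u,
    `|\int[lam]_x (z x * Jac T X t x) - \int[lam]_x (z x * Jac T X u x)| <= C * `|t - u|.
  apply: (weighted_grad_det_lip lamP (w := fun=> z) (L := Num.max `|L| LX) _ (fun _ x => zB x) (fun _ x => zr x)).
    move=> u s x y; apply: le_trans (zL x y) _; apply: le_trans (ler_wpM2r _ (ler_norm L)) _ => //.
    by apply: ler_pM => //; [rewrite le_max lexx|rewrite lerDr].
  by move=> i u s x y; rewrite (le_trans (XL _ _ _ _ _))// ler_wpM2r ?addr_ge0// le_max lexx orbT.
move: tT; rewrite le_eqVlt => /predU1P[->|tT].
  by apply: Rintegral_ge0 => x _; rewrite (Jac_end T0 flowX) mulr1.
pose m u := \int[lam]_x (z x * Jac T X u x).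
have {}mC : forall u s, `|m u - m s| <= C * `|u - s| := mC.
rewrite -/(m t).
have main e : 0 < e -> t + e <= T -> - (C * e) <= m t.
  move=> e0 te; have [wa _] := window_average t C0 e0 mC.
  pose g (p : TE) := z p.2 * Jac T X p.1 p.2 * \1_(`]t, (t + e)%R[) (p.1 : R).
  have bz : bmeas (z : ME -> R) := bmeas_lip zL zB.
  have bg : bmeas g.
    apply: bmeasM; first apply: bmeasM (bmeas_Jac T0 flowX).
      by apply: (@bmeas_comp _ _ TE ME R snd z) bz; exact: measurable_snd.
    apply: (@bmeas_comp _ _ TE MR R fst (\1_(`]t, (t + e)%R[) : MR -> R)); first exact: measurable_fst.
    by apply: bmeas_indic; exact: measurable_itv.
  have g0 (p : TE) : ~ slab t (t + e) r p -> g p = 0.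
    move=> np; have [/zr H|xr] := ltP r `|p.2 : E|; first by rewrite /g H !mul0r.
    rewrite /g indicE mem_setE in_itv /=; case: (boolP (_ && _)) => [/andP[p1 p2]|_]; last by rewrite mulr0.
    by exfalso; apply: np; apply/slabP; split => //; rewrite !ltW.
  have gE : \int[tsmu]_p g p = \int[@lebesgue_measure R]_u (m u * \1_(`]t, (t + e)%R[) u).
    rewrite (tsmu_Rintegral lamP bg g0); apply: eq_Rintegral => u _; rewrite /g /=.
    under eq_Rintegral do rewrite mulrC.
    rewrite RintegralZl// 1?mulrC//.
    apply: (@bmeas_integrableT _ _ _ _ (rball r)).
    - exact: measurable_rball.
    - exact: lebesgue_rball_fin.
    - exact: bmeasM bz (bmeas_Jac_space T0 flowX u).
    - by move=> x /negP; rewrite -ltNge => /zr ->; rewrite mul0r.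
  have : 0 <= \int[tsmu]_p g p.
    rewrite (Rintegral_ae_eq (g := fun p => `|g p|) bg.1 (bmeas_norm bg).1).
      by apply: Rintegral_ge0 => p _.
    apply: filterS Jac_ge0_st_ae => p J0; rewrite /g indicE mem_setE in_itv /=.
    case: (boolP (_ && _)) => [/andP[p1 p2]|_]; last by rewrite !mulr0 normr0.
    rewrite mulr1 ger0_norm// mulr_ge0// J0//; apply/andP; split; first exact: le_lt_trans t0 p1.
    exact: lt_le_trans p2 te.
  move=> I0; have := le_trans (ler_norm _) wa; rewrite -gE => H.
  rewrite -(ler_pM2l e0) mulrN; move: H I0; rewrite lerBlDr.
  move: wa; rewrite -gE ler_norml => /andP[w1 w2] _ I0.
  have := le_trans (lerD I0 (lexx (- (e * m t)))) w2; rewrite add0r => w3.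
  by rewrite lerNl; apply: le_trans w3 _; rewrite mulrC mulrA mulrAC.
rewrite leNgt; apply/negP => m0.
have C1 : 0 < C + 1 by rewrite ltr_wpDl.
pose e := Num.min (T - t) (- m t / (2 * (C + 1))).
have e0 : 0 < e by rewrite lt_min subr_gt0 tT divr_gt0// ?mulr_gt0// oppr_gt0.
have e1 : e <= T - t by rewrite ge_min lexx.
have e2 : e * (2 * (C + 1)) <= - m t by rewrite -ler_pdivlMr ?mulr_gt0// ge_min lexx orbT.
have e3 : t + e <= T by rewrite -lerBrDl.
have e4 := main e e0 e3; have e5 : 0 <= C * e by rewrite mulr_ge0// ltW.
move: (m t) m0 e2 e4 => M m0 e2 e4; lra.
Qed.

(** Lipschitz test functions are brought, in mean, to the indicator of the part [A n] of a ball
    where the Jacobian is negative. The integral of the Jacobian over it is then both nonnegative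
    and nonpositive. *)
Lemma Jac_ge0_ae t : 0 <= t <= T -> {ae lam, forall x : ME, 0 <= Jac T X t x}.
Proof.
move=> tT; have [mJ [C JC]] := bmeas_Jac_space T0 flowX t.
have C0 : 0 <= C := le_trans (normr_ge0 _) (JC 0).
pose A n : set ME := [set x : ME | Jac T X t x < 0] `&` rball n%:R.
have mA n : measurable (A n).
  apply: measurableI; last exact: measurable_rball.
  rewrite (_ : [set x | _] = (Jac T X t : ME -> R) @^-1` `]-oo, 0[).
    by rewrite -[X in measurable X]setTI; apply: mJ => //; exact: measurable_itv.
  by apply/seteqP; split => x /=; rewrite in_itv.
have An n (x : ME) : ~ rball n%:R x -> \1_(A n) x = 0 :> R.
  by move=> xn; rewrite indicE memNset// => -[].
have H n : {ae lam, forall x : ME, - (\1_(A n) x * Jac T X t x) = 0}.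
  have bf : bmeas (fun x : ME => - (\1_(A n) x * Jac T X t x)).
    by apply: bmeasN; apply: bmeasM; [exact: bmeas_indic|exact: (bmeas_Jac_space T0 flowX t)].
  have f0 (x : ME) : ~ rball n%:R x -> - (\1_(A n) x * Jac T X t x) = 0.
    by move=> /An ->; rewrite mul0r oppr0.
  have fge (x : ME) : 0 <= - (\1_(A n) x * Jac T X t x).
    rewrite oppr_ge0 indicE; have [/set_mem[xJ _]|_] := boolP (x \in A n); last by rewrite mul0r.
    by rewrite mul1r ltW.
  apply: (Rintegral_ge0_eq0 (measurable_rball n%:R) (lebesgue_rball_fin lamP n%:R) bf f0 fge).
  have bI : bmeas (\1_(A n) : ME -> R) by exact: bmeas_indic.
  have ax : apx lam T a (\1_(A n) : ME -> R).
    apply: (apx_integrable lamP T a (r := n%:R) bI.1).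
      exact: (bmeas_integrableT (@measurable_rball R N n%:R) (lebesgue_rball_fin lamP n%:R) bI (An n)).
    by move=> x rx; apply: An => /=; apply/negP; rewrite -ltNge.
  apply/ler_addgt0Pr => e e0; rewrite add0r.
  have C1 : 0 < C + 1 by rewrite ltr_wpDl.
  have [psi npsi dpsi] := ax _ (divr_gt0 e0 C1).
  have [[L [B [r [pL pB pr]]]] _] := npsi.
  (* The positive part supplies the sign that the test requires, stays Lipschitz, and is no farther
     from an indicator than [psi] is. *)
  pose z x := Num.max 0 (psi x).
  have zL : lip L z.
    move=> x y; apply: le_trans (pL x y); rewrite /z.
    have := ler_norm (psi x - psi y); have := ler_norm (psi y - psi x); rewrite distrC.
    by case: (leP 0 (psi x)) => h1; case: (leP 0 (psi y)) => h2 h3 h4; rewrite ler_norml; apply/andP; split; lra.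
  have zB x : `|z x| <= B.
    by apply: le_trans (pB x); rewrite /z; case: (leP 0 (psi x)) => h; rewrite ?normr0.
  have zr x : r < `|x| -> z x = 0 by move=> /pr; rewrite /z => ->; rewrite maxxx.
  have z0 x : 0 <= z x by rewrite /z le_max lexx.
  have J0 := test_Jac_ge0 zL zB zr z0 tT.
  pose rr := Num.max r n%:R; have mK := @measurable_rball R N rr.
  have fK := lebesgue_rball_fin lamP rr.
  have bz : bmeas (z : ME -> R) := bmeas_lip zL zB.
  have bp : bmeas (psi : ME -> R) := nice_bmeas npsi.
  have oI x : rr < `|x| -> \1_(A n) (x : ME) = 0 :> R.
    by rewrite gt_max => /andP[_ xn]; apply: An; apply/negP; rewrite -ltNge.
  have op x : rr < `|x| -> psi x = 0 by rewrite gt_max => /andP[/pr ? _].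
  have oz x : rr < `|x| -> z x = 0 by rewrite gt_max => /andP[/zr ? _].
  have d1 : \int[lam]_(x in rball rr) `|\1_(A n) x - psi x| <= e / (C + 1).
    by move: dpsi; rewrite (L1dist_eq lamP (r := rr) bI bp) ?lee_fin// => x rx; rewrite oI// op.
  have bd : bmeas (fun x : ME => z x - \1_(A n) x) by exact: bmeasB.
  have iz : lam.-integrable setT (EFin \o (fun x : ME => z x * Jac T X t x)).
    apply: bmeas_integrableT mK fK (bmeasM bz (bmeas_Jac_space T0 flowX t)) _.
    by move=> x /negP; rewrite -ltNge => /oz ->; rewrite mul0r.
  have iI : lam.-integrable setT (EFin \o (fun x : ME => \1_(A n) x * Jac T X t x)).
    apply: bmeas_integrableT mK fK (bmeasM bI (bmeas_Jac_space T0 flowX t)) _.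
    by move=> x /negP; rewrite -ltNge => /oI ->; rewrite mul0r.
  have -> : \int[lam]_x (- (\1_(A n) x * Jac T X t x)) =
      \int[lam]_x ((z x - \1_(A n) x) * Jac T X t x) - \int[lam]_x (z x * Jac T X t x).
    under [in RHS]eq_Rintegral do rewrite mulrBl.
    rewrite RintegralB// addrAC subrr add0r.
    under eq_Rintegral do rewrite -mulN1r.
    by rewrite RintegralZl// mulN1r.
  rewrite lerBlDr; apply: (@le_trans _ _ e); last by rewrite lerDl.
  have oJ (x : ME) : ~ rball rr x -> (z x - \1_(A n) x) * Jac T X t x = 0.
    by move=> /negP; rewrite -ltNge => rx; rewrite oz// oI// subrr mul0r.
  rewrite -(Rintegral_setT_supp _ oJ).
  have b1 := bmeasM bd (bmeas_Jac_space T0 flowX t).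
  apply: (@le_trans _ _ (\int[lam]_(x in rball rr) (C * `|\1_(A n) x - psi x|))).
    apply: le_Rintegral => //; [exact: bmeas_integrable|apply: bmeas_integrable => //|].
      by apply: bmeasM; [exact: bmeas_cst|apply: bmeas_norm; exact: bmeasB].
    move=> x _; apply: le_trans (ler_norm _) _; rewrite normrM mulrC.
    apply: ler_pM => //.
    rewrite /z indicE; have [_|_] := boolP (x \in A n); rewrite ?mulr1n ?mulr0n.
      case: (leP 0 (psi x)) => h; first by rewrite distrC.
      by rewrite sub0r normrN normr1 ger0_norm; lra.
    rewrite sub0r subr0 normrN.
    by case: (leP 0 (psi x)) => h; rewrite ?normr0.
  rewrite RintegralZl//; last first.
    by apply: bmeas_integrable => //; apply: bmeas_norm; exact: bmeasB.
  apply: le_trans (ler_wpM2l C0 d1) _; rewrite mulrCA ler_piMr ?(ltW e0)//.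
  by rewrite ler_pdivrMr// mul1r lerDl.
have H2 : {ae lam, forall x : ME, forall n, - (\1_(A n) x * Jac T X t x) = 0}.
  exact: ae_foralln.
apply: filterS H2 => x Hx; rewrite leNgt; apply/negP => xJ.
have [n xn] : exists n : nat, `|x : E| < n%:R.
  by exists (Num.Def.truncn (`|x : E|)).+1; exact: truncnS_gt.
have /eqP := Hx n; rewrite oppr_eq0 indicE mem_set ?mul1r ?(lt_eqF xJ)//.
by split => //=; exact: ltW.
Qed.


Definition JacP (t : R) (x : E) := Num.max 0 (Jac T X t x).

Lemma JacP_ge0 t x : 0 <= JacP t x.
Proof. by rewrite /JacP le_max lexx. Qed.

Lemma JacP_ae t : 0 <= t <= T -> {ae lam, forall x : ME, Jac T X t x = JacP t x}.
Proof. by move=> /Jac_ge0_ae; apply: filterS => x J0; rewrite /JacP (max_idPr J0). Qed.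

Lemma bmeas_JacP t : bmeas (JacP t : ME -> R).
Proof.
have [mJ [C JC]] := bmeas_Jac_space T0 flowX t; split.
  apply: (measurable_maxr _ mJ); exact: measurable_cst.
exists C => x; apply: le_trans (JC x).
by rewrite /JacP; case: (leP 0 (Jac T X t x)) => h; rewrite ?normr0.
Qed.

Lemma flow_nice psi t : nice lam T a psi -> 0 <= t <= T ->
  \int[lam]_x (psi (X (clamp T t) x) * Jac T X t x) = \int[lam]_x psi x.
Proof.
move=> npsi tT; have [L [B [r [wL wB wr]]]] := nice_flow_lip npsi.
have [_ [_ [XT _]]] := flowX.
rewrite (flow_conserved lamP T0 flowX wL wB wr (npsi.2 X flowX) tT).
by apply: eq_Rintegral => x _; rewrite clamp_id ?XT// lexx ltW.
Qed.

(** Two measures are compared on boxes, a generating class stable under intersection. The indicator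
    of a box is a bounded limit of bumps, for which the equality is conservation of mass. *)
Lemma flow_change (g : E -> \bar R) t : measurable_fun setT (g : ME -> \bar R) ->
  (forall x, (0 <= g x)%E) -> 0 <= t <= T ->
  (\int[lam]_x (g (X (clamp T t) x) * (JacP t x)%:E) = \int[lam]_x g x)%E.
Proof.
move=> mg g0 tT; have mX := measurable_flow t.
have [m' m'E] := @weighted_pushforward_ex _ _ ME ME R lam _ _ mX (bmeas_JacP t).1 (JacP_ge0 t).
rewrite -(m'E g mg g0); apply: eq_measure_integral => A mA _.
have [D D0 XD] := flow_displacement.
have boxE (c d : E) : m' (box c d) = lam (box c d).
  have mB := @measurable_box R N c d.
  have bB : bmeas (\1_(box c d) : ME -> R) by exact: bmeas_indic.
  have -> : m' (box c d) = (\int[lam]_x ((\1_(box c d) (X (clamp T t) x : ME))%:E * (JacP t x)%:E))%E.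
    have mI : measurable_fun setT (fun y : ME => (\1_(box c d) y : R)%:E).
      by apply/measurable_EFinP; exact: bB.1.
    have I0 (y : ME) : (0 <= (\1_(box c d) y : R)%:E)%E by rewrite lee_fin indicE.
    by rewrite -[RHS](m'E _ mI I0) integral_indic// setIT.
  have [cd|/box_set0 ->] := pselect (forall i, c 0 i <= d 0 i); last first.
    by under eq_integral do rewrite indicE in_set0 mul0e; rewrite integral0 measure0.
  (* Beyond radius [r] all bumps vanish; beyond [r + D] they still vanish after composition with the
     flow. A single ball [K] thus dominates both sequences of integrals. *)
  pose r := Num.max `|c| `|d| + 1; pose K := @rball R N (r + D).
  have mK : measurable K by exact: measurable_rball.
  have fK := lebesgue_rball_fin lamP (r + D).
  have far x : ~ K x -> r < `|X (clamp T t) x|.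
    move=> /negP; rewrite -ltNge => Kx.
    by have := ler_normB (X (clamp T t) x) (X (clamp T t) x - x); rewrite subKr; have := XD t x; lra.
  have far' (x : ME) : ~ K x -> r < `|x : E| by move=> /negP; rewrite -ltNge => ?; lra.
  have box0 (x : ME) : r < `|x : E| -> \1_(box c d) x = 0 :> R.
    move=> rx; have b0 : (fun k => bump k c d x) @ \oo --> (0 : R).
      by apply: cvg_near_cst; apply: nearW => k; exact: bump_outside.
    rewrite -[LHS](cvg_lim (@Rhausdorff R) (bump_cvg (x := x) cd)).
    exact: (cvg_lim (@Rhausdorff R) b0).
  have i1 x : `|\1_(box c d) (x : ME)| <= 1 :> R.
    by rewrite indicE; case: (_ \in _); rewrite ?normr1 ?normr0.
  have [mJ [C JC]] := bmeas_Jac_space T0 flowX t.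
  have C0 : 0 <= C := le_trans (normr_ge0 _) (JC 0).
  have mb k : measurable_fun setT (bump k c d : ME -> R).
    by apply: continuous_measurable_rv; exact: lip_continuous (bump_lip k c d).
  have cv1 : (fun k => \int[lam]_x bump k c d x) @ \oo --> (\int[lam]_x \1_(box c d) x : R).
    apply: (@Rintegral_cvg_supp _ ME R lam K _ _ 1 mK fK mb bB.1).
    - by move=> k x; exact: bump_le1.
    - exact: i1.
    - by move=> k x /far'; exact: bump_outside.
    - by move=> x /far'; exact: box0.
    - by move=> x; exact: bump_cvg.
  have cv2 : (fun k => \int[lam]_x (bump k c d (X (clamp T t) x) * Jac T X t x)) @ \oo -->
      (\int[lam]_x (\1_(box c d) (X (clamp T t) x : ME) * Jac T X t x) : R).
    apply: (@Rintegral_cvg_supp _ ME R lam K _ _ C mK fK).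
    - by move=> k; apply: measurable_funM => //; exact: measurableT_comp (mb k) mX.
    - by apply: measurable_funM => //; exact: measurableT_comp bB.1 mX.
    - by move=> k x; rewrite normrM -[C]mul1r ler_pM// bump_le1.
    - by move=> x; rewrite normrM -[C]mul1r ler_pM//; exact: i1.
    - by move=> k x /far rx; rewrite bump_outside ?mul0r.
    - by move=> x /far rx; rewrite box0 ?mul0r.
    - by move=> x; apply: cvgM; [exact: bump_cvg|exact: cvg_cst].
  have e12 : (fun k => \int[lam]_x (bump k c d (X (clamp T t) x) * Jac T X t x)) =
      (fun k => \int[lam]_x bump k c d x).
    by apply/funext => k; apply: flow_nice => //; exact: nice_bump.
  rewrite e12 in cv2; have H := etrans (esym (cvg_lim (@Rhausdorff R) cv2)) (cvg_lim (@Rhausdorff R) cv1).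
  have bXB : bmeas (fun x : ME => \1_(box c d) (X (clamp T t) x : ME) : R) := bmeas_comp mX bB.
  have bXJ := bmeasM bXB (bmeas_JacP t).
  rewrite (@Rintegral_ae_eq _ _ _ _ _ (fun x : ME => \1_(box c d) (X (clamp T t) x : ME) * JacP t x)
    (bmeasM bXB (bmeas_Jac_space T0 flowX t)).1 bXJ.1) in H; last first.
    by apply: filterS (JacP_ae tT) => x ->.
  have iX : lam.-integrable setT (EFin \o (fun x : ME => \1_(box c d) (X (clamp T t) x : ME) * JacP t x)).
    by apply: bmeas_integrableT mK fK bXJ _ => x /far rx; rewrite box0 ?mul0r.
  under eq_integral do rewrite -EFinM.
  rewrite -[LHS]fineK; last exact: integral_fune_fin_num.
  rewrite -[X in X%:E]/(\int[lam]_x (\1_(box c d) (X (clamp T t) x : ME) * JacP t x)) H.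
  rewrite /Rintegral fineK; first by rewrite integral_indic// setIT.
  by rewrite integral_indic// setIT ge0_fin_numE// lebesgue_box_fin.
apply: rv_measure_unique => //; move=> c d; rewrite boxE; exact: lebesgue_box_fin.
Qed.

(** The change of variables for the indicator of [Z]. It makes the product of a function of [X] and
    the Jacobian independent of the representative of that function. *)
Lemma flow_null (Z : set ME) t : measurable Z -> lam Z = 0%E -> 0 <= t <= T ->
  {ae lam, forall x : ME, Z (X (clamp T t) x) -> Jac T X t x = 0}.
Proof.
move=> mZ Z0 tT; have mX := measurable_flow t.
have mI : measurable_fun setT (fun x : ME => \1_Z (X (clamp T t) x : ME) * JacP t x : R).
  apply: measurable_funM; last exact: (bmeas_JacP t).1.
  by apply: (measurableT_comp _ mX); exact: measurable_indic.
have := @flow_change (fun x => (\1_Z (x : ME))%:E) t _ _ tT.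
have LZ : (\int[lam]_x (\1_Z (x : ME) : R)%:E = 0)%E by rewrite integral_indic// setIT.
rewrite LZ => H.
have {}H : (\int[lam]_x ((\1_Z (X (clamp T t) x : ME))%:E * (JacP t x)%:E) = 0)%E.
  by apply: H => [|x]; [apply/measurable_EFinP; exact: measurable_indic|rewrite lee_fin indicE].
have : ae_eq lam setT (EFin \o (fun x : ME => \1_Z (X (clamp T t) x : ME) * JacP t x)) (cst 0%E).
  apply/(ae_eq_integral_abs lam measurableT); first exact/measurable_EFinP.
  rewrite -[RHS]H; apply: eq_integral => x _.
  by rewrite /= ger0_norm// mulr_ge0 ?JacP_ge0// indicE.
apply: filterS2 (JacP_ae tT) => x -> /(_ I) [] /= /eqP.
by rewrite mulf_eq0 => /orP[|/eqP//] /[swap] Zx; rewrite indicE mem_set// oner_eq0.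
Qed.

(** Composition with the flow followed by multiplication by the Jacobian preserves distances in
    mean, so one approximation of the final datum serves at all times with the same error. *)
Lemma flow_L1dist (f g : E -> R) t : measurable_fun setT (f : ME -> R) ->
  measurable_fun setT (g : ME -> R) -> 0 <= t <= T ->
  (\int[lam]_x (`|f (X (clamp T t) x) - g (X (clamp T t) x)| * JacP t x)%:E = L1dist lam f g)%E.
Proof.
move=> mf mg tT; rewrite /L1dist -(flow_change (g := fun x => (`|f x - g x|)%:E) _ _ tT).
- by apply: eq_integral => x _; rewrite EFinM.
- by apply/measurable_EFinP; apply: measurableT_comp => //; exact: measurable_funB.
- by move=> x; rewrite lee_fin.
Qed.

End flow_change_of_variables.

(** * Comparison of two flows *)

Section flow_uniqueness.
Variables (R : realType) (N : nat).
Local Notation E := (E R N).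
Local Notation ME := (ME R N).
Local Notation MR := (measurableTypeR R).
Local Notation TE := (MR * ME)%type.
Variable lam : {sigma_finite_measure set ME -> \bar R}.
Hypothesis lamP : is_lebesgue lam.
Local Notation tsmu := (product_measure1 (@lebesgue_measure R) lam).
Variables (T : R) (a : R -> E -> E).
Hypothesis T0 : 0 < T.
Implicit Types X Y : R -> E -> E.

Lemma st_lipM L L' B B' (f g : R -> E -> R) : st_lip L f -> st_lip L' g ->
  (forall t x, `|f t x| <= B) -> (forall t x, `|g t x| <= B') ->
  st_lip (B * L' + L * B') (fun t x => f t x * g t x).
Proof.
move=> fL gL fB gB t s x y.
have -> : f t x * g t x - f s y * g s y = f t x * (g t x - g s y) + (f t x - f s y) * g s y by ring.
rewrite (le_trans (ler_normD _ _))// !normrM mulrDl lerD//.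
  by rewrite -mulrA ler_pM.
by rewrite mulrAC ler_pM.
Qed.

(** The corners are asymmetric because a step of index 0 rises over length 1 to the right of its
    base point: it must start at [- (r + 1)] to be complete at [- r], while the one based at [r] is
    still zero there. *)
Lemma bump_eq1 (r : R) (y : E) : 0 <= r -> `|y| <= r -> bump 0 (const_mx (- (r + 1))) (const_mx r) y = 1.
Proof.
move=> r0 yr; rewrite /bump big1// => i _; rewrite !mxE.
have := le_trans (rv_norm_coord y i) yr; rewrite ler_norml => /andP[y1 y2].
by rewrite /kstep sstep_ge1 ?sstep_le0 ?subr0//; lra.
Qed.

Lemma flow_coincide X Y t i : transport_flow lam T a X -> transport_flow lam T a Y -> 0 <= t <= T ->
  {ae lam, forall x : ME, Jac T X t x != 0 -> X (clamp T t) x 0 i = Y (clamp T t) x 0 i}.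
Proof.
move=> flowX flowY tT.
have [LX [XL _]] := flow_lip T0 flowX; have [LY [YL _]] := flow_lip T0 flowY.
have [D D0 XD] := flow_displacement T0 flowX; have [D' D'0 YD] := flow_displacement T0 flowY.
pose d s x := comp_flow T X i s x - comp_flow T Y i s x.
have dL : st_lip (LX + LY) d.
  move=> u s x y; rewrite /d.
  have -> : comp_flow T X i u x - comp_flow T Y i u x - (comp_flow T X i s y - comp_flow T Y i s y) =
    (comp_flow T X i u x - comp_flow T X i s y) - (comp_flow T Y i u x - comp_flow T Y i s y) by ring.
  apply: le_trans (ler_normB _ _) _; rewrite mulrDl.
  by apply: lerD; [exact: XL|exact: YL].
have dB u x : `|d u x| <= D + D'.
  have -> : d u x = (X (clamp T u) x - x) 0 i - (Y (clamp T u) x - x) 0 i.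
    by rewrite /d /comp_flow !mxE; ring.
  by rewrite (le_trans (ler_normB _ _))// lerD// (le_trans (rv_norm_coord _ _)).
have dT x : d T x = 0.
  by rewrite /d (comp_flow_end T0 flowX)// (comp_flow_end T0 flowY)// subrr.
have td : transported lam T a d.
  have := transportedD (comp_flow_transported flowX i)
    (transportedM (transported_cst lam T a (-1)) (comp_flow_transported flowY i)).
  by congr transported; apply/funext => u; apply/funext => x; rewrite mulN1r.
(* The difference [d] of two components is bounded but need not have compact support, hence the
   cutoff [psi(X)]. It equals 1 where [X] lies in the ball of radius [n], and [n] is arbitrary. *)
have H n : {ae lam, forall x : ME,
    (bump 0 (const_mx (- (n%:R + 1))) (const_mx n%:R) (X (clamp T t) x) * d t x) ^+ 2 * JacP T X t x = 0}.
  pose psi : E -> R := bump 0 (const_mx (- (n%:R + 1))) (const_mx n%:R).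
  have npsi : nice lam T a psi by exact: nice_bump.
  have [L [B [r [pL pB pr]]]] := nice_flow_lip T0 flowX npsi.
  have uL := st_lipM pL dL pB dB.
  pose u s x := psi (X (clamp T s) x) * d s x.
  have uB s x : `|u s x| <= B * (D + D') by rewrite normrM ler_pM.
  have wL := st_lipM uL uL uB uB.
  have wB s x : `|u s x * u s x| <= (B * (D + D')) * (B * (D + D')) by rewrite normrM ler_pM.
  have wr s x : r < `|x| -> u s x * u s x = 0 by move=> /pr ux; rewrite /u ux !mul0r.
  have tu := transportedM (npsi.2 X flowX) td.
  have tw := transportedM tu tu.
  have C0 := flow_conserved lamP T0 flowX wL wB wr tw tT.
  have bw : bmeas (fun x : ME => u t x * u t x).
    split; last by exists (B * (D + D') * (B * (D + D'))) => x; exact: wB.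
    by apply: continuous_measurable_rv; exact: lip_continuous (st_lip_space t wL).
  have bf := bmeasM bw (bmeas_JacP T0 flowX t).
  have f0 (x : ME) : ~ rball r x -> u t x * u t x * JacP T X t x = 0.
    by move=> /negP; rewrite -ltNge => /(wr t) ->; rewrite mul0r.
  have fge (x : ME) : 0 <= u t x * u t x * JacP T X t x.
    by rewrite mulr_ge0 ?JacP_ge0// -expr2 sqr_ge0.
  have := Rintegral_ge0_eq0 (measurable_rball r) (lebesgue_rball_fin lamP r) bf f0 fge.
  have -> : \int[lam]_x (u t x * u t x * JacP T X t x) = 0.
    rewrite -(Rintegral_ae_eq (f := fun x : ME => u t x * u t x * Jac T X t x)).
    - rewrite C0 /Rintegral; under eq_integral do rewrite dT !mulr0.
      by rewrite integral0.
    - exact: (bmeasM bw (bmeas_Jac_space T0 flowX t)).1.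
    - exact: bf.1.
    - by apply: filterS (JacP_ae lamP T0 flowX tT) => x ->.
  by move=> /(_ (lexx _)); apply: filterS => x; rewrite expr2.
have H2 := ae_foralln H.
apply: filterS2 H2 (JacP_ae lamP T0 flowX tT) => x Hx JE; rewrite JE => J0.
have [n xn] : exists n : nat, `|X (clamp T t) x| <= n%:R.
  by exists (Num.Def.truncn (`|X (clamp T t) x|)).+1; apply: ltW; exact: truncnS_gt.
have /eqP := Hx n; rewrite bump_eq1// mul1r mulf_eq0 (negbTE J0) orbF expf_eq0 /= subr_eq0.
by move/eqP.
Qed.

Lemma Jac_coincide X Y t : transport_flow lam T a X -> transport_flow lam T a Y ->
  {ae lam, forall x : ME, X (clamp T t) x = Y (clamp T t) x -> Jac T X t x = Jac T Y t x}.
Proof.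
move=> flowX flowY.
have [LX [XL _]] := flow_lip T0 flowX; have [LY [YL _]] := flow_lip T0 flowY.
pose d i x := comp_flow T X i t x - comp_flow T Y i t x.
have dL i : lip (LX + LY) (d i).
  move=> x y; rewrite /d.
  have -> : comp_flow T X i t x - comp_flow T Y i t x - (comp_flow T X i t y - comp_flow T Y i t y) =
    (comp_flow T X i t x - comp_flow T X i t y) - (comp_flow T Y i t x - comp_flow T Y i t y) by ring.
  apply: le_trans (ler_normB _ _) _; rewrite mulrDl; apply: lerD.
    exact: (st_lip_space t (XL i)).
  exact: (st_lip_space t (YL i)).
have H1 : {ae lam, forall x : ME, forall ij : 'I_N * 'I_N, d ij.1 x = 0 -> pder (d ij.1) (evec R ij.2) x = 0}.
  by apply: filter_forall => -[i j]; exact: (pder_zeros_ae lamP (evec R j) (dL i)).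
have H2 : {ae lam, forall x : ME, forall i j, derivable (comp_flow T X i t) (x : E) (evec R j)}.
  by apply: filter_forall => i; exact: (grad_derivable_ae lamP (st_lip_space t (XL i))).
have H3 : {ae lam, forall x : ME, forall i j, derivable (comp_flow T Y i t) (x : E) (evec R j)}.
  by apply: filter_forall => i; exact: (grad_derivable_ae lamP (st_lip_space t (YL i))).
apply: filterS3 H1 H2 H3 => x h1 h2 h3 XY; rewrite /Jac /grad_det; congr (\det _).
apply/matrixP => i j; rewrite !mxE.
have := h1 (i, j); rewrite /= /d {1}/comp_flow XY subrr => /(_ erefl).
rewrite (pder_derivable (derivableB (h2 i j) (h3 i j))) (deriveB (h2 i j) (h3 i j)).
by move=> /eqP; rewrite subr_eq0 => /eqP XYj; rewrite (pder_derivable (h2 i j)) (pder_derivable (h3 i j)).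
Qed.

(* Two flows can only differ where both Jacobians vanish. *)
Lemma flow_independence X Y (p : E -> R) t : transport_flow lam T a X -> transport_flow lam T a Y ->
  0 <= t <= T ->
  {ae lam, forall x : ME, p (X (clamp T t) x) * Jac T X t x = p (Y (clamp T t) x) * Jac T Y t x}.
Proof.
move=> flowX flowY tT.
have H U V : transport_flow lam T a U -> transport_flow lam T a V ->
    {ae lam, forall x : ME, Jac T U t x != 0 -> U (clamp T t) x = V (clamp T t) x}.
  move=> hU hV.
  have : {ae lam, forall x : ME, forall i, Jac T U t x != 0 -> U (clamp T t) x 0 i = V (clamp T t) x 0 i}.
    by apply: filter_forall => i; exact: flow_coincide.
  by apply: filterS => x hx J0; apply/rowP => i; exact: hx.
apply: filterS3 (H X Y flowX flowY) (H Y X flowY flowX) (Jac_coincide t flowX flowY) => x h1 h2 h3.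
have [J0|J0] := eqVneq (Jac T X t x) 0; last by rewrite (h1 J0) h3// h1.
have [J1|J1] := eqVneq (Jac T Y t x) 0; first by rewrite J0 J1 !mulr0.
by have := h3 (esym (h2 J1)); rewrite J0 => /esym/eqP; rewrite (negbTE J1).
Qed.

End flow_uniqueness.

(** * Existence *)

Lemma line_is_derive (R : realType) (V : normedModType R) (f : V -> R) (p v : V) (h : R) :
  derivable f (p + h *: v) v ->
  is_derive h 1 (fun h : R => f (p + h *: v)) ('D_v f (p + h *: v)).
Proof.
move=> df.
have qD : (fun k : R => k^-1 *: (f (k *: v + (p + h *: v)) - f (p + h *: v))) @ 0^' -->
  'D_v f (p + h *: v) := df.
have E (k : R) : k *: v + (p + h *: v) = p + (k *: 1 + h) *: v.
  by rewrite [k *: 1]mulr1 scalerDl addrCA.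
have H : (fun k : R => k^-1 *: (f (p + (k *: 1 + h) *: v) - f (p + h *: v))) @ 0^' -->
    'D_v f (p + h *: v).
  by under eq_fun do rewrite -E.
by split; [apply/cvg_ex; eexists; exact: H|exact: (cvg_lim (@Rhausdorff R) H)].
Qed.

Lemma is_derive_lip (R : realType) (g dg : R -> R) (B : R) : (forall h : R, is_derive h (1 : R) g (dg h)) ->
  (forall h, `|dg h| <= B) -> forall s t, `|g t - g s| <= B * `|t - s|.
Proof.
move=> gd gB s t; wlog st : s t / s <= t => [H|].
  have [|/ltW ts] := leP s t; first exact: H.
  by rewrite distrC [`|t - s|]distrC; exact: H.
have gc : {within `[s, t], continuous g}.
  apply: continuous_subspaceT => x; apply: differentiable_continuous; apply/derivable1_diffP.
  exact: (@ex_derive _ _ _ _ _ _ _ (gd x)).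
have [c _ ->] := @MVT_segment R g dg s t st (fun x _ => gd x) gc.
by rewrite normrM ler_wpM2r.
Qed.

(** * Bounds on test functions *)

Section test_functions.
Variables (R : realType) (N : nat).
Local Notation E := (E R N).
Implicit Types (phi : (R * E)%type -> R).

Lemma derivable_time phi t (x : E) : derivable phi (t, x) (1, 0) ->
  derivable (fun s : R => phi (s, x)) t 1 /\
  'D_1 (fun s : R => phi (s, x)) t = derive phi (t, x) (1, 0).
Proof.
have P s : (s, x) = ((0, x) : R * E) + s *: ((1, 0) : R * E).
  by congr pair => /=; [rewrite add0r [_ *: 1]mulr1|rewrite scaler0 addr0].
rewrite {1}P => /line_is_derive d.
have F : (fun s : R => phi (s, x)) = (fun s : R => phi ((0, x) + s *: (1, 0))).
  by apply/funext => s; rewrite -P.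
rewrite F; split; first exact: (@ex_derive _ _ _ _ _ _ _ d).
by rewrite (@derive_val _ _ _ _ _ _ _ d) -P.
Qed.

Lemma derivable_space phi t (x e : E) : derivable phi (t, x) (0, e) ->
  derivable (fun y : E => phi (t, y)) x e /\
  'D_e (fun y : E => phi (t, y)) x = derive phi (t, x) (0, e).
Proof.
move=> d; have qD : (fun k : R => k^-1 *: (phi (k *: (0, e) + (t, x)) - phi (t, x))) @ 0^' -->
  derive phi (t, x) (0, e) := d.
have E (k : R) : k *: ((0, e) : R * E) + (t, x) = (t, k *: e + x).
  by congr pair => /=; rewrite [_ *: 0]mulr0 add0r.
have H : (fun k : R => k^-1 *: (phi (t, k *: e + x) - phi (t, x))) @ 0^' --> derive phi (t, x) (0, e).
  by under eq_fun do rewrite -E.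
by split; [apply/cvg_ex; eexists; exact: H|exact: (cvg_lim (@Rhausdorff R) H)].
Qed.

Variables (phi : (R * E)%type -> R) (al be r : R).
Hypothesis sphi : smooth phi.
Hypothesis phi0 : forall t (x : E), t < al \/ be < t \/ r < `|x| -> phi (t, x) = 0.

Lemma test_derive_outside t (x : E) v : t < al \/ be < t \/ r < `|x| -> derive phi (t, x) v = 0.
Proof.
move=> tx; rewrite -[RHS](derive_cst (0 : R) (t, x) v); apply: near_eq_derive.
case: tx => [ta|[tb|rx]].
- have H : \forall s \near t, s < al by exact: lt_nbhsl.
  have K : \forall q \near (t, x), q.1 < al := @cvg_fst _ _ (nbhs t) (nbhs x) (nbhs_filter x) _ H.
  by apply: filterS K => -[s y] /= sa; apply: phi0; left.
- have H : \forall s \near t, be < s by exact: lt_nbhsr.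
  have K : \forall q \near (t, x), be < q.1 := @cvg_fst _ _ (nbhs t) (nbhs x) (nbhs_filter x) _ H.
  by apply: filterS K => -[s y] /= sa; apply: phi0; right; left.
- have H0 : \forall u \near `|x|, r < u by exact: lt_nbhsr.
  have H : \forall y \near x, r < `|y| := @norm_continuous _ _ x _ H0.
  have K : \forall q \near (t, x), r < `|q.2| := @cvg_snd _ _ (nbhs t) (nbhs x) (nbhs_filter t) _ H.
  by apply: filterS K => -[s y] /= sa; apply: phi0; right; right.
Qed.

Lemma test_derive_bound (v : R * E) : exists2 B : R, 0 <= B & forall p, `|derive phi p v| <= B.
Proof.
have cd : continuous (fun p => derive phi p v) := (sphi [:: v]).2.
pose K : set (R * E)%type := `[al, be]%classic `*` [set x : E | forall i, `[-r, r]%classic (x ord0 i)].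
have cK : compact K.
  apply: compact_setX; first exact: segment_compact.
  by apply: (@rV_compact _ _ (fun=> `[-r, r]%classic)) => i; exact: segment_compact.
have /compact_bounded[M [_ MB]] : compact ((fun p => derive phi p v) @` K).
  by apply: continuous_compact => //; exact: continuous_subspaceT.
exists (`|M| + 1) => [|[t x]]; first by rewrite addr_ge0.
have [ta|at_] := ltP t al; first by rewrite test_derive_outside ?normr0 ?addr_ge0//; left.
have [tb|bt] := ltP be t; first by rewrite test_derive_outside ?normr0 ?addr_ge0//; right; left.
have [rx|xr] := ltP r `|x|; first by rewrite test_derive_outside ?normr0 ?addr_ge0//; right; right.
apply: (MB (`|M| + 1)); first by rewrite ltr_pwDr// ler_norm.
exists (t, x) => //; split => /=; first by rewrite in_itv /= at_ bt.
by move=> i; rewrite /= in_itv /= -ler_norml; apply: le_trans (rv_norm_coord x i) xr.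
Qed.

Let test_line_lip (v : R * E) : exists2 B : R, 0 <= B & forall (p : R * E) (h : R), `|phi (p + h *: v) - phi p| <= B * `|h|.
Proof.
have [B B0 dB] := test_derive_bound v; exists B => // p h.
have D (s : R) : is_derive s (1 : R) (fun s : R => phi (p + s *: v)) (derive phi (p + s *: v) v).
  by apply: line_is_derive; exact: (sphi [::]).1.
have := is_derive_lip D (fun s => dB _) 0 h.
by rewrite scale0r addr0 subr0.
Qed.

(** Smoothness is given by directional derivatives, so the mean value theorem is applied along time
    and then along one coordinate at a time, through the points [z k] that mix the coordinates of
    [x] and [y]. *)
Lemma test_st_lip : exists L, st_lip L (fun t (x : E) => phi (t, x)).
Proof.
have [B1 B10 L1] := test_line_lip (1, 0).
have L2 (j : 'I_N) : exists B : R, 0 <= B /\ forall (p : R * E) (h : R), `|phi (p + h *: ((0, evec R j) : R * E)) - phi p| <= B * `|h|.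
  by have [B B0 H] := test_line_lip (0, evec R j); exists B.
pose B2 j := projT1 (cid (L2 j)).
have B20 j : 0 <= B2 j by exact: (projT2 (cid (L2 j))).1.
have B2P j : forall (p : R * E) (h : R), `|phi (p + h *: ((0, evec R j) : R * E)) - phi p| <= B2 j * `|h|.
  exact: (projT2 (cid (L2 j))).2.
have S0 : 0 <= \sum_j B2 j by rewrite sumr_ge0.
exists (B1 + \sum_j B2 j) => t s x y.
apply: le_trans (ler_distD (phi (s, x)) _ _) _; rewrite mulrDr !mulrDl -!addrA.
have H1 : `|phi (t, x) - phi (s, x)| <= B1 * `|t - s|.
  have := L1 (s, x) (t - s); have -> // : ((s, x) : R * E) + (t - s) *: ((1, 0) : R * E) = (t, x).
  by congr pair => /=; [rewrite [_ *: 1]mulr1 addrC subrK|rewrite scaler0 addr0].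
apply: lerD => //; rewrite addrCA -[leLHS]add0r addrA.
apply: (@le_trans _ _ ((\sum_j B2 j) * `|x - y|)); last first.
  by rewrite lerDr addr_ge0// mulr_ge0.
rewrite add0r; pose z (k : nat) : E := \row_j if (j < k)%N then x 0 j else y 0 j.
have step k : (k <= N)%N -> `|phi (s, z k) - phi (s, y)| <= (\sum_(j < N | (j < k)%N) B2 j) * `|x - y|.
  elim: k => [_|k IH kN].
    have -> : z 0%N = y by apply/rowP => j; rewrite mxE.
    by rewrite subrr normr0 mulr_ge0// sumr_ge0.
  pose i := Ordinal kN; apply: le_trans (ler_distD (phi (s, z k)) _ _) _.
  rewrite (bigD1 i)//= mulrDl; apply: lerD.
    have -> : (s, z k.+1) = ((s, z k) : R * E) + (x 0 i - y 0 i) *: ((0, evec R i) : R * E).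
      congr pair => /=; first by rewrite [_ *: 0]mulr0 addr0.
      apply/rowP => j; rewrite !mxE ltnS leq_eqVlt.
      have [->|ji] := eqVneq j i; first by rewrite /= eqxx ltnn /= mulr1 addrC subrK.
      have -> : (j == k :> nat) = false by apply/negbTE; apply: contra ji => /eqP jk; apply/eqP; exact: val_inj.
      by rewrite /= mulr0 addr0.
    apply: le_trans (B2P i _ _) _; apply: ler_wpM2l => //.
    by have := rv_norm_coord (x - y) i; rewrite !mxE.
  apply: le_trans (IH (ltnW kN)) _; apply: ler_wpM2r => //.
  rewrite le_eqVlt; apply/orP; left; apply/eqP; apply: eq_bigl => j /=.
  by rewrite ltnS ltn_neqAle andbC.
have := step N (leqnn N); have -> : z N = x by apply/rowP => j; rewrite mxE ltn_ord.
by under eq_bigl do rewrite ltn_ord.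
Qed.

End test_functions.



Lemma half_quotient_le (R : realFieldType) (K e : R) : 0 <= e -> 0 <= K ->
  K * (e / (2 * (K + 1))) <= e / 2.
Proof.
move=> e0 K0; have K1 : 0 < K + 1 by rewrite ltr_wpDl.
rewrite mulrA ler_pdivrMr ?mulr_gt0//; have -> : e / 2 * (2 * (K + 1)) = K * e + e by field.
by rewrite lerDl.
Qed.

Section transported_density.
Variables (R : realType) (N : nat).
Local Notation E := (E R N).
Local Notation ME := (ME R N).
Local Notation MR := (measurableTypeR R).
Local Notation TE := (MR * ME)%type.
Variable lam : {sigma_finite_measure set ME -> \bar R}.
Hypothesis lamP : is_lebesgue lam.
Local Notation tsmu := (product_measure1 (@lebesgue_measure R) lam).
Variables (T : R) (a : R -> E -> E).
Hypothesis T0 : 0 < T.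
Variable X : R -> E -> E.
Hypothesis flowX : transport_flow lam T a X.

Lemma Rintegral_norm_le_ereal (h : E -> R) (e : R) : lam.-integrable setT (EFin \o (h : ME -> R)) ->
  (\int[lam]_x (`|h x|)%:E <= e%:E)%E -> `|\int[lam]_x h x| <= e.
Proof.
move=> hi he; apply: le_trans (le_normr_Rintegral measurableT hi) _.
rewrite -lee_fin /Rintegral fineK//; apply: integral_fune_fin_num => //.
exact: (integrable_norm hi).
Qed.

Lemma flow_L1dist_norm (f g : E -> R) t : measurable_fun setT (f : ME -> R) ->
  measurable_fun setT (g : ME -> R) -> 0 <= t <= T ->
  (\int[lam]_x (`|f (X (clamp T t) x) - g (X (clamp T t) x)| * `|Jac T X t x|)%:E = L1dist lam f g)%E.
Proof.
move=> mf mg tT; rewrite -(flow_L1dist lamP T0 flowX mf mg tT).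
have mX := measurable_flow T0 flowX t.
have md : measurable_fun setT (fun x : ME => `|f (X (clamp T t) x) - g (X (clamp T t) x)|).
  apply: measurableT_comp => //; apply: measurable_funB; first exact: (measurableT_comp mf mX).
  exact: (measurableT_comp mg mX).
apply: ae_eq_integral => //.
- apply/measurable_EFinP; apply: measurable_funM => //.
  exact: (bmeas_norm (bmeas_Jac_space T0 flowX t)).1.
- by apply/measurable_EFinP; apply: measurable_funM => //; exact: (bmeas_JacP T0 flowX t).1.
apply: filterS (JacP_ae lamP T0 flowX tT) => x -> _.
by rewrite [`|JacP T X t x|]ger0_norm ?JacP_ge0.
Qed.

Variable q : E -> R.
Hypothesis mq : measurable_fun setT (q : ME -> R).
Hypothesis qloc : forall r : R, exists2 M : R, 0 <= M & forall x, `|x| <= r -> `|q x| <= M.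

Definition transported_density (t : R) (x : E) : R := q (X (clamp T t) x) * Jac T X t x.

(** The datum is only locally bounded, whereas approximation in mean needs an integrable function.
    With the displacement of the flow added to the radius, the cut is invisible after composition
    with the flow on a given ball. *)
Definition ball_cut (r : R) (x : E) : R := q x * \1_(rball r) (x : ME).

Lemma bmeas_ball_cut r : bmeas (ball_cut r : ME -> R).
Proof.
have mI : measurable_fun setT (\1_(rball r) : ME -> R).
  by apply: measurable_indic; exact: measurable_rball.
split; first exact: measurable_funM.
have [M M0 qM] := qloc r; exists M => x; rewrite /ball_cut indicE.
have [/set_mem xr|_] := boolP ((x : ME) \in rball r); first by rewrite mulr1 qM.
by rewrite mulr0 normr0.
Qed.

Lemma ball_cut_in r x : `|x| <= r -> ball_cut r x = q x.
Proof. by move=> xr; rewrite /ball_cut indicE mem_set ?mulr1. Qed.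

Lemma ball_cut_out r x : r < `|x| -> ball_cut r x = 0.
Proof.
rewrite ltNge => /negP xr; rewrite /ball_cut indicE memNset ?mulr0//.
Qed.

Lemma apx_ball_cut r : apx lam T a (ball_cut r).
Proof.
apply: (apx_integrable lamP T a (r := r) (bmeas_ball_cut r).1); last exact: ball_cut_out.
apply: (bmeas_integrableT (@measurable_rball R N r) (lebesgue_rball_fin lamP r) (bmeas_ball_cut r)).
by move=> x /negP; rewrite -ltNge; exact: ball_cut_out.
Qed.

Lemma flow_norm_le D t x r : (forall t x, `|X (clamp T t) x - x| <= D) ->
  `|x| <= r -> `|X (clamp T t) x| <= r + D.
Proof.
move=> XD xr; rewrite -[X (clamp T t) x](subrK x) addrC.
by apply: le_trans (ler_normD _ _) _; apply: lerD.
Qed.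

Lemma transported_density_Lloc t : Lloc lam (transported_density t).
Proof.
have [D D0 XD] := flow_displacement T0 flowX.
have [mJ [C JC]] := bmeas_Jac_space T0 flowX t.
split.
  apply: measurable_funM => //.
  exact: (measurableT_comp mq (measurable_flow T0 flowX t)).
move=> r; have [M M0 qM] := qloc (r + D); exists (M * C); apply: aeW => x xr.
rewrite normrM ler_pM//.
by apply: qM; exact: flow_norm_le.
Qed.

Lemma transported_density_end x : transported_density T x = q x.
Proof.
have [_ [_ [XT _]]] := flowX.
by rewrite /transported_density (Jac_end T0 flowX) mulr1 clamp_id ?XT// lexx ltW.
Qed.

(** On [[0, T]] the function is a uniform limit of Lipschitz functions of time: both the datum and
    the test function are approximated in mean by Lipschitz functions, and [weighted_grad_det_lip]
    applies to the approximations. *)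
Lemma transported_density_continuous phi : L1c lam phi ->
  {within `[0, T], continuous (fun t => \int[lam]_x (transported_density t x * phi x))}.
Proof.
move=> [mphi [phii [r phir]]].
have [D D0 XD] := flow_displacement T0 flowX.
have [_ [C JC]] := bmeas_Jac T0 flowX.
have C0 : 0 <= C := le_trans (normr_ge0 _) (JC (0, 0)).
pose f := ball_cut (r + 1 + D); have bf := bmeas_ball_cut (r + 1 + D).
have [M fM] := bf.2; have M0 : 0 <= M := le_trans (normr_ge0 _) (fM 0).
pose F t := \int[lam]_x (transported_density t x * phi x).
have FE t : F t = \int[lam]_x (f (X (clamp T t) x) * Jac T X t x * phi x).
  apply: eq_Rintegral => x _; have [/phir ->|xr] := ltP r `|x : E|; first by rewrite !mulr0.
  by rewrite /transported_density /f ball_cut_in// flow_norm_le// (le_trans xr)// lerDl.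
have bfX t : bmeas (fun x : ME => f (X (clamp T t) x)) := bmeas_comp (measurable_flow T0 flowX t) bf.
have iF t : lam.-integrable setT (EFin \o (fun x : ME => f (X (clamp T t) x) * Jac T X t x * phi x)).
  apply: (@le_integrable _ _ _ _ _ measurableT _ (EFin \o (fun x : ME => M * C * phi x))).
  - apply/measurable_EFinP; apply: measurable_funM => //.
    exact: (bmeasM (bfX t) (bmeas_Jac_space T0 flowX t)).1.
  - move=> x _; rewrite /= lee_fin normrM [leRHS]normrM; apply: ler_pM => //.
    rewrite normrM [leRHS]ger0_norm ?mulr_ge0//.
    by apply: ler_pM; [| |exact: fM|exact: (JC (t, x))].
  - have := integrableZl measurableT (M * C) phii; congr (integrable _ _ _).
have key e : 0 < e -> exists G : R -> R, exists2 K, 0 <= K &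
    (forall t s, `|G t - G s| <= K * `|t - s|) /\ (forall t, 0 <= t <= T -> `|F t - G t| <= e).
  move=> e0; have CM1 : 0 < 2 * (M * C + 1) by rewrite mulr_gt0// ltr_wpDl// mulr_ge0.
  have [z0 nz0 dz0] := apx_integrable lamP T a mphi phii phir (divr_gt0 e0 CM1).
  have [[Lz [Bz [rz [zL zB zr]]]] _] := nz0.
  have Bz0 : 0 <= Bz := le_trans (normr_ge0 _) (zB 0).
  have Bz1 : 0 < 2 * (Bz + 1) by rewrite mulr_gt0// ltr_wpDl.
  (* The tolerance for [psi] depends on the bound [Bz] of the approximation already chosen for
     [phi]. The two errors, [M * C] times the first distance and [Bz] times the second, are at most
     [e / 2] each. *)
  have [psi npsi dpsi] := @apx_ball_cut (r + 1 + D) _ (divr_gt0 e0 Bz1).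
  (* This cutoff reduces the support of [z0] to radius [r + 1]. It is 1 where [phi] may be nonzero,
     so the distance to [phi] does not increase. *)
  pose chi (x : E) : R := clamp 1 (r + 1 - `|x|).
  pose z x := chi x * z0 x.
  have chi01 x : 0 <= chi x <= 1 := clamp_itv ltr01 _.
  have chiL : st_lip 1 (fun _ : R => chi).
    move=> t s x y; rewrite mul1r; apply: le_trans (clamp_lip ltr01 _ _) _.
    have -> : r + 1 - `|x| - (r + 1 - `|y|) = `|y| - `|x| by ring.
    by apply: le_trans (ler_dist_dist _ _) _; rewrite distrC lerDr.
  have chiB (t : R) x : `|chi x| <= 1 by have /andP[? ?] := chi01 x; rewrite ger0_norm.
  have z0L : st_lip `|Lz| (fun _ : R => z0).
    move=> t s x y; apply: le_trans (zL x y) _.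
    apply: le_trans (ler_wpM2r (normr_ge0 _) (ler_norm Lz)) _.
    by apply: ler_wpM2l => //; rewrite lerDr.
  have zLip : st_lip (1 * `|Lz| + 1 * Bz) (fun _ : R => z) := st_lipM chiL z0L chiB (fun _ => zB).
  have zBd (t : R) x : `|z x| <= Bz.
    by rewrite normrM -[Bz]mul1r ler_pM//; exact: chiB t x.
  have zout x : r + 1 < `|x| -> z x = 0.
    by move=> rx; rewrite /z /chi /clamp (min_idPl _) ?(max_idPl _) ?mul0r//; lra.
  have dphiz x : `|phi x - z x| <= `|phi x - z0 x|.
    have [xr|xr] := leP `|x| r.
      by rewrite /z /chi /clamp (min_idPr _) ?(max_idPr _) ?mul1r//; lra.
    rewrite phir// /z !sub0r !normrN normrM ler_piMl//; exact: (chiB 0).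
  have mz : measurable_fun setT (z : ME -> R).
    by apply: continuous_measurable_rv; exact: lip_continuous (st_lip_space 0 zLip).
  have [L [B [rp [pL pB pr]]]] := nice_flow_lip T0 flowX npsi.
  have wL := st_lipM pL zLip pB zBd.
  pose w t x := psi (X (clamp T t) x) * z x.
  have wB t x : `|w t x| <= B * Bz by rewrite normrM; apply: ler_pM => //; exact: (zBd t).
  have wr t x : r + 1 < `|x| -> w t x = 0 by move=> /zout zx; rewrite /w zx mulr0.
  have [LX [XL _]] := flow_lip T0 flowX.
  pose LL := Num.max (B * (1 * `|Lz| + 1 * Bz) + L * Bz) LX.
  have wL' : st_lip LL w.
    by move=> u s x y; apply: le_trans (wL u s x y) _; rewrite ler_wpM2r ?addr_ge0// le_max lexx.
  have XL' i : st_lip LL (comp_flow T X i).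
    by move=> u s x y; apply: le_trans (XL i u s x y) _; rewrite ler_wpM2r ?addr_ge0// le_max lexx orbT.
  have [K K0 GK] := weighted_grad_det_lip lamP wL' wB wr XL'.
  exists (fun t => \int[lam]_x (w t x * Jac T X t x)), K => //; split; first exact: GK.
  move=> t tT; rewrite FE.
  have bw : bmeas (w t : ME -> R) by apply: bmeas_lip (st_lip_space t wL') (wB t).
  have bwJ := bmeasM bw (bmeas_Jac_space T0 flowX t).
  have iw : lam.-integrable setT (EFin \o (fun x : ME => w t x * Jac T X t x)).
    apply: bmeas_integrableT (@measurable_rball R N (r + 1)) (lebesgue_rball_fin lamP (r + 1)) bwJ _.
    by move=> x /negP; rewrite -ltNge => /(wr t) ->; rewrite mul0r.
  rewrite -RintegralB//; apply: Rintegral_norm_le_ereal.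
    by have := integrableB measurableT (iF t) iw; congr (integrable _ _ _).
  have mfp : measurable_fun setT (f : ME -> R) := bf.1.
  have mpsi : measurable_fun setT (psi : ME -> R) := (nice_bmeas npsi).1.
  pose A (x : ME) : \bar R := ((M * C) * `|phi x - z0 x|)%:E.
  pose A' (x : ME) : \bar R := (Bz * (`|f (X (clamp T t) x) - psi (X (clamp T t) x)| * `|Jac T X t x|))%:E.
  have mA1 : measurable_fun setT (fun x : ME => `|phi x - z0 x|).
    by apply: measurableT_comp => //; apply: measurable_funB => //; exact: (nice_bmeas nz0).1.
  have mX := measurable_flow T0 flowX t.
  have mA2 : measurable_fun setT (fun x : ME => `|f (X (clamp T t) x) - psi (X (clamp T t) x)| * `|Jac T X t x|).
    apply: measurable_funM; last exact: (bmeas_norm (bmeas_Jac_space T0 flowX t)).1.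
    by apply: measurableT_comp => //; apply: measurable_funB; [exact: (measurableT_comp mfp mX)|exact: (measurableT_comp mpsi mX)].
  have mA : measurable_fun setT A by apply/measurable_EFinP; apply: measurable_funM.
  have mA' : measurable_fun setT A' by apply/measurable_EFinP; apply: measurable_funM.
  apply: (@le_trans _ _ (\int[lam]_x (A x + A' x))%E).
    apply: ge0_le_integral => //.
    - apply/measurable_EFinP; apply: measurableT_comp => //; apply: measurable_funB; last exact: bwJ.1.
      by apply/measurable_EFinP; exact: (measurable_int _ (iF t)).
    - exact: emeasurable_funD.
    move=> x _; rewrite /A /A' -EFinD lee_fin.
    have -> : f (X (clamp T t) x) * Jac T X t x * phi x - w t x * Jac T X t x =
      f (X (clamp T t) x) * Jac T X t x * (phi x - z x) +
      z x * ((f (X (clamp T t) x) - psi (X (clamp T t) x)) * Jac T X t x) by rewrite /w; ring.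
    apply: le_trans (ler_normD _ _) _; apply: lerD.
      rewrite 2!normrM; apply: ler_pM; [by rewrite mulr_ge0|by []| |exact: dphiz].
      by apply: ler_pM; [| |exact: fM|exact: (JC (t, x))].
    rewrite [leLHS]normrM; apply: ler_pM => //; first exact: (zBd t).
    by rewrite normrM.
  rewrite ge0_integralD//; last 2 first.
    by move=> x _; rewrite lee_fin !mulr_ge0.
    by move=> x _; rewrite lee_fin !mulr_ge0.
  have -> : (\int[lam]_x A x = (M * C)%:E * L1dist lam phi z0)%E.
    rewrite /A; under eq_integral do rewrite EFinM; rewrite ge0_integralZl//.
      exact/measurable_EFinP.
    by rewrite lee_fin mulr_ge0.
  have -> : (\int[lam]_x A' x = Bz%:E * L1dist lam f psi)%E.
    rewrite -(flow_L1dist_norm mfp mpsi tT) /A'; under eq_integral do rewrite EFinM.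
    by rewrite ge0_integralZl//; exact/measurable_EFinP.
  rewrite [e in leRHS]splitr EFinD; apply: leeD.
    apply: le_trans (lee_wpmul2l _ dz0) _; first by rewrite lee_fin mulr_ge0.
    rewrite -EFinM lee_fin; exact: half_quotient_le (ltW e0) (mulr_ge0 M0 C0).
  apply: le_trans (lee_wpmul2l _ dpsi) _; first by rewrite lee_fin.
  rewrite -EFinM lee_fin; exact: half_quotient_le (ltW e0) Bz0.
apply/subspace_continuousP => t tI; apply/cvgrPdist_le => e e0.
have e40 : 0 < e / 4 by rewrite divr_gt0.
have [G [K K0 [GL FG]]] := key _ e40.
have K1 : 0 < K + 1 by rewrite ltr_wpDl.
have tT : 0 <= t <= T by move: tI; rewrite /= in_itv.
suff Hs : \forall s \near (t : R), 0 <= s <= T -> `|F t - F s| <= e.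
  by rewrite /within /=; apply: filterS Hs => s Hs sI; apply: Hs; move: sI; rewrite /= in_itv.
near=> s => sT.
have h1 := FG t tT; have h2 := FG s sT; have h3 := GL t s.
have h4 : `|t - s| <= e / 4 / (K + 1).
  near: s; exists (e / 4 / (K + 1)); first by rewrite /= !divr_gt0.
  by move=> u /= /ltW.
have h5 : K * `|t - s| <= e / 4.
  apply: le_trans (ler_wpM2l K0 h4) _; rewrite mulrCA ler_piMr ?(ltW e40)//.
  by rewrite ler_pdivrMr// mul1r lerDl.
have h6 := le_trans h3 h5.
move: (F t) (F s) (G t) (G s) h1 h2 h6 => p1 p2 p3 p4.
rewrite !ler_norml => /andP[? ?] /andP[? ?] /andP[? ?]; apply/andP; split; lra.
Unshelve. all: by end_near. Qed.

End transported_density.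


(** * The continuity equation for the transported density *)

Section transported_density_pde.
Variables (R : realType) (N : nat).
Local Notation E := (E R N).
Local Notation ME := (ME R N).
Local Notation MR := (measurableTypeR R).
Local Notation TE := (MR * ME)%type.
Variable lam : {sigma_finite_measure set ME -> \bar R}.
Hypothesis lamP : is_lebesgue lam.
Local Notation tsmu := (product_measure1 (@lebesgue_measure R) lam).
Variables (T : R) (a : R -> E -> E).
Hypothesis T0 : 0 < T.
Variable X : R -> E -> E.
Hypothesis flowX : transport_flow lam T a X.
Variable q : E -> R.
Hypothesis mq : measurable_fun setT (q : ME -> R).
Hypothesis qloc : forall r : R, exists2 M : R, 0 <= M & forall x, `|x| <= r -> `|q x| <= M.

Lemma bmeas_flow_comp (f : E -> R) : bmeas (f : ME -> R) ->
  bmeas (fun p : TE => f (X (clamp T p.1) p.2)).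
Proof.
have [L [XL _]] := flow_lip T0 flowX.
apply: bmeas_comp; apply: measurable_rv => i; exact: measurable_st (XL i).
Qed.

(* The speed, cut off where it is undefined or exceeds its essential bound. *)
Lemma bounded_speed : Linfty_st lam T a -> exists b : 'I_N -> TE -> R,
  (forall j, bmeas (b j)) /\
  {ae tsmu, forall p : TE, 0 < (p.1 : R) < T -> forall j, b j p = a p.1 p.2 0 j}.
Proof.
move=> [ma [M0 aM]]; pose M := Num.max 0 M0; have M00 : 0 <= M by rewrite le_max lexx.
pose I : set TE := [set` `]0, T[] `*` setT.
have mI : measurable I by apply: measurableX => //; exact: measurable_itv.
pose G : set TE := I `&` [set p | forall j, `|a p.1 p.2 0 j| <= M].
have mG : measurable G.
  have -> : G = I `&` \bigcap_(j in [set: 'I_N]) (I `&` (fun p : TE => a p.1 p.2 0 j) @^-1` `[- M, M]).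
    apply/seteqP; split => p [Ip Gp]; split => //.
      by move=> j _; split => //=; rewrite in_itv /= -ler_norml.
    by move=> j; have [_] := Gp j Logic.I; rewrite /= in_itv /= -ler_norml.
  apply: measurableI => //; apply: fin_bigcap_measurable; first exact: finite_finset.
  by move=> j _; apply: ma => //; exact: measurable_itv.
exists (fun j => (fun p : TE => a p.1 p.2 0 j) \_ G); split.
  move=> j; split.
    apply/(measurable_restrictT _ mG); apply: measurable_funS (ma j) => //.
    by move=> p [].
  exists M => p; rewrite /patch; case: ifPn => [/set_mem[_ Gp]|_]; first exact: Gp.
  by rewrite normr0.
move/st_aeP: aM; apply: filterS => p ap pT j; rewrite /patch mem_set//; split.
  by split => //=; rewrite in_itv.
move=> i /=; apply: le_trans (rv_norm_coord _ _) _; apply: le_trans (ap pT) _.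
by rewrite le_max lexx orbT.
Qed.

(** For a datum [psi] that is [nice], the equation is [flow_integral0] with weight [psi(X)]. The
    general datum follows by approximation in mean on a ball, the error being independent of time by
    [flow_L1dist_norm]. *)
Lemma transported_density_pde phi : Linfty_st lam T a -> test_fun T phi ->
  (\int[@lebesgue_measure R]_(t in `]0%R, T[)
     \int[lam]_(x in [set: ME])
       (transported_density T X q t x * (derive phi (t, x : E) (1, 0) +
          \sum_(j < N) a t x 0 j * derive phi (t, x : E) (0, evec R j)))%:E)%E = 0%E.
Proof.
move=> aI [sm [del [r [del0 supp]]]].
have [b [bb bE]] := bounded_speed aI; have [ma _] := aI.
(* The [del] of a test function may exceed [T / 2]; the minimum ensures [al <= be]. *)
pose al := Num.min del (T / 2); pose be := T - al.
have T0' := T0.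
have [al0 [alT ald]] : 0 < al /\ al <= T / 2 /\ al <= del.
  by rewrite /al; case: (leP del (T / 2)) => h; split => //; lra.
have phi0 t (x : E) : t < al \/ be < t \/ r < `|x| -> phi (t, x) = 0.
  case=> [h|[h|h]]; apply: supp; [left|right; left|by right; right].
    by apply: le_trans ald; exact: ltW.
  by apply: le_trans (ltW h); rewrite /be; lra.
have [Lp pL] := test_st_lip sm phi0.
have cont f : continuous f -> measurable_fun setT (f : TE -> R) := @continuous_measurable_ts R N f.
pose D0 (p : TE) : R := derive phi (p : R * E) (1, 0).
pose Dx j (p : TE) : R := derive phi (p : R * E) (0, evec R j).
have bD0 : bmeas D0.
  split; first exact: cont (sm [:: (1, 0)]).2.
  by have [B _ H] := test_derive_bound sm phi0 (1, 0); exists B.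
have bDx j : bmeas (Dx j).
  split; first exact: cont (sm [:: (0, evec R j)]).2.
  by have [B _ H] := test_derive_bound sm phi0 (0, evec R j); exists B.
have D0out (p : TE) : r < `|p.2 : E| -> D0 p = 0.
  by case: p => t x /= rx; apply: (test_derive_outside phi0); right; right.
have Dxout j (p : TE) : r < `|p.2 : E| -> Dx j p = 0.
  by case: p => t x /= rx; apply: (test_derive_outside phi0); right; right.
pose It : TE -> R := fun p => \1_(`]0, T[) (p.1 : R).
have bIt : bmeas It.
  apply: (@bmeas_comp _ _ TE MR R fst (\1_(`]0, T[) : MR -> R)); first exact: measurable_fst.
  by apply: bmeas_indic; exact: measurable_itv.
have It1 p : 0 < (p.1 : R) < T -> It p = 1 by move=> pT; rewrite /It indicE mem_setE in_itv /= pT.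
have It0 p : ~ (0 < (p.1 : R) < T) -> It p = 0.
  by move=> /negP/negbTE pT; rewrite /It indicE mem_setE in_itv /= pT.
(* The derivative of [phi] along the speed, with the bounded speed [b] in place of [a]: this makes
   it bounded everywhere, and it changes only on a null set. *)
pose W (p : TE) := It p * (D0 p + \sum_j b j p * Dx j p).
have bW : bmeas W.
  have bS : bmeas (fun p => \sum_j b j p * Dx j p).
    by apply: bmeas_sum => j _; exact: (bmeasM (bb j) (bDx j)).
  exact: (bmeasM bIt (bmeasD bD0 bS)).
have W0 (p : TE) : ~ (0 < (p.1 : R) < T) \/ r < `|p.2 : E| -> W p = 0.
  case=> [/It0 h|h]; first by rewrite /W h mul0r.
  by rewrite /W D0out// big1 ?addr0 ?mulr0// => j _; rewrite Dxout ?mulr0.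
have [D DD0 XD] := flow_displacement T0 flowX.
pose f := ball_cut q (r + D); have bf : bmeas (f : ME -> R) := bmeas_ball_cut mq qloc (r + D).
have bJ := bmeas_Jac T0 flowX.
pose H2 (p : TE) := f (X (clamp T p.1) p.2) * Jac T X p.1 p.2 * W p.
have bH2 : bmeas H2 := (bmeasM (bmeasM (bmeas_flow_comp bf) bJ) bW).
have slab0 (p : TE) : ~ slab 0 T r p -> ~ (0 < (p.1 : R) < T) \/ r < `|p.2 : E|.
  move=> np; have [rx|xr] := ltP r `|p.2 : E|; [by right|left => /andP[p1 p2]].
  by apply: np; apply/slabP; split => //; rewrite !ltW.
have H20 (p : TE) : ~ slab 0 T r p -> H2 p = 0 by move=> /slab0/W0 h; rewrite /H2 h mulr0.
have tests psi : nice lam T a psi ->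
    \int[tsmu]_p (psi (X (clamp T p.1) p.2) * Jac T X p.1 p.2 * W p) = 0.
  move=> npsi; have [L [B [rp [wL wB wr]]]] := nice_flow_lip T0 flowX npsi.
  have [Bp [pB pBd]] : exists Bp : R, 0 <= Bp /\ forall t x, `|phi (t, x)| <= Bp.
    exists (Lp * T); split; first by rewrite mulr_ge0 ?(st_lip_ge0 pL)// ltW.
    move=> t x; have [ta|ta] := ltP t 0.
      by rewrite phi0 ?normr0 ?mulr_ge0 ?(st_lip_ge0 pL) ?(ltW T0)//; left; exact: lt_trans ta al0.
    have [tT|tT] := ltP T t.
      rewrite phi0 ?normr0 ?mulr_ge0 ?(st_lip_ge0 pL) ?(ltW T0)//; right; left.
      by apply: le_lt_trans tT; rewrite /be; lra.
    have := pL t 0 x x; rewrite subrr normr0 addr0 subr0 [phi (0, x)]phi0; last by left.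
    rewrite subr0 [`|t|]ger0_norm// => /le_trans; apply.
    by rewrite ler_wpM2l// (st_lip_ge0 pL).
  have bpsi := bmeas_flow_comp (nice_bmeas npsi).
  have dphi (p : TE) : der_at (fun t x => phi (t, x)) p.1 p.2.
    case: p => t x /=; split; first exact: (derivable_time ((sm [::]).1 _ _)).1.
    by move=> j; exact: (derivable_space ((sm [::]).1 _ _)).1.
  apply: (flow_integral0 lamP T0 flowX (al := al) (be := be) (r := r) wL wB pL pBd (npsi.2 X flowX) _ al0).
  - by apply: aeW => p _; exact: dphi.
  - by rewrite /be; lra.
  - by rewrite /be; lra.
  - by move=> t x /phi0 h; rewrite h mul0r.
  - exact: (bmeasM (bmeasM bpsi bJ) bW).1.
  - apply: filterS bE => p bp pT; congr (_ * _); rewrite /W (It1 _ pT) mul1r.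
    case: p bp pT => t x /= bp pT; rewrite /mat_der /D0.
    rewrite (derivable_time ((sm [::]).1 _ _)).2; congr (_ + _).
    apply: eq_bigr => j _; rewrite (bp pT).
    by rewrite (derivable_space ((sm [::]).1 _ _)).2.
  - by move=> p pT; rewrite (W0 p (or_introl pT)) mulr0.
have [_ [BW WB]] := bW; have BW0 : 0 <= BW := le_trans (normr_ge0 _) (WB (0, 0)).
have H2int : \int[tsmu]_p H2 p = 0.
  apply/eqP; rewrite -normr_le0; apply/ler_addgt0Pr => e e0; rewrite add0r.
  have K0 : 0 < BW * T + 1 by rewrite ltr_wpDl// mulr_ge0// ltW.
  have [psi npsi dpsi] := apx_ball_cut lamP T a mq qloc (r + D) (divr_gt0 e0 K0).
  have [L [B [rp [wL wB wr]]]] := nice_flow_lip T0 flowX npsi.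
  have bpsi := bmeas_flow_comp (nice_bmeas npsi).
  have bfX := bmeas_flow_comp bf.
  have bpsiH := bmeasM (bmeasM bpsi bJ) bW.
  have psi0 (p : TE) : ~ slab 0 T r p -> psi (X (clamp T p.1) p.2) * Jac T X p.1 p.2 * W p = 0.
    by move=> /slab0/W0 h; rewrite h mulr0.
  have mS := @measurable_slab R N 0 T r; have fS := tsmu_slab_fin lamP 0 T r.
  have iH2 : tsmu.-integrable setT (EFin \o H2) := bmeas_integrableT mS fS bH2 H20.
  have ipsi := bmeas_integrableT mS fS bpsiH psi0.
  rewrite -[\int[tsmu]_p H2 p]subr0 -[X in _ - X](tests psi npsi) -(RintegralB _ iH2 ipsi)//.
  pose rr := Num.max (r + D + D) rp.
  pose h (p : TE) := `|f (X (clamp T p.1) p.2) - psi (X (clamp T p.1) p.2)| * `|Jac T X p.1 p.2| *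
    \1_(`[0, T]) (p.1 : R).
  have bh : bmeas h.
    apply: bmeasM; first by apply: bmeasM; apply: bmeas_norm => //; exact: bmeasB.
    apply: (@bmeas_comp _ _ TE MR R fst (\1_(`[0, T]) : MR -> R)); first exact: measurable_fst.
    by apply: bmeas_indic; exact: measurable_itv.
  have fX0 t (x : E) : r + D + D < `|x| -> f (X (clamp T t) x) = 0.
    move=> rx; apply: ball_cut_out.
    by have := ler_normB (X (clamp T t) x) (X (clamp T t) x - x); rewrite subKr; have := XD t x; lra.
  have h0 (p : TE) : ~ slab 0 T rr p -> h p = 0.
    move=> np; rewrite /h; have [|xr] := ltP rr `|p.2 : E|.
      by rewrite gt_max => /andP[/fX0 -> /wr ->]; rewrite subrr normr0 !mul0r.
    rewrite indicE mem_setE in_itv /=; case: (boolP (_ && _)) => [pT|_]; last by rewrite mulr0.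
    by exfalso; apply: np; apply/slabP.
  have mS' := @measurable_slab R N 0 T rr; have fS' := tsmu_slab_fin lamP 0 T rr.
  have ih := bmeas_integrableT mS' fS' bh h0.
  have ibh : tsmu.-integrable setT (EFin \o (fun p : TE => BW * h p)).
    apply: (bmeas_integrableT mS' fS' (bmeasM (bmeas_cst _ BW) bh)) => p /h0 ->.
    by rewrite mulr0.
  have id := bmeas_integrableT mS fS (bmeasB bH2 bpsiH)
    (fun p np => etrans (congr2 (fun u v => u - v) (H20 p np) (psi0 p np)) (subrr 0)).
  have idn := bmeas_integrableT mS fS (bmeas_norm (bmeasB bH2 bpsiH))
    (fun p np => etrans (congr2 (fun u v => `|u - v|) (H20 p np) (psi0 p np)) (etrans (congr1 _ (subrr 0)) (normr0 _))).
  apply: le_trans (le_normr_Rintegral _ id) _ => //.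
  apply: (@le_trans _ _ (\int[tsmu]_p (BW * h p))).
    apply: le_Rintegral => // p _.
    have [pT|/negP pT] := boolP (0 < (p.1 : R) < T); last first.
      rewrite /H2 (W0 p (or_introl pT)) !mulr0 subrr normr0 mulr_ge0//.
      by rewrite /h indicE !mulr_ge0.
    have -> : H2 p - psi (X (clamp T p.1) p.2) * Jac T X p.1 p.2 * W p =
      W p * ((f (X (clamp T p.1) p.2) - psi (X (clamp T p.1) p.2)) * Jac T X p.1 p.2).
      by rewrite /H2; ring.
    rewrite normrM [X in _ * X]normrM; apply: ler_pM => //.
    rewrite /h indicE mem_setE in_itv /=.
    have -> : (0 <= (p.1 : R) <= T) = true by case/andP: pT => p1 p2; rewrite !ltW.
    by rewrite mulr1.
  rewrite RintegralZl// (tsmu_Rintegral lamP bh h0).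
  pose l := fine (L1dist lam f psi).
  have lfin : L1dist lam f psi \is a fin_num.
    by rewrite ge0_fin_numE ?L1dist_ge0//; apply: le_lt_trans dpsi _; rewrite ltry.
  have -> : \int[@lebesgue_measure R]_t \int[lam]_x h (t, x) =
      \int[@lebesgue_measure R]_t (l * \1_(`[0, T]) (t : R)).
    apply: eq_Rintegral => t _; rewrite /h /= indicE mem_setE in_itv /=.
    case: (boolP (0 <= (t : R) <= T)) => [tT|_]; last first.
      by rewrite mulr0 /Rintegral; under eq_integral do rewrite mulr0; rewrite integral0.
    rewrite mulr1 /l -(flow_L1dist_norm lamP T0 flowX bf.1 (nice_bmeas npsi).1 tT).
    by rewrite /Rintegral; under eq_integral do rewrite mulr1.
  have oI (t : MR) : ~ [set` `[0, T]] t -> l * \1_(`[0, T]) (t : R) = 0.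
    by move=> nt; rewrite indicE memNset// mulr0.
  have -> : \int[@lebesgue_measure R]_t (l * \1_(`[0, T]) (t : R)) = l * T.
    rewrite -(Rintegral_setT_supp (lebesgue_measure : {measure set MR -> \bar R}) oI).
    rewrite (@eq_Rintegral _ _ _ _ _ (fun=> l)); last by move=> t tI; rewrite indicE tI mulr1.
    rewrite Rintegral_cst//.
    congr (_ * _); have mE : @lebesgue_measure R [set` `[0, T]] = T%:E.
      by rewrite lebesgue_measure_itv /= lte_fin T0 -EFinD subr0.
    by rewrite [X in fine X]mE.
  have le1 : l <= e / (BW * T + 1) by rewrite -lee_fin /l fineK.
  apply: (@le_trans _ _ ((BW * T) * (e / (BW * T + 1)))).
    by rewrite [l * T]mulrC mulrA ler_wpM2l ?mulr_ge0 ?(ltW T0).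
  rewrite mulrCA ler_piMr ?(ltW e0)// ler_pdivrMr// mul1r lerDl.
  exact: ler01.
(* The iterated integral of the statement involves [a] itself, so [H1] uses its restriction [A],
   equal to [a] at every interior time. The bounded [H2] agrees with [H1] almost everywhere and
   provides the integrability that Fubini requires. *)
pose A j : TE -> R := (fun p : TE => a p.1 p.2 0 j) \_ ([set` `]0, T[] `*` setT).
have mIs : measurable ([set` `]0, T[] `*` setT : set TE).
  by apply: measurableX => //; exact: measurable_itv.
have mA j : measurable_fun setT (A j) by apply/(measurable_restrictT _ mIs); exact: ma.
have AE j (p : TE) : 0 < (p.1 : R) < T -> A j p = a p.1 p.2 0 j.
  by move=> pT; rewrite /A /patch mem_set//; split => //=; rewrite in_itv.
pose H1 (p : TE) := f (X (clamp T p.1) p.2) * Jac T X p.1 p.2 *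
  (It p * (D0 p + \sum_j A j p * Dx j p)).
have mH1 : measurable_fun setT H1.
  apply: measurable_funM; first exact: (bmeasM (bmeas_flow_comp bf) bJ).1.
  apply: measurable_funM; first exact: bIt.1.
  apply: measurable_funD; first exact: bD0.1.
  by apply: measurable_sum => j; apply: measurable_funM => //; exact: (bDx j).1.
have H12 : {ae tsmu, forall p : TE, H1 p = H2 p}.
  apply: filterS bE => p bp; rewrite /H1 /H2 /W; congr (_ * _).
  have [pT|/negP pT] := boolP (0 < (p.1 : R) < T); last by rewrite It0 ?mul0r.
  by congr (_ * (_ + _)); apply: eq_bigr => j _; rewrite bp// AE.
have iH2 : tsmu.-integrable setT (EFin \o H2).
  exact: (bmeas_integrableT (@measurable_slab R N 0 T r) (tsmu_slab_fin lamP 0 T r) bH2 H20).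
have mEH1 : measurable_fun setT (EFin \o H1) by exact/measurable_EFinP.
have mEH2 : measurable_fun setT (EFin \o H2) by apply/measurable_EFinP; exact: bH2.1.
have iH1 : tsmu.-integrable setT (EFin \o H1).
  apply/integrableP; split => //.
  have -> : (\int[tsmu]_p `|(EFin \o H1) p| = \int[tsmu]_p `|(EFin \o H2) p|)%E.
    apply: ae_eq_integral => //; [exact: measurableT_comp|exact: measurableT_comp|].
    by apply: filterS H12 => p /= ->.
  by have /integrableP[] := iH2.
transitivity (\int[tsmu]_p (H1 p)%:E)%E; last first.
  transitivity (\int[tsmu]_p (H2 p)%:E)%E.
    by apply: ae_eq_integral => //; apply: filterS H12 => p /= ->.
  by rewrite -[LHS]fineK ?[X in X%:E]H2int//; apply: integral_fune_fin_num.
rewrite -[RHS](integral12_prod_meas1 iH1) integral_mkcond; apply: eq_integral => t _.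
rewrite /patch mem_setE in_itv /= /fubini_F; case: ifPn => tT.
  apply: eq_integral => x _ /=; congr EFin; rewrite /H1 It1// mul1r /=.
  have -> : D0 (t, x) + \sum_j A j (t, x) * Dx j (t, x) =
      derive phi (t, x : E) (1, 0) + \sum_(j < N) a t x 0 j * derive phi (t, x : E) (0, evec R j).
    by congr (_ + _); apply: eq_bigr => j _; rewrite AE.
  have [rx|xr] := ltP r `|x : E|.
    have -> : derive phi (t, x : E) (1, 0) + \sum_(j < N) a t x 0 j * derive phi (t, x : E) (0, evec R j) = 0.
      have := D0out (t, x) rx; rewrite /D0 => ->; rewrite big1 ?addr0// => j _.
      by have := Dxout j (t, x) rx; rewrite /Dx => ->; rewrite mulr0.
    by rewrite !mulr0.
  by rewrite /transported_density /f ball_cut_in//; exact: flow_norm_le.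
by rewrite [RHS]integral0_eq// => x _; rewrite /= /H1 (It0 (t, x) (negP tT)) mul0r mulr0.
Qed.

End transported_density_pde.


(** * Reversible solutions *)

Section reversible.
Variables (R : realType) (N : nat).
Local Notation E := (E R N).
Local Notation ME := (ME R N).
Local Notation MR := (measurableTypeR R).
Local Notation TE := (MR * ME)%type.
Variable lam : {sigma_finite_measure set ME -> \bar R}.
Hypothesis lamP : is_lebesgue lam.
Local Notation tsmu := (product_measure1 (@lebesgue_measure R) lam).
Variables (T : R) (a : R -> E -> E).
Hypothesis T0 : 0 < T.

(** The representative is zero on the set where one of the essential bounds on balls of integer
    radius fails. This countable union of null sets is null. *)
Lemma Lloc_everywhere_bounded (f : E -> R) : Lloc lam f ->
  exists q : E -> R, [/\ measurable_fun setT (q : ME -> R),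
    forall r : R, exists2 M : R, 0 <= M & forall x, `|x| <= r -> `|q x| <= M &
    {ae lam, forall x : ME, q x = f x}].
Proof.
move=> [mf fB].
have H (n : nat) : exists M : R, 0 <= M /\ {ae lam, forall x : ME, `|x : E| <= n%:R -> `|f x| <= M}.
  have [M MB] := fB n%:R; exists (Num.max 0 M); split; first by rewrite le_max lexx.
  by apply: filterS MB => x h /h xM; rewrite le_max xM orbT.
pose M n := projT1 (cid (H n)).
have M0 n : 0 <= M n by exact: (projT2 (cid (H n))).1.
have MP n : {ae lam, forall x : ME, `|x : E| <= n%:R -> `|f x| <= M n} := (projT2 (cid (H n))).2.
pose G : set ME := \bigcap_n (~` (rball n%:R `&` (fun x => `|f x|) @^-1` `]M n, +oo[)).
have mG : measurable G.
  apply: bigcapT_measurable => n; apply: measurableC; apply: measurableI; first exact: measurable_rball.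
  rewrite -[X in measurable X]setTI; apply: (measurableT_comp _ mf) => //; exact: measurable_itv.
have GP x : G x -> forall n : nat, `|x : E| <= n%:R -> `|f x| <= M n.
  move=> Gx n xn; rewrite leNgt; apply/negP => Mx; apply: (Gx n Logic.I); split => //=.
  by rewrite in_itv /= Mx.
exists (fun x : ME => f x * \1_G x); split.
- by apply: measurable_funM => //; exact: measurable_indic.
- move=> r; pose n := (Num.Def.truncn r).+1.
  have rn : r <= n%:R by apply: ltW; exact: truncnS_gt.
  exists (M n) => // x xr; rewrite indicE; have [/set_mem Gx|_] := boolP ((x : ME) \in G).
    by rewrite mulr1; apply: GP => //; exact: le_trans rn.
  by rewrite mulr0 normr0.
- have := ae_foralln MP; apply: filterS => x Hx.
  rewrite indicE mem_set ?mulr1// => n _ [xn]; rewrite /= in_itv /= andbT ltNge.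
  by rewrite Hx.
Qed.

Lemma transported_density_reversible X (q : E -> R) : Linfty_st lam T a -> transport_flow lam T a X ->
  measurable_fun setT (q : ME -> R) ->
  (forall r : R, exists2 M : R, 0 <= M & forall x, `|x| <= r -> `|q x| <= M) ->
  reversible lam T a (transported_density T X q).
Proof.
move=> aI flowX mq qloc; split.
  split; first by move=> t _; apply: (transported_density_Lloc T0 flowX mq qloc).
  split; first by move=> phi; apply: (transported_density_continuous lamP T0 flowX mq qloc).
  by move=> phi; apply: (transported_density_pde lamP T0 flowX mq qloc).
exists X; split => // t tT; apply: filterS (jac_Jac_ae lamP T0 flowX tT) => x ->.
by rewrite (transported_density_end T0 flowX) /transported_density clamp_id.
Qed.

(** A reversible solution comes with a flow [Y] of its own and with its own final value, equal to
    [f] off a null set. That set is harmless after composition with [Y], because the Jacobian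
    vanishes on its preimage; then [Y] is exchanged for [X]. Uniqueness is this formula applied to
    two solutions with the same flow. *)
Lemma reversible_formula X pi (f : E -> R) t : transport_flow lam T a X -> reversible lam T a pi ->
  {ae lam, forall x : ME, pi T x = f x} -> 0 <= t <= T ->
  {ae lam, forall x : ME, pi t x = f (X t x) * jac X t x}.
Proof.
move=> flowX [_ [Y [flowY piY]]] [Z [mZ Z0 ZP]] tT.
have H1 := piY t tT; have H2 := jac_Jac_ae lamP T0 flowY tT.
have H3 := flow_null lamP T0 flowY mZ Z0 tT.
have H4 := flow_independence lamP T0 f flowX flowY tT; have H5 := jac_Jac_ae lamP T0 flowX tT.
have H6 : {ae lam, forall x : ME, pi t x = f (Y t x) * Jac T Y t x}.
  apply: filterS3 H1 H2 H3 => x -> -> J0.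
  have [pf|pf] := pselect (pi T (Y t x) = f (Y t x)); first by rewrite pf.
  by rewrite J0 ?mulr0// clamp_id//; apply: ZP.
apply: filterS3 H4 H5 H6 => x; rewrite !clamp_id// => h4 h5 ->.
by rewrite h5 h4.
Qed.

End reversible.

Theorem mainTheorem8 (R : realType) (N : nat) (T : R)
  (lam : {measure set ME R N -> \bar R}) (a : R -> E R N -> E R N) (piT : E R N -> R) :
  0 < T -> is_lebesgue lam -> Linfty_st lam T a ->
  (exists X, transport_flow lam T a X) ->
  Lloc lam piT ->
  (exists pi, reversible lam T a pi /\ {ae lam, forall x : ME R N, pi T x = piT x}) /\
  (forall pi1 pi2, reversible lam T a pi1 -> reversible lam T a pi2 ->
     {ae lam, forall x : ME R N, pi1 T x = piT x} ->
     {ae lam, forall x : ME R N, pi2 T x = piT x} ->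
     forall t, 0 <= t <= T -> {ae lam, forall x : ME R N, pi1 t x = pi2 t x}) /\
  (forall X pi, transport_flow lam T a X -> reversible lam T a pi ->
     {ae lam, forall x : ME R N, pi T x = piT x} ->
     forall t, 0 <= t <= T ->
       {ae lam, forall x : ME R N, pi t x = piT (X t x) * jac X t x}).
Proof.
move=> T0 lamP aI [X flowX] fI; have [lam' lamE] := lebesgue_sigma_finite lamP; subst lam.
have formula Y pi : transport_flow lam' T a Y -> reversible lam' T a pi ->
    {ae lam', forall x : ME R N, pi T x = piT x} ->
    forall t, 0 <= t <= T -> {ae lam', forall x : ME R N, pi t x = piT (Y t x) * jac Y t x}.
  by move=> flowY rpi piTE t tT; exact: (reversible_formula lamP T0 flowY rpi piTE tT).
split; last split => //.
- have [q [mq qloc qE]] := Lloc_everywhere_bounded fI.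
  exists (transported_density T X q); split.
    exact: (transported_density_reversible lamP T0 aI flowX mq qloc).
  by apply: filterS qE => x <-; exact: (transported_density_end T0 flowX).
- move=> pi1 pi2 r1 r2 e1 e2 t tT.
  by apply: filterS2 (formula X pi1 flowX r1 e1 t tT) (formula X pi2 flowX r2 e2 t tT) => x -> ->.
Qed.
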